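(* Let $Y$ be a random simplicial complex on the vertex set $[n]=\{0,1,\dots,n\}$ drawn from the upper model with probability parameters $\{p_\sigma\}$ satisfying $0<p\le p_\sigma\le P<1$ for all $\sigma$, where $p=e^{-a}$ and $P=e^{-A}$ are constants independent of $n$ (the medial regime). Define the dual numbers $0<a'\le A'$ by $e^{-a}+e^{-a'}=1=e^{-A}+e^{-A'}$, and for $y>0$ put $\beta(n,y)=\log_2\ln n+\log_2\log_2\ln n-\log_2 y$. Then, with probability tending to $1$ as $n\to\infty$: (1) $\dim Y=n-1$; (2) for any fixed constant $\epsilon_0>0$, the maximal integer $d$ such that $Y$ contains the $(n-d)$-dimensional skeleton $\Delta_n^{(n-d)}$ of the simplex $\Delta_n$ satisfies $\lfloor\beta(n,A')\rfloor+1\le d\le \beta(n,a')+1+\epsilon_0$; (3) if the system of probability parameters is homogeneous, then for any fixed constants $\epsilon_0,\delta_0>0$ the reduced Betti numbers $b_j(Y)$ vanish for all $j$ except possibly those with $\log_2\ln n-\log_2 A'+1-\delta_0< n-j\le \beta(n,a')+1+\epsilon_0$.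
   Context: Upper model: for each non-empty proper subset $\sigma\subsetneq[n]$ (a simplex of dimension $|\sigma|-1$) a probability parameter $p_\sigma\in[0,1]$ is given. A random hypergraph $X$ is formed by including each non-empty proper subset $\sigma\subsetneq[n]$ independently with probability $p_\sigma$. The upper random simplicial complex $Y$ is the smallest simplicial complex containing $X$: $\sigma\in Y$ iff some $\tau\supseteq\sigma$ lies in $X$. $\Delta_n$ denotes the simplex on $[n]$ (all non-empty subsets of $[n]$) and $\Delta_n^{(k)}$ its $k$-skeleton. Homogeneous: $p_\sigma=p_{\sigma'}$ whenever $\dim\sigma=\dim\sigma'$.
   Formalization: In (2), ''the maximal integer d such that Y contains the (n-d)-dimensional skeleton'' is read as the minimal such d (the maximal skeleton contained in Y); literally, the maximal d is at least n with high probability, so the stated upper bound would fail. *)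

(* Defs.v *)
From HB Require Import structures.
From mathcomp Require Import all_boot all_order all_algebra.
From mathcomp Require Import all_classical all_reals all_analysis.
Set Implicit Arguments. Unset Strict Implicit. Unset Printing Implicit Defensive.
Import Order.TTheory GRing.Theory Num.Theory.
Local Open Scope ring_scope.

Definition admissible (n : nat) : {set {set 'I_n.+1}} :=
  [set s | (s != finset.set0) && (s != finset.setT)].

Definition upper_cplx (n : nat) (X : {set {set 'I_n.+1}}) : {set {set 'I_n.+1}} :=
  [set s | (s != finset.set0) && [exists t in X, s \subset t]].

(* dimension of a complex: max |s| - 1 (= -1 for the void complex) *)
Definition cdim (n : nat) (Y : {set {set 'I_n.+1}}) : int :=
  (\max_(s in Y) #|s|)%:Z - 1.

(* Y contains the (n-d)-skeleton of Delta_n : every non-empty s with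
   |s| <= n - d + 1 is a face of Y *)
Definition contains_skel (n : nat) (Y : {set {set 'I_n.+1}}) (d : nat) : bool :=
  [forall s : {set 'I_n.+1}, ((s != finset.set0) && (#|s| + d <= n.+1)%N) ==> (s \in Y)].

(* the least d (in 0..n+1; d = n+1 always works) with Delta_n^(n-d) in Y *)
Definition skel_codim (n : nat) (Y : {set {set 'I_n.+1}}) : nat :=
  find (contains_skel Y) (iota 0 n.+2).

(* Reduced simplicial homology with rational coefficients.  The empty face
   (dimension -1) is added when Y is non-empty (augmented chain complex). *)
Definition aug (n : nat) (Y : {set {set 'I_n.+1}}) : {set {set 'I_n.+1}} :=
  if Y == finset.set0 then Y else finset.set0 |: Y.

Definition faces (n : nat) (Y : {set {set 'I_n.+1}}) (k : nat) : {set {set 'I_n.+1}} :=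
  [set s in aug Y | #|s| == k].

Definition bd_entry (n : nat) (Y : {set {set 'I_n.+1}}) (k : nat)
    (t s : {set 'I_n.+1}) : rat :=
  if [&& s \in faces Y k, t \in faces Y k.-1, t \subset s & #|s :\: t| == 1%N]
  then \sum_(v in s :\: t) (-1) ^+ #|[set u in s | (u < v)%N]|
  else 0.

(* boundary map from (k-1)-chains to (k-2)-chains, as a matrix indexed by
   all subsets of [n] (rows: targets, columns: sources) *)
Definition bdmx (n : nat) (Y : {set {set 'I_n.+1}}) (k : nat) :
    'M[rat]_#|{set 'I_n.+1}| :=
  \matrix_(i, j) bd_entry Y k (enum_val i) (enum_val j).

(* reduced Betti number b_j(Y) = dim ker d_j - rank d_{j+1}, for j >= -1 *)
Definition rbetti (n : nat) (Y : {set {set 'I_n.+1}}) (j : int) : nat :=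
  if (j < -1)%R then 0%N else
  let k := absz (j + 1)%R in
  (#|faces Y k| - \rank (bdmx Y k) - \rank (bdmx Y k.+1))%N.

(* Probability, in the upper model with parameters ps, that the random
   complex Y satisfies E: X contains each admissible s independently with
   probability ps s. *)
Definition prob (R : realType) (n : nat) (ps : {set 'I_n.+1} -> R)
    (E : pred {set {set 'I_n.+1}}) : R :=
  \sum_(X : {set {set 'I_n.+1}} | (X \subset admissible n) && E (upper_cplx X))
     \prod_(s in admissible n) (if s \in X then ps s else 1 - ps s).

Definition homogeneous (R : realType) (ps : forall n : nat, {set 'I_n.+1} -> R) : Prop :=
  forall (n : nat) (s t : {set 'I_n.+1}), s \in admissible n -> t \in admissible n ->
    #|s| = #|t| -> ps n s = ps n t.

Definition log2 (R : realType) (x : R) : R := ln x / ln 2.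

Definition beta (R : realType) (n : nat) (y : R) : R :=
  log2 (ln (n%:R : R)) + log2 (log2 (ln (n%:R : R))) - log2 y.

(* Main.v *)
(** A set [s] is a non-face of [Y] exactly when [X] contains no superset of [s],
    and such avoidance events are independent for disjoint families of supersets.

    The largest skeleton is located by a union bound on one side and, on the
    other, by a second moment for the non-faces of a given codimension, each
    weighted by the inverse of its probability.

    For the Betti numbers, the homology of [Y] is controlled by that of the pair
    (simplex, [Y]), whose chains live on the non-faces: this replaces Alexander
    duality.  Above the window there are no relative chains.  Below it, Garland's
    method applies: the relative homology vanishes once the graph formed, for
    each set [r], by the [v] with [r - v] a non-face and the pairs with
    [r - v - w] a non-face has spectral gap close to 1.  Homogeneity makes each
    of these graphs an Erdos-Renyi graph on a random set of vertices, and its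
    gap comes from bounding a high moment of the centred adjacency matrix. *)

(* There are about $n^m$ links to control, with $m$ of order $\log_2\ln n$, so one link must fail
   with probability far below $n^{-m}$. A moment of bounded order does not give this. The trace is
   taken of order $2k$ with $k$ between $\ln n/4$ and $\ln n$, which brings the failure probability
   down to $e^{-c(\ln n)^2}$. The losses are then polynomial in $k$ and $m$, and the expected degree
   $T$ of a link must beat them. The margin [delta0] provides this: it makes $T$ at least
   $n^{2\eta}$ with $2\eta=1-2^{-\delta_0}$.

   Nothing is conditioned on [r] being a non-face. That event concerns the members of [X] containing
   [r], while the link graph of [r] is read off the members missing one or two points of [r]. When
   [r] is a face, its gap condition is void.

   The margin [eps0] has a similar role for the skeleton: it multiplies $2^d$ by $2^{\epsilon_0}$,
   so that $a'2^d$ wins against $\ln\binom{n+1}{d}$, which has the same order $\ln n\,\log_2\ln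
   n$. *)
Require Import Defs.
From mathcomp Require Import all_boot all_order all_algebra.
From mathcomp Require Import ring lra zify reals.
Set Implicit Arguments. Unset Strict Implicit. Unset Printing Implicit Defensive.
Import Order.TTheory GRing.Theory Num.Theory.
Local Open Scope ring_scope.

(** * Chains of the simplex *)

Section Simplex.
Variable n : nat.
Local Notation V := 'I_n.+1.
Implicit Types (v w : V) (s t r : {set V}) (z y : {set V} -> rat).

Definition sg v s : rat := (-1) ^+ #|[set u in s | (u < v)%N]|.

Lemma sgsq v s : sg v s * sg v s = 1.
Proof. by rewrite /sg -expr2 sqrr_sign. Qed.

Lemma sgU1 v u s : u \notin s -> sg v (u |: s) = (if (u < v)%N then -1 else 1) * sg v s.
Proof.
move=> us; rewrite /sg; case: ifP => uv.
  have -> : [set x in u |: s | (x < v)%N] = u |: [set x in s | (x < v)%N].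
    by apply/setP=> x; rewrite !inE; case: eqP => // ->; rewrite uv.
  by rewrite cardsU1 !inE (negbTE us) /= exprS.
have -> : [set x in u |: s | (x < v)%N] = [set x in s | (x < v)%N].
  by apply/setP=> x; rewrite !inE; case: eqP => [->|] //=; rewrite uv andbF.
by rewrite mul1r.
Qed.

Lemma sgU1id v s : v \notin s -> sg v (v |: s) = sg v s.
Proof. by move=> vs; rewrite sgU1 // ltnn mul1r. Qed.

(** This sign rule is the content of $\partial\partial=0$. It returns in [sum_links], where it turns
    link signs at $r$ into boundary signs at $r\setminus\{v,w\}$. *)
Lemma sg_swap v w t : v != w -> v \notin t -> w \notin t ->
  sg v t * sg w (v |: t) = - (sg w t * sg v (w |: t)).
Proof.
move=> vw vt wt; rewrite !sgU1 //.
have := vw; rewrite -val_eqE neq_ltn.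
by case: ltngtP => //= _ _; rewrite !(mulN1r, mul1r) !(mulrN, opprK) mulrC.
Qed.

(** Chains are functions on all subsets, the empty one included, so this is the augmented boundary
    of the simplex. *)
Definition bd z t : rat := \sum_(v | v \notin t) sg v t * z (v |: t).

Definition cone z s : rat := if ord0 \in s then z (s :\ ord0) else 0.

Lemma bd_bd z t : bd (bd z) t = 0.
Proof.
pose F v w := sg v t * (sg w (v |: t) * z (w |: (v |: t))).
have E : bd (bd z) t = \sum_(q : V * V | [&& q.1 \notin t, q.2 \notin t & q.1 != q.2])
    F q.1 q.2.
  rewrite /bd; under eq_bigr do rewrite mulr_sumr.
  rewrite pair_big_dep /=; apply: eq_bigl => -[v w] /=.
  by rewrite !inE negb_or (eq_sym w) andbA andbAC -andbA.
suff H : bd (bd z) t = - bd (bd z) t.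
  by apply/eqP; have /eqP := H; rewrite -addr_eq0 -mulr2n mulrn_eq0.
rewrite {1}E E -sumrN.
rewrite (reindex_inj (h := fun q : V * V => (q.2, q.1))) /=; last by move=> [a b] [c d] [-> ->].
apply: eq_big => [[v w]|[v w]] /=; first by rewrite andbCA eq_sym.
case/and3P=> wt vt wv; rewrite /F !mulrA sg_swap // !mulNr; congr (- (_ * z _)).
by rewrite setUCA.
Qed.

(** The simplex is contractible: coning from [ord0] is a contracting homotopy. As the least vertex,
    [ord0] itself carries sign $+1$ and reverses every other sign, so all remaining terms cancel. *)
Lemma bd_cone z t : bd (cone z) t + cone (bd z) t = z t.
Proof.
rewrite /cone; case: ifPn => ot; last first.
  rewrite addr0 /bd (bigD1 ord0) //= setU11 setU1K // big1 ?addr0; last first.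
    by move=> v /andP[vt v0]; rewrite !inE eq_sym (negbTE v0) (negbTE ot) mulr0.
  rewrite /sg (_ : [set _ in _ | _] = set0) ?cards0 ?mul1r //.
  by apply/setP => x; rewrite !inE ltn0 andbF.
set t' := t :\ ord0.
have o' : ord0 \notin t' by rewrite setD11.
have tE : t = ord0 |: t' by rewrite setD1K.
rewrite {2}/bd (bigD1 ord0) //= -tE.
have -> : sg ord0 t' = 1.
  rewrite /sg (_ : [set _ in _ | _] = set0) ?cards0 ?mul1r //.
  by apply/setP => x; rewrite !inE ltn0 andbF.
rewrite mul1r addrCA -[RHS]addr0; congr (_ + _).
rewrite /bd [X in X + _](eq_bigl (fun v => (v \notin t') && (v != ord0))); last first.
  by move=> v; rewrite tE !inE negb_or negb_and negbK andbC; case: eqP => //=.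
rewrite -big_split big1 //= => v /andP[vt' v0].
rewrite inE ot orbT [in sg v t]tE sgU1 // lt0n v0 mulN1r mulNr.
suff -> : (v |: t) :\ ord0 = v |: t' by rewrite addNr.
by rewrite setDUl; congr (_ :|: _); apply/setDidPl; rewrite disjoints1 inE.
Qed.

Lemma eq_bd z y t : (forall s, t \proper s -> z s = y s) -> bd z t = bd y t.
Proof.
move=> e; apply: eq_bigr => v vt; congr (_ * _); apply: e.
by rewrite properUr // sub1set.
Qed.

Lemma bdB z y t : bd (fun s => z s - y s) t = bd z t - bd y t.
Proof. by rewrite /bd -sumrB; apply: eq_bigr => v _; rewrite mulrBr. Qed.

(* [U] is the family of non-faces; the relative chains of size [k] are the
   functions supported on the members of [U] of cardinal [k]. *)
Definition rel_exact (U : pred {set V}) (k : nat) : Prop :=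
  forall z, (forall s, ~~ (U s && (#|s| == k)) -> z s = 0) ->
  (forall t, U t -> bd z t = 0) ->
  exists2 y, (forall s, ~~ (U s && (#|s| == k.+1)) -> y s = 0) &
             (forall s, U s -> bd y s = z s).

(** One step of the long exact sequence of the pair, done by hand. The cone over a cycle fills it in
    the simplex; the part of the cone on non-faces is a relative cycle; subtracting the boundary of
    a relative filling pushes the cone back among the faces. The connecting map accounts for the
    shift from [k] to [k.+1]. *)
Lemma abs_exact (U : pred {set V}) k :
  (forall s t, U s -> s \subset t -> U t) ->
  rel_exact U k.+1 ->
  forall z, (forall s, ~~ (~~ U s && (#|s| == k)) -> z s = 0) ->
  (forall t, bd z t = 0) ->
  exists2 y, (forall s, ~~ (~~ U s && (#|s| == k.+1)) -> y s = 0) &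
             (forall s, bd y s = z s).
Proof.
move=> upU ex z z0 bz.
have cbz t : cone (bd z) t = 0 by rewrite /cone bz if_same.
have bcz t : bd (cone z) t = z t by rewrite -[RHS](bd_cone z) cbz addr0.
have cz0 s : #|s| != k.+1 -> cone z s = 0.
  move=> sk; rewrite /cone; case: ifP => // os; apply: z0.
  by move: sk; rewrite (cardsD1 ord0 s) os add1n eqSS negb_and => ->; rewrite orbT.
pose zb s := if U s then cone z s else 0.
have [|t Ut|u u0 bu] := ex zb.
- move=> s; rewrite /zb; case: ifP => //= _; exact: cz0.
- transitivity (bd (cone z) t).
    (* At a non-face [t] the boundary reads only supersets of [t], all non-faces, so cutting the
       cone down to [U] changes nothing there. *)
    by apply: eq_bd => s /proper_sub ts; rewrite /zb (upU _ _ Ut ts).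
  by rewrite bcz z0 // Ut.
have bu0 s : #|s| != k.+1 -> bd u s = 0.
  move=> sk; rewrite /bd big1 // => v vs; rewrite u0 ?mulr0 //.
  by rewrite cardsU1 vs add1n eqSS negb_and sk orbT.
exists (fun s => cone z s - bd u s) => [s|s]; last by rewrite bdB bd_bd bcz subr0.
rewrite negb_and negbK => /orP[Us|sk]; last by rewrite cz0 // bu0 // subrr.
by rewrite bu // /zb Us subrr.
Qed.

End Simplex.

(** * Exactness by counting dimensions *)

Section LinearAlgebra.
Variables (F : fieldType) (I : finType).
Implicit Types (h : I -> I -> F) (z : I -> F).

Definition mxof h : 'M[F]_#|I| := \matrix_(i, j) h (enum_val i) (enum_val j).
Definition rvof z : 'rV[F]_#|I| := \row_j z (enum_val j).
(** Used through its row space, the functions supported on [P]. *)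
Definition diagof (P : pred I) : 'M[F]_#|I| := mxof (fun s t => ((s == t) && P s)%:R).

Lemma sum_enum_val (G : I -> F) : \sum_(i < #|I|) G (enum_val i) = \sum_s G s.
Proof. by rewrite [RHS](reindex _ (onW_bij _ (@enum_val_bij I))). Qed.

Lemma rvof_mul z h : rvof z *m mxof h = rvof (fun t => \sum_s z s * h s t).
Proof.
apply/rowP=> j; rewrite !mxE -[RHS]sum_enum_val.
by apply: eq_bigr => i _; rewrite !mxE.
Qed.

Lemma mxof_mul h h' : mxof h *m mxof h' = mxof (fun s r => \sum_t h s t * h' t r).
Proof.
apply/matrixP=> i j; rewrite !mxE -[RHS]sum_enum_val.
by apply: eq_bigr => l _; rewrite !mxE.
Qed.

Lemma rvofK (u : 'rV_#|I|) : u = rvof (fun s => u 0 (enum_rank s)).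
Proof. by apply/rowP=> j; rewrite mxE enum_valK. Qed.

Lemma rvof_eq z z' : rvof z = rvof z' -> z =1 z'.
Proof. by move=> /rowP e s; have := e (enum_rank s); rewrite !mxE enum_rankK. Qed.

Lemma eq_rvof z z' : z =1 z' -> rvof z = rvof z'.
Proof. by move=> e; apply/rowP=> j; rewrite !mxE. Qed.

Lemma rvof0 : rvof (fun=> 0) = 0.
Proof. by apply/rowP=> j; rewrite !mxE. Qed.

Lemma sum_diag (P : pred I) z t : \sum_s z s * ((s == t) && P s)%:R = z t * (P t)%:R.
Proof.
rewrite (bigD1 t) //= eqxx big1 ?addr0 // => s /negbTE ->; exact: mulr0.
Qed.

Lemma rvof_diag P z : (rvof z <= diagof P)%MS <-> (forall s, ~~ P s -> z s = 0).
Proof.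
split=> [/submxP[u]|z0].
  rewrite (rvofK u) rvof_mul => /rvof_eq e s /negbTE Ps.
  by rewrite e sum_diag Ps mulr0.
apply/submxP; exists (rvof z); rewrite rvof_mul; apply: eq_rvof => t.
rewrite sum_diag; case: (boolP (P t)) => Pt; first by rewrite mulr1.
by rewrite mulr0 z0.
Qed.

Lemma rank_diag P : \rank (diagof P) = #|P|.
Proof.
pose B : 'M[F]_(#|P|, #|I|) := \matrix_(i, j) (enum_val i == enum_val j)%:R.
have BB : B *m B^T = 1%:M.
  apply/matrixP=> i j; rewrite !mxE.
  under eq_bigr do rewrite !mxE.
  rewrite (sum_enum_val (fun s => (enum_val i == s)%:R * (enum_val j == s)%:R)).
  rewrite (bigD1 (enum_val i)) //= eqxx mul1r big1 ?addr0.
    by rewrite (inj_eq enum_val_inj) eq_sym.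
  by move=> s si; rewrite eq_sym (negbTE si) mul0r.
have DB : B^T *m B = diagof P.
  apply/matrixP=> i j; rewrite !mxE.
  under eq_bigr do rewrite !mxE.
  rewrite -(big_enum_val (A := P) (fun s => (s == enum_val i)%:R * (s == enum_val j)%:R)).
  rewrite big_mkcond (bigD1 (enum_val i)) //= eqxx mul1r big1 ?addr0.
    by rewrite unfold_in; case: (P _); rewrite ?andbF ?andbT.
  by move=> s si; rewrite (negbTE si) mul0r if_same.
have rB : \rank B = #|P|.
  apply/eqP; rewrite eqn_leq rank_leq_row /=.
  by rewrite -{1}(mxrank1 F #|P|) -BB mxrankM_maxl.
rewrite -DB -[RHS]rB; apply/eqP; rewrite eqn_leq mxrankM_maxr /=.
rewrite -{1}(mul1mx B) -BB -mulmxA; exact: mxrankM_maxr.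
Qed.

Lemma rank_row_mx m p q (A : 'M[F]_(m, p)) (B : 'M[F]_(m, q)) :
  (\rank (row_mx A B) <= \rank A + \rank B)%N.
Proof.
rewrite -mxrank_tr tr_row_mx -addsmxE -(mxrank_tr A) -(mxrank_tr B).
exact: mxrank_adds_leqif.
Qed.

(* Dimension count: injectivity of [(h1, w h2^T)] bounds [#|P|] by
   [rank h1 + rank h2], which forces [ker h1 = im h2]. *)
Lemma exact_of_injective (P : pred I) (h2 h1 : I -> I -> F) (w : I -> F) :
  (forall s t, ~~ P t -> h2 s t = 0) ->
  (forall s r, \sum_t h2 s t * h1 t r = 0) ->
  (forall z, (forall s, ~~ P s -> z s = 0) ->
     (forall r, \sum_t z t * h1 t r = 0) ->
     (forall s, \sum_t z t * (w t * h2 s t) = 0) -> forall s, z s = 0) ->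
  forall z, (forall s, ~~ P s -> z s = 0) -> (forall r, \sum_t z t * h1 t r = 0) ->
  exists u, forall t, z t = \sum_s u s * h2 s t.
Proof.
move=> h2P h21 inj z zP zh1.
pose D := diagof P; pose H1 := mxof h1; pose H2 := mxof h2.
pose G := mxof (fun t s => w t * h2 s t).
(* [G] is a diagonal matrix times the transpose of [H2], so the weights cannot raise the rank. *)
have rG : (\rank G <= \rank H2)%N.
  have -> : G = diag_mx (rvof w) *m H2^T.
    by apply/matrixP => i j; rewrite mul_diag_mx !mxE.
  by rewrite -(mxrank_tr H2) mxrankM_maxr.
pose K := (D :&: kermx H1)%MS.
have H2K : (H2 <= K)%MS.
  rewrite sub_capmx; apply/andP; split.
    apply/row_subP=> i; have -> : row i H2 = rvof (h2 (enum_val i)).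
      by apply/rowP=> j; rewrite !mxE.
    by apply/rvof_diag => t; apply: h2P.
  apply/sub_kermxP; rewrite mxof_mul; apply/matrixP => i j; rewrite !mxE; exact: h21.
have S0 : (D :&: kermx (row_mx H1 G))%MS = 0.
  apply/eqP/rowV0P => v; rewrite sub_capmx => /andP[].
  rewrite (rvofK v); set zz := fun s => _ => /rvof_diag vP /sub_kermxP.
  rewrite mul_mx_row -row_mx0 => /eq_row_mx[].
  rewrite !rvof_mul -!rvof0 => /rvof_eq e1 /rvof_eq e2.
  by apply: eq_rvof; apply: inj.
have KH2 : (K <= H2)%MS.
  rewrite -(mxrank_leqif_sup H2K).
  rewrite eqn_leq mxrankS //=.
  (* Rank-nullity on [D], once for [H1] with kernel [K] and once for the pair [H1], [G] with kernel
     zero; comparing the two bounds the rank of [K] by that of [H2]. *)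
  have e1 := mxrank_mul_ker D H1; have e2 := mxrank_mul_ker D (row_mx H1 G).
  rewrite S0 mxrank0 addn0 mul_mx_row in e2.
  rewrite -(leq_add2l (\rank (D *m H1))) e1 -e2.
  apply: leq_trans (rank_row_mx _ _) _.
  by rewrite leq_add2l (leq_trans (mxrankM_maxr _ _)).
have : (rvof z <= K)%MS.
  rewrite sub_capmx; apply/andP; split; first exact/rvof_diag.
  by apply/sub_kermxP; rewrite rvof_mul -rvof0; apply: eq_rvof.
move=> /submx_trans/(_ KH2)/submxP[u]; rewrite (rvofK u) rvof_mul => /rvof_eq e.
by exists (fun s => u 0 (enum_rank s)).
Qed.

(** Rank-nullity for [h1] on the functions supported on [P], whose kernel lies in the image of [h2].
    The subtraction in [rbetti] is truncated, so this inequality is all that the vanishing of a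
    Betti number requires. *)
Lemma card_le_rank (P : pred I) (h2 h1 : I -> I -> F) :
  (forall z, (forall s, ~~ P s -> z s = 0) -> (forall r, \sum_t z t * h1 t r = 0) ->
     exists u, forall t, z t = \sum_s u s * h2 s t) ->
  (#|P| <= \rank (mxof h1) + \rank (mxof h2))%N.
Proof.
move=> ex; rewrite -(rank_diag P) -(mxrank_mul_ker (diagof P) (mxof h1)).
rewrite leq_add ?mxrankM_maxr //; apply: mxrankS.
apply/rV_subP => v; rewrite sub_capmx => /andP[].
rewrite (rvofK v); set z := fun s => _ => /rvof_diag zP /sub_kermxP.
rewrite rvof_mul -rvof0 => /rvof_eq z1; have [u e] := ex z zP z1.
by apply/submxP; exists (rvof u); rewrite rvof_mul; apply: eq_rvof.
Qed.

End LinearAlgebra.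

(** * Garland's argument *)

Section Garland.
Variable n : nat.
Local Notation V := 'I_n.+1.
Implicit Types (v w : V) (s t r : {set V}) (z y : {set V} -> rat).

(** The matrix of [bd]. At most one [v] contributes; keeping a sum lets one exchange of summations
    give both the boundary ([sum_inc]) and its transpose ([sum_inc_tgt]). *)
Definition inc s t : rat := \sum_(v | v \notin t) (s == v |: t)%:R * sg v t.

Lemma sum_inc z t : \sum_s z s * inc s t = bd z t.
Proof.
rewrite /inc /bd; under eq_bigr do rewrite mulr_sumr.
rewrite exchange_big; apply: eq_bigr => v vt /=.
rewrite (bigD1 (v |: t)) //= eqxx mul1r mulrC big1 ?addr0 //.
by move=> s /negbTE ->; rewrite mul0r mulr0.
Qed.

Lemma eqU1D1 v s t : (v \notin t) && (s == v |: t) = (v \in s) && (t == s :\ v).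
Proof.
apply/andP/andP => -[h /eqP->]; first by rewrite setU11 setU1K.
by rewrite setD1K // setD11.
Qed.

Lemma inc_alt s t : inc s t = \sum_(v in s) (t == s :\ v)%:R * sg v s.
Proof.
rewrite /inc [LHS]big_mkcond [RHS]big_mkcond; apply: eq_bigr => v _ /=.
have := eqU1D1 v s t.
case: (boolP (v \notin t)) => vt; case: (boolP (v \in s)) => vs //=.
- move=> ->; case: (t =P s :\ v) => [te|_]; last by rewrite !mul0r.
  by rewrite -(setD1K vs) -te sgU1id.
- by move=> ->; rewrite mul0r.
- by move=> <-; rewrite mul0r.
Qed.

Lemma sum_inc_tgt z s : \sum_t z t * inc s t = \sum_(v in s) sg v s * z (s :\ v).
Proof.
under eq_bigr do rewrite inc_alt mulr_sumr.
rewrite exchange_big; apply: eq_bigr => v vt /=.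
rewrite (bigD1 (s :\ v)) //= eqxx mul1r mulrC big1 ?addr0 //.
by move=> t /negbTE ->; rewrite mul0r mulr0.
Qed.

Lemma inc_neq0 s t : inc s t != 0 -> (t \subset s) && (#|s| == #|t|.+1).
Proof.
apply: contraR => h; rewrite /inc big1 // => v vt.
case: (s =P v |: t) => [se|]; last by rewrite mul0r.
by move: h; rewrite se subsetUr cardsU1 vt eqxx.
Qed.

Lemma inc_entry s t : inc s t =
  if (t \subset s) && (#|s :\: t| == 1%N) then \sum_(v in s :\: t) sg v s else 0.
Proof.
case: ifPn => [/andP[ts /cards1P[x sx]]|h].
  have xs : (x \in s) && (x \notin t) by rewrite andbC -in_setD sx set11.
  have te : t = s :\ x.
    by rewrite -sx setDDr setDv set0U; apply/esym/setIidPr.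
  case/andP: xs => xs xt.
  rewrite inc_alt sx big_set1 (bigD1 x) //= -te eqxx mul1r big1 ?addr0 //.
  move=> v /andP[vs vx]; case: eqP; rewrite ?mul0r // => e.
  by have /setP/(_ v) := e; rewrite te !inE vs vx eqxx.
apply/eqP/negPn/negP => /inc_neq0/andP[ts /eqP c].
by case/negP: h; rewrite ts cardsD (setIidPr ts) c subSnn.
Qed.

Lemma sum_setU1 (R : nmodType) (G : {set V} -> V -> R) :
  \sum_(s : {set V}) \sum_(v in s) G s v = \sum_(s : {set V}) \sum_(v | v \notin s) G (v |: s) v.
Proof.
rewrite !pair_big_dep /=.
rewrite (reindex_onto (fun q : {set V} * V => (q.2 |: q.1, q.2))
                      (fun q => (q.1 :\ q.2, q.2))) /=.
  apply: eq_bigl => -[s v] /=; rewrite setU11 /= xpair_eqE eqxx andbT.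
  by apply/eqP/idP => [<-|vs]; rewrite ?setD11 // setU1K.
by move=> [s v] /= vs; rewrite setD1K.
Qed.

(** Garland's weight in complemented form: complements of non-faces form a simplicial complex, and
    the usual count of cofacets becomes a count of facets. *)
Definition wt (U : pred {set V}) s : nat := #|[set w in s | U (s :\ w)]|.

(** [wt] is the degree in the link graph of [r], so on functions orthogonal to the degrees the
    normalised adjacency form is at most $1/m$. Rational values suffice, since the homology has
    rational coefficients. *)
Definition spectral_gap (U : pred {set V}) (m : nat) (r : {set V}) : Prop :=
  forall f : V -> rat, (forall v, ~~ ((v \in r) && U (r :\ v)) -> f v = 0) ->
  \sum_(v in r) (wt U (r :\ v))%:R * f v = 0 ->
  m%:R * \sum_(v in r) \sum_(w in r :\ v | U (r :\ v :\ w)) f v * f w <=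
  \sum_(v in r) (wt U (r :\ v))%:R * f v ^+ 2.

Lemma sum_sq_wt (U : pred {set V}) z :
  \sum_t (U t)%:R * (\sum_(v | v \notin t) z (v |: t) ^+ 2) =
  \sum_s (wt U s)%:R * z s ^+ 2.
Proof.
under eq_bigr do rewrite mulr_sumr.
rewrite (eq_bigr (fun s => \sum_(v | v \notin s) (U ((v |: s) :\ v))%:R * z (v |: s) ^+ 2)).
  rewrite -(sum_setU1 (fun s v => (U (s :\ v))%:R * z s ^+ 2)).
  apply: eq_bigr => s _; rewrite -mulr_suml; congr (_ * _).
  rewrite -natr_sum; congr _%:R; rewrite /wt -sum1_card.
  rewrite [RHS](eq_bigl (fun v => (v \in s) && U (s :\ v))); last by move=> v; rewrite inE.
  by rewrite big_mkcondr.
by move=> s _; apply: eq_bigr => v vs; rewrite setU1K.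
Qed.

(* Each pair [t < t + v + w] contributes [sg v r * sg w r = - sg v t * sg w t],
   so for a relative cycle the quadratic forms of all links add up to the
   weighted norm. *)
Lemma sum_links (U : pred {set V}) z :
  (forall t, U t -> bd z t = 0) ->
  \sum_(r : {set V}) \sum_(v in r) \sum_(w in r :\ v | U (r :\ v :\ w))
     (sg v r * z (r :\ v)) * (sg w r * z (r :\ w)) =
  \sum_s (wt U s)%:R * z s ^+ 2.
Proof.
move=> bz; rewrite sum_setU1 -sum_sq_wt.
transitivity (\sum_(s : {set V}) \sum_(w in s) \sum_(v | v \notin s) (U (s :\ w))%:R *
  ((sg v (v |: s) * z s) * (sg w (v |: s) * z ((v |: s) :\ w)))).
  apply: eq_bigr => s _; rewrite exchange_big /=; apply: eq_bigr => v vs.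
  rewrite setU1K // big_mkcondr; apply: eq_bigr => w _ /=.
  by case: (U _); rewrite ?mul1r ?mul0r.
rewrite sum_setU1; apply: eq_bigr => t _.
case: (boolP (U t)) => Ut; last first.
  rewrite mul0r big1 // => w wt; rewrite big1 // => v _.
  by rewrite setU1K // (negbTE Ut) mul0r.
(* The square of $\partial z(t)=0$ is subtracted: its diagonal cancels the squares, and its cross
   terms are the link terms up to the sign rule. *)
have -> : true%:R * (\sum_(v | v \notin t) z (v |: t) ^+ 2) =
    (\sum_(v | v \notin t) z (v |: t) ^+ 2) - bd z t * bd z t.
  by rewrite bz // mulr0 subr0 mul1r.
rewrite {2}/bd mulr_sumr -sumrB; apply: eq_bigr => w wt.
rewrite [X in _ - X]mulrC [bd z t]/bd mulr_sumr [X in _ - X](bigD1 w) //= opprD addrA.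
have -> : sg w t * z (w |: t) * (sg w t * z (w |: t)) = z (w |: t) ^+ 2.
  by rewrite mulrACA sgsq mul1r expr2.
rewrite subrr add0r -sumrN; apply: eq_big => [v|v].
  by rewrite !inE negb_or andbC.
rewrite !inE negb_or => /andP[vw vt].
rewrite setU1K // Ut mul1r.
have -> : (v |: (w |: t)) :\ w = v |: t by rewrite setUCA setU1K // !inE negb_or eq_sym vw.
have -> : sg v (v |: (w |: t)) * z (w |: t) * (sg w (v |: (w |: t)) * z (v |: t)) =
  sg v (v |: (w |: t)) * sg w (v |: (w |: t)) * (z (w |: t) * z (v |: t)).
  by rewrite mulrACA.
rewrite sgU1id ?inE ?negb_or ?vw //.
rewrite (setUCA [set v]) sgU1id; last by rewrite !inE negb_or eq_sym vw.
have h : sg v (w |: t) * sg w (v |: t) = - (sg w t * sg v t).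
  rewrite -[LHS]mul1r -(sgsq v t).
  by rewrite mulrACA sg_swap // mulrN mulrACA sgsq mulr1 mulrC.
by rewrite h mulNr mulrACA.
Qed.

(** The last condition on [z] makes its restriction to each link orthogonal to the degrees, so each
    gap applies. Summed over [r], the link forms give the norm $S$ by [sum_links], while the local
    norms give $NS$, since a [K]-set lies in $N=n+1-K$ sets one larger. Hence $2NS\le NS$ and $S=0$;
    the factor 2 is the slack that forces this. *)
Lemma garland (U : pred {set V}) (K : nat) z :
  (K <= n)%N ->
  (forall s t, U s -> s \subset t -> U t) ->
  (forall s, U s -> #|s| = K -> (0 < wt U s)%N) ->
  (forall r, #|r| = K.+1 -> spectral_gap U (2 * (n.+1 - K)) r) ->
  (forall s, ~~ (U s && (#|s| == K)) -> z s = 0) ->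
  (forall t, U t -> bd z t = 0) ->
  (forall r, \sum_(v in r) sg v r * ((wt U (r :\ v))%:R * z (r :\ v)) = 0) ->
  forall s, z s = 0.
Proof.
move=> Kn upU wpos gap zs bz cz.
pose S := \sum_s (wt U s)%:R * z s ^+ 2.
pose N := (n.+1 - K)%N.
have zK s : #|s| != K -> z s = 0 by move=> sK; apply: zs; rewrite negb_and sK orbT.
have e1 : \sum_(r : {set V}) \sum_(v in r) (wt U (r :\ v))%:R * (sg v r * z (r :\ v)) ^+ 2 = N%:R * S.
  rewrite sum_setU1 mulr_sumr; apply: eq_bigr => s _.
  rewrite (eq_bigr (fun _ => (wt U s)%:R * z s ^+ 2)); last first.
    by move=> v vs; rewrite setU1K // exprMn expr2 sgsq mul1r.
  rewrite sumr_const -[LHS]mulr_natl; case: (#|s| =P K) => [sK|/eqP/zK ->]; last first.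
    by rewrite expr0n /= !mulr0.
  by congr (_%:R * _); rewrite /N -sK -[X in (X - _)%N](card_ord n.+1) -(cardC s) addKn.
have e2 := sum_links bz.
have le : (2 * N)%:R * S <= N%:R * S.
  rewrite /S -{1}e2 -[N%:R * _]e1 mulr_sumr; apply: ler_sum => r _.
  case: (#|r| =P K.+1) => [rK|/eqP rK]; last first.
    have z0 v : v \in r -> z (r :\ v) = 0.
      by move=> vr; apply: zK; move: rK; rewrite (cardsD1 v) vr eqSS.
    rewrite !big1 ?mulr0 // => v vr; first by rewrite z0 // mulr0 expr0n mulr0.
    by rewrite big1 // => w _; rewrite z0 // mulr0 mul0r.
  pose f v := if v \in r then sg v r * z (r :\ v) else 0.
  have fE v : v \in r -> f v = sg v r * z (r :\ v) by rewrite /f => ->.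
  have l1 : \sum_(v in r) (wt U (r :\ v))%:R * (sg v r * z (r :\ v)) ^+ 2 =
    \sum_(v in r) (wt U (r :\ v))%:R * f v ^+ 2.
    by apply: eq_bigr => v vr; rewrite fE.
  have l2 : \sum_(v in r) \sum_(w in r :\ v | U (r :\ v :\ w))
      sg v r * z (r :\ v) * (sg w r * z (r :\ w)) =
    \sum_(v in r) \sum_(w in r :\ v | U (r :\ v :\ w)) f v * f w.
    apply: eq_bigr => v vr; apply: eq_bigr => w /andP[].
    by rewrite inE => /andP[_ wr] _; rewrite !fE.
  rewrite l1 l2; apply: gap => // [v|].
    rewrite /f negb_and; case: ifP => //= vr h.
    by rewrite zs ?mulr0 // negb_and h.
  by rewrite -[RHS](cz r); apply: eq_bigr => v vr; rewrite fE // mulrCA.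
have NN : (0 < N)%N by rewrite subn_gt0.
have S0 : S <= 0.
  move: le; rewrite natrM -mulrA -subr_le0 -[X in _ - X]mul1r -mulrBl.
  by rewrite (_ : 2%:R - 1 = 1) // mul1r pmulr_rle0 // ltr0n.
have wge s : 0 <= (wt U s)%:R * z s ^+ 2 by rewrite mulr_ge0 ?sqr_ge0.
have /eqP : S = 0 by apply/eqP; rewrite eq_le S0 sumr_ge0.
rewrite psumr_eq0 // => /allP h s.
case: (boolP (U s && (#|s| == K))) => [/andP[Us /eqP sK]|/zs //].
have := h s (mem_index_enum _); rewrite /= mulf_eq0 pnatr_eq0 -leqn0 leqNgt wpos //=.
by rewrite sqrf_eq0 => /eqP.
Qed.

End Garland.

(** * From spectral gaps to vanishing Betti numbers *)

Section Exactness.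
Variable n : nat.
Local Notation V := 'I_n.+1.
Implicit Types (v w : V) (s t r : {set V}) (z y : {set V} -> rat).

(** No orthogonal decomposition is used: [exact_of_injective] with weights [wt] asks that a chain
    killed by the boundary and by the weighted adjoint be zero, and this is [garland]. *)
Lemma rel_exact_of_gap (U : pred {set V}) (K : nat) :
  (K <= n)%N ->
  (forall s t, U s -> s \subset t -> U t) ->
  (forall s, U s -> #|s| = K -> (0 < wt U s)%N) ->
  (forall r, #|r| = K.+1 -> spectral_gap U (2 * (n.+1 - K)) r) ->
  rel_exact U K.
Proof.
move=> Kn upU wpos gap z zs bz.
pose P s := U s && (#|s| == K).
pose Q s := U s && (#|s| == K.+1).
pose h1 s t := if P s && U t then inc s t else 0.
pose h2 s t := if Q s && P t then inc s t else 0.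
have P1 y t : (forall s, ~~ P s -> y s = 0) -> U t -> \sum_s y s * h1 s t = bd y t.
  move=> y0 Ut; rewrite -sum_inc; apply: eq_bigr => s _; rewrite /h1 Ut andbT.
  by case: ifPn => // /y0 ->; rewrite !mul0r.
have [|s r|y y0 y1 y2|//||u zu] := @exact_of_injective _ _ P h2 h1 (fun s => (wt U s)%:R) _ _ _ z.
- by move=> s t Pt; rewrite /h2 (negbTE Pt) andbF.
- case: (boolP (U r)) => Ur; last first.
    by rewrite big1 // => t _; rewrite /h1 (negbTE Ur) andbF mulr0.
  rewrite P1 //; last by move=> t Pt; rewrite /h2 (negbTE Pt) andbF.
  case: (boolP (Q s)) => Qs; last first.
    by rewrite /bd big1 // => v _; rewrite /h2 (negbTE Qs) mulr0.
  (* The composite is $\partial\partial$ of the indicator of [s]; restricting the intermediate sets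
     to [U] loses nothing, since everything above [r] is in [U]. *)
  pose d : {set V} -> rat := fun s' => (s' == s)%:R.
  have dE t : bd d t = inc s t.
    rewrite -sum_inc (bigD1 s) //= /d eqxx mul1r big1 ?addr0 // => t' /negbTE ->.
    by rewrite mul0r.
  transitivity (bd (bd d) r); last exact: bd_bd.
  apply: eq_bd => t /proper_sub rt; rewrite dE /h2 Qs /=; case: ifPn => //.
  rewrite negb_and (upU _ _ Ur rt) /= => tK; apply/esym/eqP/negPn/negP => /inc_neq0.
  by case/andP: Qs => _ /eqP ->; rewrite eqSS eq_sym (negbTE tK) andbF.
- apply: (garland Kn upU wpos gap y0) => [t Ut|r]; first by rewrite -P1.
  case: (boolP (U r)) => Ur; last first.
    rewrite big1 // => v vr; rewrite y0 ?mulr0 // /P negb_and.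
    by apply/orP; left; apply: contra Ur => /upU; apply; apply: subD1set.
  case: (#|r| =P K.+1) => [rK|/eqP rK]; last first.
    rewrite big1 // => v vr; rewrite y0 ?mulr0 // /P negb_and.
    by apply/orP; right; move: rK; rewrite (cardsD1 v) vr eqSS.
  rewrite -(sum_inc_tgt (fun t => (wt U t)%:R * y t)) -[RHS](y2 r); apply: eq_bigr => t _.
  rewrite /h2 /Q Ur rK eqxx /=; case: ifPn => [_|/y0 ->]; last by rewrite mulr0 !mul0r.
  by rewrite mulrCA mulrA.
- move=> r; case: (boolP (U r)) => Ur; first by rewrite P1 ?bz.
  by rewrite big1 // => t _; rewrite /h1 (negbTE Ur) andbF mulr0.
exists (fun s => if Q s then u s else 0) => [s /negbTE|t Ut]; first by rewrite /Q => ->.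
rewrite -sum_inc.
case: (boolP (P t)) => Pt.
  by rewrite zu; apply: eq_bigr => s _; rewrite /h2 Pt andbT; case: (Q s); rewrite ?mul0r ?mulr0.
rewrite zs // big1 // => s _; case: ifPn => [/andP[_ /eqP sK]|_]; last by rewrite mul0r.
apply/eqP; rewrite mulf_eq0; apply/orP; right; apply/negPn/negP => /inc_neq0.
rewrite sK eqSS eq_sym; move: Pt; rewrite /P Ut /= => /negbTE ->.
by rewrite andbF.
Qed.

(** Above [setT] there is no link for Garland's argument, but the boundary at a single non-face of
    codimension one already reads off the coefficient of [setT]. *)
Lemma rel_exact_top (U : pred {set V}) v : U (setT :\ v) -> rel_exact U n.+1.
Proof.
move=> Uv z z0 bz; suff zT s : z s = 0.
  by exists (fun=> 0) => // s _; rewrite zT /bd big1 // => w _; rewrite mulr0.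
case: (boolP (s == setT)) => [/eqP ->|sT]; last first.
  apply: z0; rewrite negb_and; apply/orP; right.
  by apply: contra sT => /eqP c; rewrite eqEcard subsetT [#|[set: _]|]cardsT card_ord c leqnn.
have := bz _ Uv; rewrite /bd (bigD1 v) ?inE ?eqxx //= setD1K ?inE // big1 ?addr0.
  by move/eqP; rewrite mulf_eq0 signr_eq0 => /eqP.
by move=> w /andP[]; rewrite !inE andbT negbK => ->.
Qed.

Lemma rel_exact_empty (U : pred {set V}) k :
  (forall s, U s -> #|s| != k) -> rel_exact U k.
Proof.
move=> Uk z z0 _; have zE s : z s = 0.
  by apply: z0; case: (boolP (U s)) => //= /Uk.
by exists (fun=> 0) => // s _; rewrite zE /bd big1 // => w _; rewrite mulr0.
Qed.

Definition nonface (Y : {set {set V}}) : pred {set V} := fun s => s \notin aug Y.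

(** With $j=k-1$, [k] is the cardinal of the faces carrying the chains; relative exactness is
    required one higher because of the shift in [abs_exact]. *)
Lemma rbetti_eq0 (Y : {set {set V}}) (k : nat) :
  (forall s t, nonface Y s -> s \subset t -> nonface Y t) ->
  rel_exact (nonface Y) k.+1 -> rbetti Y (k%:Z - 1) = 0%N.
Proof.
move=> up ex; rewrite /rbetti; case: ifP => // _.
rewrite subrK absz_nat; apply/eqP; rewrite -subnDA subn_eq0.
pose h l s t := bd_entry Y l t s.
have hE l : bdmx Y l = (mxof (h l))^T by apply/matrixP=> i j; rewrite !mxE.
rewrite !hE !mxrank_tr.
have hi l s t : h l s t = if (s \in faces Y l) && (t \in faces Y l.-1) then inc s t else 0.
  rewrite /h /bd_entry inc_entry.
  by case: (s \in _); case: (t \in _) => //=; rewrite if_same.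
apply: (@card_le_rank _ _ (mem (faces Y k))) => z z0 z1.
have fE l s : (s \in faces Y l) = (~~ nonface Y s && (#|s| == l)).
  by rewrite inE /nonface negbK.
have [| |y y0 yz] := abs_exact up ex (z := z).
- by move=> s; rewrite -fE; apply: z0.
- move=> t; case: (boolP (nonface Y t)) => Ut.
    rewrite /bd big1 // => v vt; rewrite z0 ?mulr0 // inE [_ \in faces _ _]fE.
    by rewrite (up _ _ Ut) // subsetUr.
  rewrite -(z1 t) -sum_inc; apply: eq_bigr => s _; rewrite hi.
  case: ifPn => //; rewrite negb_and => /orP[sk|tk]; first by rewrite z0 ?mul0r.
  have [/eqP->|/inc_neq0/andP[_ /eqP sc]] := boolP (inc s t == 0) => //.
  rewrite z0 ?mul0r // [mem _ _]fE; move: tk; rewrite fE Ut /= sc => tk.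
  by rewrite negb_and; apply/orP; right; apply: contra tk => /eqP <-.
exists y => t; rewrite -yz -sum_inc; apply: eq_bigr => s _; rewrite hi /=.
case: ifPn => //; rewrite negb_and => /orP[sk|tk].
  by rewrite y0 ?mul0r // -fE.
have [/eqP->|/inc_neq0/andP[ts /eqP sc]] := boolP (inc s t == 0) => //.
rewrite y0 ?mul0r //; move: tk; rewrite fE /= sc eqSS; apply: contra.
by case/andP => Us ->; rewrite andbT; apply: contra Us => /up; apply.
Qed.

End Exactness.

(** * Random hypergraphs *)

Section Expectation.
Variables (R : realFieldType) (T : finType) (p : T -> R).
Implicit Types (X S : {set T}) (F G : {set T} -> R) (E : pred {set T}).

Definition wtX X : R := \prod_i (if i \in X then p i else 1 - p i).
Definition Ex F : R := \sum_X wtX X * F X.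
Definition Pr E : R := Ex (fun X => (E X)%:R).
Definition avoid S X : bool := [disjoint S & X].
Definition pavoid S : R := \prod_(s in S) (1 - p s).

Lemma eq_Ex F G : F =1 G -> Ex F = Ex G.
Proof. by move=> e; apply: eq_bigr => X _; rewrite e. Qed.

Lemma ExD F G : Ex (fun X => F X + G X) = Ex F + Ex G.
Proof. by rewrite -big_split; apply: eq_bigr => X _; rewrite mulrDr. Qed.

Lemma ExZ c F : Ex (fun X => c * F X) = c * Ex F.
Proof. by rewrite mulr_sumr; apply: eq_bigr => X _; rewrite mulrCA. Qed.

Lemma Ex_sum (I : Type) (r : seq I) (P : pred I) (F : I -> {set T} -> R) :
  Ex (fun X => \sum_(i <- r | P i) F i X) = \sum_(i <- r | P i) Ex (F i).
Proof.
by rewrite exchange_big; apply: eq_bigr => X _; rewrite mulr_sumr.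
Qed.

(** Setting the parameter to 0 on [S], but keeping $1-p$ for absent elements, kills exactly the
    hypergraphs meeting [S]; the sum of weights then factors over the elements. *)
Lemma Ex_avoid S : Pr (avoid S) = pavoid S.
Proof.
pose f i := if i \in S then 0 else p i.
transitivity (\sum_(X in {set T}) \prod_i (if i \in X then f i else 1 - p i)).
  apply: eq_bigr => X _; rewrite /wtX /f /avoid.
  case: (boolP [disjoint S & X]) => [/pred0P d|/pred0Pn[s /andP[sS sX]]].
    rewrite mulr1; apply: eq_bigr => i _; case: ifP => // iX.
    by case: ifP => // iS; have := d i; rewrite /= iS iX.
  have {}sX : s \in X := sX; have {}sS : s \in S := sS.
  by rewrite mulr0 [RHS](bigD1 s) //= sX sS mul0r.
rewrite -(bigA_distr _ _ f) /pavoid [RHS]big_mkcond; apply: eq_bigr => i _.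
by rewrite /f /=; case: ifP => _; lra.
Qed.

Lemma pavoid0 : pavoid set0 = 1.
Proof. by rewrite /pavoid big_set0. Qed.

Lemma Ex1 : Ex (fun=> 1) = 1.
Proof.
rewrite -[RHS]pavoid0 -Ex_avoid; apply: eq_Ex => X.
by rewrite /avoid -setI_eq0 set0I eqxx.
Qed.

Lemma Excst c : Ex (fun=> c) = c.
Proof. by rewrite -[RHS]mulr1 -Ex1 -ExZ; apply: eq_Ex => X; rewrite mulr1. Qed.

Lemma pavoidU S S' : [disjoint S & S'] -> pavoid (S :|: S') = pavoid S * pavoid S'.
Proof. by move=> d; rewrite /pavoid -bigU //; apply: eq_bigl => i; rewrite !inE. Qed.

Lemma avoidU S S' X : avoid (S :|: S') X = avoid S X && avoid S' X.
Proof. by rewrite /avoid -!setI_eq0 setIUl setU_eq0. Qed.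

(** Independence in a form that covers all uses, since any function of a 0/1 indicator is affine.
    Expanding over subsets [J] leaves avoidances of disjoint unions, whose probability is
    multiplicative. *)
Lemma Ex_indep (B : finType) (S : B -> {set T}) (a b : B -> R) :
  (forall i j, i != j -> [disjoint S i & S j]) ->
  Ex (fun X => \prod_i (a i + b i * (avoid (S i) X)%:R)) =
  \prod_i (a i + b i * pavoid (S i)).
Proof.
move=> dS.
under eq_Ex => X do under eq_bigr do rewrite addrC.
under [RHS]eq_bigr do rewrite addrC.
rewrite bigA_distr; under eq_Ex do rewrite bigA_distr.
rewrite Ex_sum; apply: eq_bigr => J _.
pose SJ i := if i \in J then S i else set0.
pose c := \prod_i (if i \in J then b i else a i).
transitivity (c * Pr (avoid (\bigcup_i SJ i))); last first.
  rewrite Ex_avoid /pavoid partition_disjoint_bigcup /=; last first.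
    move=> i j ij; rewrite /SJ; case: (i \in J); case: (j \in J); rewrite ?dS //;
    by rewrite -setI_eq0 ?set0I ?setI0.
  rewrite -big_split; apply: eq_bigr => i _; rewrite /SJ /=.
  by case: ifP => //; rewrite big_set0 mulr1.
rewrite -ExZ; apply: eq_Ex => X.
have -> : avoid (\bigcup_i SJ i) X = [forall i, avoid (SJ i) X].
  apply/idP/forallP => [h i|h].
    by apply: disjointWl h; apply: bigcup_sup.
  apply/pred0P => s /=; apply/negP => /andP[/bigcupP[i _ si] sX].
  by have /pred0P/(_ s)/= := h i; rewrite si sX.
have -> : [forall i, avoid (SJ i) X]%:R = \prod_i ((avoid (SJ i) X)%:R : R).
  case: (boolP [forall _, _]) => [/forallP h|/forallPn[i h]].
    by rewrite big1 // => i _; rewrite h.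
  by rewrite (bigD1 i) //= (negbTE h) mul0r.
rewrite -big_split; apply: eq_bigr => i _ /=; rewrite /SJ; case: ifP => // _.
by rewrite /avoid -setI_eq0 set0I eqxx mulr1.
Qed.

Hypothesis p01 : forall i, 0 <= p i <= 1.

Lemma wtX_ge0 X : 0 <= wtX X.
Proof.
apply: prodr_ge0 => i _; have /andP[p0 p1] := p01 i.
by case: ifP => _; rewrite ?subr_ge0.
Qed.

Lemma le_Ex F G : (forall X, F X <= G X) -> Ex F <= Ex G.
Proof. by move=> h; apply: ler_sum => X _; rewrite ler_wpM2l ?wtX_ge0. Qed.

Lemma Pr_le1 E : Pr E <= 1.
Proof. by rewrite -Ex1; apply: le_Ex => X; case: (E X). Qed.

Lemma le_Pr E E' : (forall X, E X -> E' X) -> Pr E <= Pr E'.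
Proof. by move=> h; apply: le_Ex => X; rewrite ler_nat; case: (E X) (h X) => // ->. Qed.

Lemma PrC E : Pr E = 1 - Pr (predC E).
Proof.
rewrite -[1]Ex1 -mulN1r -ExZ -ExD; apply: eq_Ex => X /=.
by case: (E X) => /=; rewrite ?mulr0 ?mulr1 ?addr0 ?subrr.
Qed.

Lemma Pr_union (I : finType) (P : pred I) (E : I -> pred {set T}) :
  Pr (fun X => [exists (i | P i), E i X]) <= \sum_(i | P i) Pr (E i).
Proof.
rewrite -Ex_sum; apply: le_Ex => X.
case: (boolP [exists (_ | _), _]) => [/existsP[i /andP[Pi Ei]]|_]; last exact: sumr_ge0.
by rewrite (bigD1 i) //= Ei lerDl sumr_ge0.
Qed.

Lemma Pr_or E E' : Pr (fun X => E X || E' X) <= Pr E + Pr E'.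
Proof. by rewrite -ExD; apply: le_Ex => X; rewrite -natrD ler_nat; case: (E X); case: (E' X). Qed.

Lemma markov F c : 0 < c -> (forall X, 0 <= F X) ->
  Pr (fun X => c < F X) <= Ex F / c.
Proof.
move=> c0 F0; rewrite mulrC -ExZ; apply: le_Ex => X.
case: (ltP c (F X)) => h; last by rewrite mulr_ge0 // invr_ge0 ltW.
by rewrite mulrC ler_pdivlMr // mul1r ltW.
Qed.

Lemma pavoid_ge0 S : 0 <= pavoid S.
Proof. by apply: prodr_ge0 => i _; rewrite subr_ge0; case/andP: (p01 i). Qed.

Lemma pavoid_le1 S : pavoid S <= 1.
Proof. by rewrite -Ex_avoid Pr_le1. Qed.

(* Markov's inequality for [2^-k], [k] the number of events that occur. *)
Lemma lower_tail (B : finType) (W : {set B}) (S : B -> {set T}) (x : R) (t : nat) :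
  (forall i j, i != j -> [disjoint S i & S j]) ->
  (forall i, i \in W -> pavoid (S i) = x) ->
  Pr (fun X => (\sum_(i in W) avoid (S i) X < t)%N) <=
  2 ^+ t * (1 - x / 2) ^+ #|W|.
Proof.
move=> dS Sx.
pose a (i : B) : R := 1; pose b i : R := if i \in W then - 2^-1 else 0.
have e : Ex (fun X => \prod_i (a i + b i * (avoid (S i) X)%:R)) = (1 - x / 2) ^+ #|W|.
  rewrite Ex_indep // /a /b -prodr_const [RHS]big_mkcond; apply: eq_bigr => i _ /=.
  by case: ifP => [/Sx ->|_]; rewrite ?mul0r ?addr0 // mulNr mulrC.
rewrite -e -ExZ; apply: le_Ex => X.
have -> : \prod_i (a i + b i * (avoid (S i) X)%:R) =
    2^-1 ^+ (\sum_(i in W) avoid (S i) X).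
  rewrite expr_sum [RHS]big_mkcond; apply: eq_bigr => i _; rewrite /a /b.
  by case: ifP => _; rewrite ?mul0r ?addr0 //; case: (avoid _ _); rewrite /= ?expr1 ?expr0; lra.
set k := (\sum_(_ in _) _)%N; case: ltnP => kt /=; last first.
  by rewrite mulr_ge0 ?exprn_ge0 //; lra.
rewrite -(subnK (ltnW kt)) exprD -mulrA -exprMn (_ : 2 * 2^-1 = 1) ?expr1n ?mulr1; last by lra.
by apply: exprn_ege1; lra.
Qed.

End Expectation.

(** * Norm and trace *)

Lemma big_tuple_cons (R : nmodType) (T : finType) (k : nat) (F : seq T -> R) :
  \sum_(s : k.+1.-tuple T) F s = \sum_x \sum_(s : k.-tuple T) F (x :: s).
Proof.
rewrite pair_bigA /=.
rewrite (reindex (fun q : T * k.-tuple T => [tuple of q.1 :: q.2])) //=.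
exists (fun s => (thead s, [tuple of behead s])) => [[x s] _|s _] /=.
  by congr (_, _); apply: val_inj.
by rewrite -tuple_eta.
Qed.

Lemma big_tuple_nil (R : nmodType) (T : finType) (F : seq T -> R) :
  \sum_(s : 0.-tuple T) F s = F [::].
Proof.
rewrite (big_pred1 [tuple]) // => s; by rewrite [s]tuple0; apply/esym/eqP.
Qed.

Section Norm.
Variables (R : realFieldType) (V : finType).
Implicit Types (f g : V -> R) (M : V -> V -> R).

Definition dot f g : R := \sum_v f v * g v.

Lemma dot_ge0 f : 0 <= dot f f.
Proof. by apply: sumr_ge0 => v _; rewrite -expr2 sqr_ge0. Qed.

Lemma cauchy_schwarz f g : dot f g ^+ 2 <= dot f f * dot g g.
Proof.
have : 0 <= \sum_v \sum_w (f v * g w - f w * g v) ^+ 2.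
  by apply: sumr_ge0 => v _; apply: sumr_ge0 => w _; rewrite sqr_ge0.
suff -> : \sum_v \sum_w (f v * g w - f w * g v) ^+ 2 =
    2 * (dot f f * dot g g - dot f g ^+ 2) by rewrite pmulr_rge0 ?subr_ge0; lra.
pose A v w := f v * f v * (g w * g w); pose B v w := f v * g v * (f w * g w).
have eA : dot f f * dot g g = \sum_v \sum_w A v w.
  by rewrite /dot mulr_suml; apply: eq_bigr => v _; rewrite mulr_sumr.
have eB : dot f g ^+ 2 = \sum_v \sum_w B v w.
  by rewrite /dot expr2 mulr_suml; apply: eq_bigr => v _; rewrite mulr_sumr.
have eA' : dot f f * dot g g = \sum_v \sum_w A w v by rewrite exchange_big eA.
rewrite mulrBr mulrDl mul1r {1}eA eA' eB mulr_sumr -big_split -sumrB.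
apply: eq_bigr => v _; rewrite mulr_sumr -big_split -sumrB.
by apply: eq_bigr => w _; rewrite /A /B /=; ring.
Qed.

Definition app M f v : R := \sum_w M v w * f w.

Fixpoint mpow M k v w : R :=
  if k is k'.+1 then \sum_u M v u * mpow M k' u w else (v == w)%:R.

Lemma mpowD M k l v w : mpow M (k + l) v w = \sum_u mpow M k v u * mpow M l u w.
Proof.
elim: k v => [|k IH] v /=.
  rewrite (bigD1 v) //= eqxx mul1r big1 ?addr0 // => u /negbTE uv.
  by rewrite eq_sym uv mul0r.
under eq_bigr do rewrite IH mulr_sumr.
rewrite exchange_big; apply: eq_bigr => u _; rewrite mulr_suml.
by apply: eq_bigr => x _; rewrite mulrA.
Qed.

Lemma mpow1 M v w : mpow M 1 v w = M v w.
Proof.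
rewrite /= (bigD1 w) //= eqxx mulr1 big1 ?addr0 // => u /negbTE ->; exact: mulr0.
Qed.

Lemma mpow_sym M k v w : (forall v w, M v w = M w v) -> mpow M k v w = mpow M k w v.
Proof.
move=> sM; elim: k v w => [|k IH] v w /=; first by rewrite eq_sym.
transitivity (mpow M (k + 1) w v); last by rewrite addn1.
by rewrite mpowD; apply: eq_bigr => u _; rewrite mpow1 IH sM mulrC.
Qed.

Lemma dot_app M f g : (forall v w, M v w = M w v) -> dot (app M f) g = dot f (app M g).
Proof.
move=> sM; rewrite /dot /app; under eq_bigr do rewrite mulr_suml.
rewrite exchange_big; apply: eq_bigr => v _; rewrite mulr_sumr.
by apply: eq_bigr => w _; rewrite sM mulrCA mulrA.
Qed.

Lemma app_mpowD M k l f v : app (mpow M (k + l)) f v = app (mpow M k) (app (mpow M l) f) v.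
Proof.
rewrite /app; under eq_bigr do rewrite mpowD mulr_suml.
rewrite exchange_big; apply: eq_bigr => u _; rewrite mulr_sumr.
by apply: eq_bigr => w _; rewrite mulrA.
Qed.

Definition tr M k : R := \sum_v mpow M k v v.

Lemma app_le_frob M f :
  dot (app M f) (app M f) <= (\sum_v \sum_w M v w ^+ 2) * dot f f.
Proof.
rewrite mulr_suml; apply: ler_sum => v _; rewrite -expr2.
apply: le_trans (cauchy_schwarz (M v) f) _.
by apply: ler_wpM2r; [exact: dot_ge0 | apply: ler_sum].
Qed.

Lemma frob_mpow M k : (forall v w, M v w = M w v) ->
  \sum_v \sum_w mpow M k v w ^+ 2 = tr M (k + k).
Proof.
move=> sM; apply: eq_bigr => v _; rewrite mpowD; apply: eq_bigr => w _.
by rewrite expr2 [in RHS](mpow_sym _ w).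
Qed.

(* Iterated Cauchy-Schwarz replaces the spectral theorem. *)
Lemma norm_trace M r f : (forall v w, M v w = M w v) ->
  dot (app M f) (app M f) ^+ (2 ^ r) <= dot f f ^+ (2 ^ r) * tr M (2 ^ r + 2 ^ r).
Proof.
move=> sM; pose a k := dot (app (mpow M k) f) (app (mpow M k) f).
have a2 k : a k ^+ 2 <= dot f f * a (k + k)%N.
  have -> : a k = dot f (app (mpow M (k + k)) f).
    rewrite /a dot_app; last by move=> v w; apply: mpow_sym.
    by apply: eq_bigr => v _; rewrite app_mpowD.
  exact: cauchy_schwarz.
have a0 k : 0 <= a k by apply: dot_ge0.
have -> : dot (app M f) (app M f) = a 1%N.
  have E v : app M f v = app (mpow M 1) f v.
    by apply: eq_bigr => w _; rewrite mpow1.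
  by apply: eq_bigr => v _; rewrite E.
(* Each squaring doubles the power of [M], at the cost of a power of the norm of [f]. After [r]
   rounds the Frobenius norm of $M^{2^r}$ takes over, and its square is the trace of
   $M^{2^{r+1}}$. *)
have ind i : a 1%N ^+ (2 ^ i) <= dot f f ^+ (2 ^ i).-1 * a (2 ^ i)%N.
  elim: i => [|i IH]; first by rewrite expr0 mul1r expr1.
  rewrite expnSr exprM; apply: le_trans (_ : _ <= (dot f f ^+ (2 ^ i).-1 * a (2 ^ i)%N) ^+ 2) _.
    by rewrite ler_sqr ?nnegrE ?mulr_ge0 ?exprn_ge0 ?dot_ge0 ?a0.
  rewrite exprMn; apply: (@le_trans _ _ ((dot f f ^+ (2 ^ i).-1) ^+ 2 * (dot f f * a (2 ^ i + 2 ^ i)%N))).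
    by apply: ler_wpM2l (a2 _); rewrite sqr_ge0.
  rewrite mulrA -exprM -exprSr (_ : (2 ^ i).-1 * 2 = (2 ^ i * 2).-2)%N; last first.
    by have := expn_gt0 2 i; case: (2 ^ i)%N => // m _; rewrite mulSn.
  rewrite -(_ : (2 ^ i * 2).-1 = (2 ^ i * 2).-2.+1)%N; last first.
    by have := expn_gt0 2 i; case: (2 ^ i)%N => // m _; rewrite mulSn.
  by rewrite muln2 -addnn.
apply: le_trans (ind r) _; rewrite -(frob_mpow _ sM).
apply: le_trans (ler_wpM2l _ (app_le_frob _ _)) _; first by rewrite exprn_ge0 ?dot_ge0.
rewrite mulrCA -exprSr prednK ?expn_gt0 // mulrC //.
Qed.

Fixpoint wp M x (s : seq V) : R := if s is y :: s' then M x y * wp M y s' else 1.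

Lemma mpow_walk M k x y :
  mpow M k x y = \sum_(s : k.-tuple V) wp M x s * (last x s == y)%:R.
Proof.
elim: k x => [|k IH] x /=; first by rewrite (big_tuple_nil (fun s => wp M x s * (last x s == y)%:R)) /= mul1r.
rewrite (big_tuple_cons k (fun s => wp M x s * (last x s == y)%:R)) /=.
apply: eq_bigr => u _; rewrite IH mulr_sumr.
by apply: eq_bigr => s _; rewrite mulrA.
Qed.

End Norm.

(** * Closed walks *)

Section Counting.
Variable V : finType.
Implicit Types (s : seq V) (l : seq {set V}).

Fixpoint edges x s : seq {set V} :=
  if s is y :: s' then [set x; y] :: edges y s' else [::].

Lemma size_edges x s : size (edges x s) = size s.
Proof. by elim: s x => //= y s IH x; rewrite IH. Qed.

Lemma edges_sub x s e : e \in edges x s -> {subset e <= x :: s}.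
Proof.
elim: s x => //= y s IH x; rewrite inE => /orP[/eqP->|/IH h] v.
  by rewrite !inE => /orP[]/eqP->; rewrite eqxx ?orbT.
by move=> /h; rewrite !inE => h'; rewrite h' orbT.
Qed.

Lemma edges_card x s e : path (fun a b => a != b) x s -> e \in edges x s -> #|e| = 2.
Proof.
elim: s x => //= y s IH x /andP[xy /IH h]; rewrite inE => /orP[/eqP->|/h //].
by rewrite cards2 xy.
Qed.

(** A walk is connected: a vertex not met later in the walk brings an edge not met later. *)
Lemma card_vertices x s :
  (#|[set v in x :: s]| <= #|[set e in edges x s]|.+1)%N.
Proof.
elim: s x => [|y s IH] x.
  by rewrite (_ : [set v in _] = [set x]) ?cards1 //; apply/setP => v; rewrite !inE.
have -> : [set v in x :: y :: s] = x |: [set v in y :: s].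
  by apply/setP=> v; rewrite !inE.
have -> : [set e in edges x (y :: s)] = [set x; y] |: [set e in edges y s].
  by apply/setP=> v; rewrite !inE.
rewrite cardsU1 cardsU1; case: (boolP (x \in _)) => xs /=.
  by rewrite add0n (leq_trans (IH y)) // ltnS leq_addl.
rewrite add1n ltnS (leq_trans (IH y)) // inE.
case: (boolP (_ \in edges y s)) => // /edges_sub/(_ x); rewrite !inE eqxx => /(_ isT) h.
by move: xs; rewrite !inE h.
Qed.

Lemma sum_count_mem l : (\sum_e count_mem e l = size l)%N.
Proof.
elim: l => [|e l IH] /=; first by rewrite big1.
rewrite big_split /= IH (bigD1 e) //= eqxx big1 ?addn0 // => e' /negbTE h.
by rewrite eq_sym h.
Qed.

Lemma card_double_edges l : (forall e, count_mem e l != 1%N) ->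
  (#|[set e in l]| * 2 <= size l)%N.
Proof.
move=> c1; rewrite -sum_count_mem -sum_nat_const big_mkcond leq_sum // => e _.
rewrite inE -has_pred1 has_count; have := c1 e.
by case: (count_mem e l) => [|[|]].
Qed.

Lemma card_tuple_in (R : pzSemiRingType) k (D : {set V}) :
  \sum_(s : k.-tuple V) ((all (mem D) s)%:R : R) = #|D|%:R ^+ k.
Proof.
elim: k => [|k IH]; first by rewrite (big_tuple_nil (fun s => (all _ s)%:R)).
rewrite (big_tuple_cons k (fun s => (all (mem D) s)%:R)) exprS -IH.
transitivity (\sum_x (x \in D)%:R * \sum_(s : k.-tuple V) ((all (mem D) s)%:R : R)).
  apply: eq_bigr => x _; rewrite mulr_sumr; apply: eq_bigr => s _ /=.
  by rewrite -natrM mulnb.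
rewrite -mulr_suml; congr (_ * _).
by rewrite -natr_sum -sum1_card [in RHS]big_mkcond; congr _%:R; apply: eq_bigr => x _; case: ifP.
Qed.

Lemma sum_by_card (R : pzSemiRingType) (G : nat -> R) :
  \sum_(D : {set V}) G #|D| = \sum_(d < #|V|.+1) 'C(#|V|, d)%:R * G d.
Proof.
rewrite (partition_big (fun D : {set V} => inord #|D| : 'I_#|V|.+1) predT) //=.
apply: eq_bigr => d _; rewrite (eq_bigr (fun=> G d)).
  rewrite sumr_const -[LHS]mulr_natl; congr (_%:R * _); rewrite -card_draws.
  apply: eq_card => D; transitivity (inord #|D| == d :> 'I_#|V|.+1) => //.
  rewrite inE -val_eqE /= inordK // ltnS; exact: max_card.
by move=> D /eqP <-; rewrite inordK // ltnS; exact: max_card.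
Qed.

Lemma bin_le_exp n m : ('C(n, m) <= n ^ m)%N.
Proof.
apply: leq_trans (_ : n ^_ m <= _)%N.
  by rewrite -bin_ffact leq_pmulr // fact_gt0.
rewrite ffact_prod -[X in (_ <= _ ^ X)%N]card_ord -prod_nat_const.
by apply: leq_prod => i _; apply: leq_subr.
Qed.

Lemma sum_pos_le m k : (\sum_(d < m) (0 < d < k.+2) <= k.+1)%N.
Proof.
suff h : (\sum_(d < m) (0 < d < k.+2) <= minn m.-1 k.+1)%N.
  by apply: leq_trans h (geq_minr _ _).
elim: m => [|m IH]; first by rewrite big_ord0.
by rewrite big_ord_recr /=; move: IH; set S := (\sum_(_ < _) _)%N; lia.
Qed.

End Counting.

(** * Trace moments of a centred random graph *)

Section RandomGraph.
Variables (R : realFieldType) (T : finType) (p : T -> R) (V : finType).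
Variables (rho : {set V}) (S : V + {set V} -> {set T}) (Q q : R).
Hypothesis p01 : forall i, 0 <= p i <= 1.
Hypothesis dS : forall i j, i != j -> [disjoint S i & S j].
Hypothesis SV : forall v, v \in rho -> pavoid p (S (inl v)) = Q.
Hypothesis SE : forall e : {set V}, #|e| = 2 -> e \subset rho -> pavoid p (S (inr e)) = q.
Hypothesis Q0 : 0 <= Q.
Hypothesis q01 : 0 <= q <= 1.
Implicit Types (X : {set T}) (v w x : V) (s : seq V) (e : {set V}).

Definition live X v : bool := (v \in rho) && avoid (S (inl v)) X.
Definition live_edge X e : bool := avoid (S (inr e)) X.
(** Only the edges are centred, not the vertices: this is the adjacency matrix minus [q] times that
    of the complete graph on the live vertices. *)
Definition cadj X v w : R :=
  if v == w then 0 else (live X v)%:R * (live X w)%:R * ((live_edge X [set v; w])%:R - q).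

Lemma cadj_sym X v w : cadj X v w = cadj X w v.
Proof. by rewrite /cadj eq_sym setUC; case: eqP => // _; rewrite [_%:R * _%:R]mulrC. Qed.

Lemma live_wp X x s : (live X x)%:R * wp (cadj X) x s =
  (path (fun a b => a != b) x s && all (live X) (x :: s))%:R *
  \prod_(e <- edges x s) ((live_edge X e)%:R - q).
Proof.
elim: s x => [|y s IH] x /=; first by rewrite big_nil andbT.
rewrite big_cons {1}/cadj; case: eqP => [_|_] /=; first by rewrite mul0r mulr0 mul0r.
have /= := IH y; case: (live X x); case: (live X y) => /= IHy;
  rewrite ?andbF ?(mulr0, mul0r) //.
rewrite mul1r in IHy; rewrite !mul1r IHy. exact: mulrCA.
Qed.

Lemma wp_live X x s : (0 < size s)%N -> wp (cadj X) x s = (live X x)%:R * wp (cadj X) x s.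
Proof.
case: s => //= y s _; rewrite /cadj; case: eqP => _; first by rewrite !mul0r mulr0.
by case: (live X x); rewrite ?mul1r // !mul0r.
Qed.

(* Centred variables: a walk crossing some edge exactly once has mean zero. *)
Lemma Ex_walk x s k : (0 < k)%N -> size s = (k + k)%N ->
  Ex p (fun X => wp (cadj X) x s) <=
  (#|[set v in x :: s]| <= k.+1)%N%:R *
    (Q ^+ #|[set v in x :: s]| * q ^+ #|[set v in x :: s]|.-1).
Proof.
move=> k0 sk; set d := #|_|; case/andP: q01 => q0 q1.
have rhs0 : 0 <= (d <= k.+1)%N%:R * (Q ^+ d * q ^+ d.-1).
  by rewrite !mulr_ge0 ?exprn_ge0.
case: (boolP (path (fun a b => a != b) x s && all (mem rho) (x :: s))); last first.
  move=> h; rewrite (_ : Ex _ _ = 0) //; rewrite -[RHS](Excst p 0); apply: eq_Ex => X.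
  rewrite wp_live ?sk ?addn_gt0 ?k0 // live_wp.
  case: (boolP (_ && _)) => [/andP[pa al]|_]; last by rewrite mul0r.
  case/negP: h; rewrite pa /=; apply: sub_all al => v; by case/andP.
case/andP=> pa /allP al.
pose c e := count_mem e (edges x s).
(* Affine encoding for [Ex_indep]: a vertex contributes its indicator on the walk and 1 off it, an
   edge contributes $(1_e-q)^{c(e)}$. *)
pose a (i : V + {set V}) : R := match i with inl v => (v \notin x :: s)%:R
  | inr e => (- q) ^+ c e end.
pose b (i : V + {set V}) : R := match i with inl v => (v \in x :: s)%:R
  | inr e => (1 - q) ^+ c e - (- q) ^+ c e end.
have -> : Ex p (fun X => wp (cadj X) x s) =
    Ex p (fun X => \prod_i (a i + b i * (avoid (S i) X)%:R)).
  apply: eq_Ex => X; rewrite wp_live ?sk ?addn_gt0 ?k0 // live_wp pa big_sumType /=.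
  congr (_ * _).
    rewrite (_ : _ && _ = [forall v, (v \in x :: s) ==> avoid (S (inl v)) X]).
      case: (boolP [forall v, _]) => [/forallP h|/forallPn[v]].
        rewrite big1 // => v _; have := h v; case: (v \in _) => //= [->|_].
          by rewrite mul1r add0r.
        by rewrite mul0r addr0.
      rewrite negb_imply => /andP[h1 h2].
      by rewrite (bigD1 v) //= h1 (negbTE h2) add0r mulr0 mul0r.
    rewrite -[X in X && _ = _]/(live X x) -/(all (live X) (x :: s)).
    apply/allP/forallP => h v.
      by apply/implyP => /h /andP[].
    by move=> vs; rewrite /live (implyP (h v) vs) andbT; apply: al.
  transitivity (\prod_e ((live_edge X e)%:R - q) ^+ c e).
    rewrite /c; elim: (edges x s) => [|e l IH]; first by rewrite big_nil big1.
    rewrite big_cons IH [LHS]/= [in RHS](bigD1 e) //= eqxx exprS -mulrA.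
    congr (_ * _); rewrite [LHS](bigD1 e) //=; congr (_ * _).
    by apply: eq_bigr => e' /negbTE h; rewrite eq_sym h.
  apply: eq_bigr => e _; rewrite /live_edge; case: (avoid _ X) => /=.
    by rewrite mulr1 [RHS]addrC subrK.
  by rewrite mulr0 addr0 sub0r.
rewrite Ex_indep // big_sumType /=.
have -> : \prod_v ((v \notin x :: s)%:R + (v \in x :: s)%:R * pavoid p (S (inl v))) = Q ^+ d.
  rewrite /d -prodr_const [in RHS]big_mkcond; apply: eq_bigr => v _ /=.
  rewrite [v \in [set _ in _]]inE; case: (boolP (v \in _)) => h.
    by rewrite add0r mul1r SV //; apply: al.
  by rewrite mul0r addr0.
(* The [m]-th central moment of a Bernoulli variable of parameter [q]: it is 1 for $m=0$, 0 for
   $m=1$, and at most [q] in absolute value from $m=2$ on. *)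
pose mu m : R := (1 - q) ^+ m * q + (1 - q) * (- q) ^+ m.
have -> : \prod_e ((- q) ^+ c e + ((1 - q) ^+ c e - (- q) ^+ c e) * pavoid p (S (inr e))) =
   \prod_e mu (c e).
  apply: eq_bigr => e _; case: (posnP (c e)) => [->|].
    by rewrite /mu !expr0; ring.
  rewrite /c -has_count has_pred1 => es; rewrite SE; first by rewrite /mu; ring.
    exact: edges_card es.
  by apply/subsetP => v /(edges_sub es) vs; apply: al.
case: (boolP [exists e, c e == 1%N]) => [/existsP[e /eqP ce]|/existsPn h].
  rewrite (bigD1 e) //= ce (_ : mu 1%N = 0) ?mul0r ?mulr0 //.
  by rewrite /mu !expr1; ring.
(* Every edge used is crossed at least twice in $2k$ steps, so there are at most [k] edges and
   [k.+1] vertices; conversely there are at least $d-1$ edges, whence the power of [q]. *)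
have le1 := card_vertices x s.
have le2 := card_double_edges h; rewrite size_edges sk in le2.
have dk : (d <= k.+1)%N by rewrite (leq_trans le1) // ltnS; lia.
rewrite dk mul1r ler_wpM2l ?exprn_ge0 //.
apply: le_trans (_ : q ^+ #|[set e in edges x s]| <= _); last first.
  by rewrite ler_wiXn2l // -ltnS prednK // /d (cardsD1 x) !inE eqxx.
rewrite -prodr_const [leRHS]big_mkcond; apply: le_trans (ler_norm _) _.
rewrite normr_prod; apply: ler_prod => e _; rewrite normr_ge0 /=.
rewrite inE -has_pred1 has_count -/(c e); have := h e.
case: (c e) => [|[|m]] // _ /=.
  by rewrite /mu !expr0 !(mulr1, mul1r) addrC subrK normr1.
have sq (y : R) : 0 <= y <= 1 -> y ^+ m.+2 <= y.
  move=> /andP[y0 y1]; rewrite exprS ler_piMr // exprn_ile1 //.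
have q1' : 0 <= 1 - q by lra.
have n1 : `|(1 - q) ^+ m.+2 * q| = (1 - q) ^+ m.+2 * q.
  by rewrite ger0_norm // mulr_ge0 ?exprn_ge0.
have n2 : `|(1 - q) * (- q) ^+ m.+2| = (1 - q) * q ^+ m.+2.
  by rewrite [LHS]normrM [`|(- q) ^+ _|]normrX normrN !ger0_norm.
rewrite /mu (le_trans (ler_normD _ _)) // n1 n2.
have h1 : (1 - q) ^+ m.+2 <= 1 - q by apply: sq; lra.
have h2 : q ^+ m.+2 <= q * q.
  rewrite exprSr ler_wpM2r // exprS ler_piMr // exprn_ile1 //.
by nra.
Qed.

(** Closed walks are grouped by vertex set. With $N$ points there are at most $N^d$ sets of size
    $d$, each carrying at most $d^{2k}$ walks of mean at most $Q^dq^{d-1}$. As $NQq\ge1$ the largest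
    size $k+1$ dominates, and summing over $d$ costs one more factor $k+1$. *)
Lemma Ex_trace k : (0 < k)%N -> 1 <= #|V|%:R * Q * q ->
  Ex p (fun X => tr (cadj X) (k + k)) <=
  k.+1%:R ^+ (k + k).+1 * (#|V|%:R * Q) * (#|V|%:R * Q * q) ^+ k.
Proof.
move=> k0 T1; case/andP: q01 => q0 q1.
pose h d : R := (d <= k.+1)%N%:R * (Q ^+ d * q ^+ d.-1).
have h0 d : 0 <= h d by rewrite !mulr_ge0 ?exprn_ge0.
have kk : (k + k = (k + k).-1.+1)%N by rewrite prednK // addn_gt0 k0.
have e1 : Ex p (fun X => tr (cadj X) (k + k)) <=
   \sum_(s : (k + k).-tuple V) h #|[set v in val s]|.
  rewrite (_ : Ex p _ = Ex p (fun X => \sum_x \sum_(s : (k + k).-tuple V)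
     (last x s == x)%:R * wp (cadj X) x s)); last first.
    apply: eq_Ex.
    move=> X; apply: eq_bigr => x _; rewrite mpow_walk.
    by apply: eq_bigr => s _; rewrite mulrC.
  rewrite Ex_sum; under eq_bigr do rewrite Ex_sum.
  apply: (@le_trans _ _ (\sum_x \sum_(s : (k + k).-tuple V)
     (last x s == x)%:R * h #|[set v in x :: s]|)).
    apply: ler_sum => x _; apply: ler_sum => s _; rewrite ExZ ler_wpM2l //.
    by apply: Ex_walk; rewrite ?size_tuple.
  (* A closed walk starts at its last vertex, so the tuple alone determines it. *)
  rewrite kk.
  under eq_bigr do rewrite (big_tuple_cons _ (fun s => (last _ s == _)%:R * h #|[set v in _ :: s]|)).
  rewrite (big_tuple_cons _ (fun s => h #|[set v in s]|)) exchange_big /=.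
  apply: ler_sum => y _; rewrite exchange_big /=; apply: ler_sum => s _.
  rewrite (bigD1 (last y s)) //= eqxx mul1r big1 ?addr0; last first.
    by move=> x /negbTE xl; rewrite eq_sym xl mul0r.
  rewrite (_ : [set v in [:: last y s, y & s]] = [set v in y :: s]) //.
  by apply/setP => v; rewrite !inE; case: eqP => // ->; have := mem_last y s; rewrite inE.
apply: le_trans e1 _.
apply: (@le_trans _ _ (\sum_(D : {set V}) h #|D| * #|D|%:R ^+ (k + k))).
  under [leRHS]eq_bigr do rewrite -card_tuple_in mulr_sumr.
  rewrite exchange_big; apply: ler_sum => s _ /=.
  rewrite (bigD1 [set v in val s]) //=.
  rewrite (_ : all _ _ = true) ?mulr1; last by apply/allP => v vs; rewrite -[mem _ v]/(v \in _) inE.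
  by rewrite lerDl; apply: sumr_ge0 => D _; rewrite mulr_ge0.
rewrite [leLHS](sum_by_card V (fun d => h d * d%:R ^+ (k + k))).
pose C := k.+1%:R ^+ (k + k) * (#|V|%:R * Q) * (#|V|%:R * Q * q) ^+ k.
have C0 : 0 <= C by rewrite !mulr_ge0 ?exprn_ge0 ?mulr_ge0.
apply: (@le_trans _ _ (\sum_(d < #|V|.+1) (0 < d < k.+2)%N%:R * C)); last first.
  rewrite -mulr_suml exprS -!mulrA mulrA -/C -natr_sum.
  rewrite (_ : _ * (_ * _) = k.+1%:R * C); last by rewrite /C !mulrA.
  by rewrite ler_wpM2r // ler_nat sum_pos_le.
apply: ler_sum => -[d _] _ /=; rewrite /h.
case: d => [|d] /=; first by rewrite mulr0n kk exprS !(mul0r, mulr0).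
rewrite !ltnS; case: (leqP d k) => dk; last by rewrite !mul0r mulr0.
rewrite !mul1r /C [leLHS]mulrA [leLHS]mulrC -[leRHS]mulrA.
apply: ler_pM; rewrite ?mulr_ge0 ?exprn_ge0 //.
  by rewrite lerXn2r ?nnegrE // ler_nat.
apply: (@le_trans _ _ ((#|V|%:R * Q) * (#|V|%:R * Q * q) ^+ d)); last first.
  by rewrite ler_wpM2l ?mulr_ge0 // ler_weXn2l // -ltnS.
apply: (@le_trans _ _ (#|V|%:R ^+ d.+1 * (Q ^+ d.+1 * q ^+ d))).
  by rewrite ler_wpM2r ?mulr_ge0 ?exprn_ge0 // -natrX ler_nat bin_le_exp.
rewrite le_eqVlt; apply/orP; left; apply/eqP; rewrite !exprMn !exprS; ring.
Qed.

End RandomGraph.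

(** * From the norm to the spectral gap *)

Section Gap.
Variables (R : realFieldType) (V : finType) (live : pred V) (adj : rel V) (q : R).
Hypothesis adjl : forall v w, adj v w -> [&& v != w, live v & live w].
Hypothesis q0 : 0 < q.

Definition centred v w : R := (adj v w)%:R - q * [&& v != w, live v & live w]%:R.

(** The adjacency form is the centred form plus $q(F^2-\|f\|^2)$ with $F=\sum f$. In a regular graph
    orthogonality would give $F=0$. Here the degree at a live vertex is $q(c-1)$ plus the centred
    matrix applied to the indicator of live vertices, so orthogonality bounds $F$ through [kappa];
    this is the second-order term $4\kappa^2/(qs)$. *)
Lemma gap_of_norm (kappa m : R) (s t : nat) (f : V -> R) :
  0 <= kappa -> 0 <= m -> (forall g, dot (app centred g) (app centred g) <= kappa ^+ 2 * dot g g) ->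
  (1 < s <= \sum_v live v)%N ->
  (forall v, live v -> (t <= \sum_w adj v w)%N) ->
  m * (kappa + 4 * kappa ^+ 2 / (q * s%:R)) <= t%:R ->
  (forall v, ~~ live v -> f v = 0) ->
  \sum_v (\sum_w adj v w)%:R * f v = 0 ->
  m * (\sum_v \sum_w (adj v w)%:R * (f v * f w)) <=
  \sum_v (\sum_w adj v w)%:R * f v ^+ 2.
Proof.
move=> k0 m0 Mn /andP[s1 sc] degt num f0 ort.
set c := (\sum_v live v)%N in sc *.
pose F := \sum_v f v; pose ff := dot f f.
have ff0 : 0 <= ff := dot_ge0 f.
have e1 : \sum_v \sum_w (adj v w)%:R * (f v * f w) =
    dot f (app centred f) + q * (F ^+ 2 - ff).
  rewrite /dot /app expr2 {1}/F mulr_suml /ff /dot -sumrB mulr_sumr -big_split.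
  apply: eq_bigr => v _ /=; rewrite [X in _ = X + _]mulr_sumr.
  have -> : q * (f v * F - f v * f v) =
     \sum_w q * ([&& v != w, live v & live w]%:R * (f v * f w)).
    rewrite -mulr_sumr; congr (q * _); rewrite [RHS](bigD1 v) //= eqxx mul0r add0r.
    rewrite /F (bigD1 v) //= mulrDr addrC addKr mulr_sumr; apply: eq_bigr => w wv.
    rewrite eq_sym wv /=; case: (boolP (live v)) => [_|/f0 ->]; last by rewrite !(mul0r, mulr0).
    by case: (boolP (live w)) => [_|/f0 ->]; rewrite ?mul1r // !(mul0r, mulr0).
  by rewrite -big_split; apply: eq_bigr => w _; rewrite /centred /=; ring.
pose chi v : R := (live v)%:R.
have cchi : \sum_v chi v = c%:R by rewrite /chi /c natr_sum.
have dchi : dot chi chi = c%:R.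
  by rewrite -cchi; apply: eq_bigr => v _; rewrite /chi; case: (live v); rewrite ?mulr1 ?mulr0.
have e2 v : live v -> (\sum_w adj v w)%:R = app centred chi v + q * (c%:R - 1).
  move=> lvv; have -> : c%:R - 1 = \sum_w [&& v != w, live v & live w]%:R * chi w.
    rewrite -cchi (bigD1 v) //= [in RHS](bigD1 v) //= eqxx mul0r add0r /chi lvv.
    rewrite [LHS]addrC addKr; apply: eq_bigr => w wv; rewrite eq_sym wv /=.
    by case: (live w); rewrite ?mulr1 ?mulr0.
  rewrite mulr_sumr /app -big_split natr_sum; apply: eq_bigr => w _ /=.
  rewrite /centred /chi; case: (boolP (adj v w)) => [/adjl/and3P[-> -> ->]|_] /=; first by ring.
  by rewrite sub0r; ring.
have e3 : q * (c%:R - 1) * F = - dot f (app centred chi).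
  apply/eqP; rewrite eq_sym -subr_eq0 -opprD oppr_eq0 -[X in _ == X]ort; apply/eqP.
  rewrite /dot /F mulr_sumr -big_split; apply: eq_bigr => v _ /=.
  by case: (boolP (live v)) => [/e2 ->|/f0 ->]; ring.
have c2 : 2 <= c%:R :> R by rewrite ler_nat (leq_trans s1).
have s2 : 2 <= s%:R :> R by rewrite ler_nat.
have scR : s%:R <= c%:R :> R by rewrite ler_nat.
have e4 : (q * (c%:R - 1) * F) ^+ 2 <= ff * (kappa ^+ 2 * c%:R).
  rewrite e3 sqrrN (le_trans (cauchy_schwarz _ _)) // ler_wpM2l //.
  by rewrite -dchi Mn.
(* The 4 is the square of the 2 in $c\le2(c-1)$. *)
have e5 : q * F ^+ 2 <= 4 * kappa ^+ 2 / (q * s%:R) * ff.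
  have qs0 : 0 < q * s%:R by rewrite mulr_gt0 //; lra.
  rewrite mulrAC ler_pdivlMr //.
  have cpos : 0 < c%:R :> R by lra.
  rewrite -(ler_pM2r cpos).
  apply: (@le_trans _ _ ((q * c%:R * F) ^+ 2)).
    have -> : q * F ^+ 2 * (q * s%:R) * c%:R = q ^+ 2 * F ^+ 2 * c%:R * s%:R by ring.
    have -> : (q * c%:R * F) ^+ 2 = q ^+ 2 * F ^+ 2 * c%:R * c%:R by ring.
    apply: ler_wpM2l scR; apply: mulr_ge0; last exact: ler0n.
    by apply: mulr_ge0; rewrite sqr_ge0.
  have -> : 4 * kappa ^+ 2 * ff * c%:R = 4 * (ff * (kappa ^+ 2 * c%:R)) by ring.
  apply: le_trans (ler_wpM2l _ e4); last by [].
  have -> : 4 * (q * (c%:R - 1) * F) ^+ 2 = (q * F) ^+ 2 * (2 * (c%:R - 1)) ^+ 2 by ring.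
  have -> : (q * c%:R * F) ^+ 2 = (q * F) ^+ 2 * c%:R ^+ 2 by ring.
  by rewrite ler_wpM2l ?sqr_ge0 // ler_sqr ?nnegrE; lra.
have e6 : dot f (app centred f) <= kappa * ff.
  apply: le_trans (ler_norm _) _; rewrite -ler_sqr ?nnegrE ?mulr_ge0 //.
  rewrite real_normK ?num_real // (le_trans (cauchy_schwarz _ _)) //.
  have -> : (kappa * ff) ^+ 2 = ff * (kappa ^+ 2 * ff) by ring.
  by apply: ler_wpM2l (Mn f).
have e7 : t%:R * ff <= \sum_v (\sum_w adj v w)%:R * f v ^+ 2.
  rewrite /ff /dot mulr_sumr; apply: ler_sum => v _; rewrite -expr2.
  case: (boolP (live v)) => [lvv|/f0 ->]; last by rewrite expr0n !mulr0.
  by rewrite ler_wpM2r ?sqr_ge0 // ler_nat degt.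
apply: le_trans e7; apply: le_trans (ler_wpM2r ff0 num).
rewrite -[leRHS]mulrA ler_wpM2l // e1 mulrDl mulrBr addrA.
have qff : 0 <= q * ff by rewrite mulr_ge0 // ltW.
by lra.
Qed.

End Gap.

(** * Links of faces *)

Section Links.
Variable n : nat.
Local Notation V := 'I_n.+1.
Implicit Types (v w : V) (r s e : {set V}) (X : {set {set V}}).

Definition star s : {set {set V}} := [set t : {set V} | s \subset t].
Definition block r e : {set {set V}} := [set t : {set V} | r :\: t == e].
Definition outer X s : bool := avoid (star s) X.

(* [r - e] is a non-face iff [r] is one and [X] avoids [block r e'] for all
   nonempty [e' <= e]: the blocks are disjoint, hence independent. *)
Definition block_of r (i : V + {set V}) : {set {set V}} :=
  match i with inl v => block r [set v]
             | inr e => if #|e| == 2 then block r e else set0 end.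

Lemma block_disjoint r e e' : e != e' -> [disjoint block r e & block r e'].
Proof.
move=> ee; rewrite -setI_eq0; apply/eqP/setP => t; rewrite !inE.
by case: eqP => // ->; apply: negbTE.
Qed.

Lemma block_of_disjoint r i j : i != j -> [disjoint block_of r i & block_of r j].
Proof.
case: i j => [v|e] [w|e'] /= ij.
- by apply: block_disjoint; apply: contra ij => /eqP/set1_inj ->.
- case: ifP => e2; last by rewrite -setI_eq0 setI0.
  by apply: block_disjoint; apply: contraTneq e2 => <-; rewrite cards1.
- case: ifP => e2; last by rewrite -setI_eq0 set0I.
  by apply: block_disjoint; apply: contraTneq e2 => ->; rewrite cards1.
- case: ifP => e2; last by rewrite -setI_eq0 set0I.
  case: ifP => e2'; last by rewrite -setI_eq0 setI0.
  by apply: block_disjoint; apply: contra ij => /eqP ->.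
Qed.

Lemma starD1 r v : v \in r -> star (r :\ v) = star r :|: block r [set v].
Proof.
move=> vr; apply/setP => t; rewrite !inE.
case: (boolP (v \in t)) => vt.
  rewrite (_ : _ == _ = false) ?orbF; last first.
    by apply/eqP => /setP/(_ v); rewrite !inE eqxx vt.
  apply/subsetP/subsetP => h x; last by rewrite inE => /andP[_ /h].
  by case: (x =P v) => [->//|/eqP xv xr]; apply: h; rewrite !inE xv.
rewrite [r \subset t](_ : _ = false) /=; last first.
  by apply/negbTE; apply: contra vt => /subsetP; apply.
apply/subsetP/eqP => [h|/setP h x].
  apply/setP => x; rewrite !inE; case: (x =P v) => [->|/eqP xv]; first by rewrite vt vr.
  by apply/negbTE; rewrite negb_and negbK orbC -implybE; apply/implyP => xr; apply: h; rewrite !inE xv.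
rewrite !inE => /andP[xv xr]; have := h x; rewrite !inE xr andbT (negbTE xv).
by move/negbFE.
Qed.

Lemma blockD1 r v w : v \in r -> w \in r -> v != w ->
  block (r :\ v) [set w] = block r [set w] :|: block r [set v; w].
Proof.
move=> vr wr vw; apply/setP => t; rewrite !inE setDDl setUC -setDDl.
case: (boolP (v \in t)) => vt.
  rewrite [X in _ = _ || X](_ : _ = false) ?orbF; last first.
    by apply/eqP => /setP/(_ v); rewrite !inE eqxx vt.
  suff -> : r :\: t :\ v = r :\: t by [].
  by apply/setDidPl; rewrite disjoint_sym disjoints1 inE vt.
rewrite [X in _ = X || _](_ : _ = false) /=; last first.
  by apply/eqP => /setP/(_ v); rewrite !inE vt vr (negbTE vw).
apply/eqP/eqP => [<-|->].
  by rewrite setD1K // inE vt vr.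
by rewrite setU1K // inE.
Qed.

Lemma outerD1 X r v : v \in r -> outer X (r :\ v) = outer X r && avoid (block r [set v]) X.
Proof. by move=> vr; rewrite /outer starD1 // avoidU. Qed.

Lemma outerD2 X r v w : v \in r -> w \in r -> v != w ->
  outer X (r :\ v :\ w) = [&& outer X r, avoid (block r [set v]) X,
     avoid (block r [set w]) X & avoid (block r [set v; w]) X].
Proof.
move=> vr wr vw; rewrite outerD1 ?inE ?(eq_sym w) ?vw // outerD1 // blockD1 // avoidU.
by rewrite -!andbA.
Qed.

Lemma outer_up X s (t : {set V}) : outer X s -> s \subset t -> outer X t.
Proof.
move=> h st; apply: disjointWl h; apply/subsetP => u; rewrite !inE.
exact: subset_trans.
Qed.

Section Good.
Variables (R : realFieldType) (q : R) (r : {set V}) (X : {set {set V}}).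

Let live_r : pred V := live r (block_of r) X.
Definition link_adj v w : bool :=
  [&& v != w, live_r v, live_r w & live_edge (block_of r) X [set v; w]].

(** The liveness of [v] is left out, so that the terms with [w] in $r\setminus v$ are indicators of
    independent events, as [lower_tail] wants; for live [v] this is the degree. *)
Definition link_degree v : nat :=
  (\sum_(w in r :\ v) avoid (block r [set w] :|: block r [set v; w]) X)%N.

(** All three conditions concern the blocks of [r] only, hence are independent of [r] being a
    non-face. *)
Definition good_link (c : R) (j s t : nat) : bool :=
  [&& tr (cadj r (block_of r) q X) (2 ^ j + 2 ^ j) <= c,
      (s <= \sum_(v in r) avoid (block r [set v]) X)%N &
      [forall v in r, (t <= link_degree v)%N]].

Lemma link_degreeE v : live_r v -> link_degree v = (\sum_w link_adj v w)%N.
Proof.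
move=> lvv; rewrite /link_degree big_mkcond; apply: eq_bigr => w _ /=.
rewrite !inE /link_adj lvv eq_sym; case: (boolP (v == w)) => //= vw.
rewrite /live_r /live /live_edge /= cards2 vw eqxx avoidU.
by case: (w \in r).
Qed.

Lemma outer_link v w : outer X r -> v \in r ->
  (w \in r :\ v) && outer X (r :\ v :\ w) = link_adj v w.
Proof.
move=> Ur vr; rewrite /link_adj /live_r /live /live_edge /= !inE eq_sym vr /=.
case: (boolP (v == w)) => //= vw; rewrite cards2 vw eqxx.
case: (boolP (w \in r)) => wr /=; last by rewrite andbF.
by rewrite outerD2 // Ur.
Qed.

Lemma wt_link v : outer X r -> v \in r -> wt (outer X) (r :\ v) = (\sum_w link_adj v w)%N.
Proof.
move=> Ur vr; rewrite /wt -sum1_card big_mkcond; apply: eq_bigr => w _.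
by rewrite inE outer_link.
Qed.

Lemma good_link_gap (kappa : R) (m j s t : nat) :
  0 < q -> 0 <= kappa -> (1 < s)%N ->
  m%:R * (kappa + 4 * kappa ^+ 2 / (q * s%:R)) <= t%:R ->
  good_link (kappa ^+ (2 * 2 ^ j)) j s t ->
  spectral_gap (outer X) m r.
Proof.
move=> q0 k0 s1 num /and3P[trk sc /forall_inP degt] f f0 ort.
(* If [r] is a face, so is each $r\setminus v$, and [f] is zero. *)
case: (boolP (outer X r)) => Ur; last first.
  have fz v : v \in r -> f v = 0 by move=> vr; rewrite f0 // outerD1 // (negbTE Ur) andbF.
  rewrite !big1 ?mulr0 // => v vr; first by rewrite fz // expr0n mulr0.
  by rewrite big1 // => w _; rewrite fz // mul0r.
have lvE v : live_r v = (v \in r) && outer X (r :\ v).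
  by rewrite /live_r /live /=; case: (boolP (v \in r)) => //= vr; rewrite outerD1 // Ur.
have {}f0 v : ~~ live_r v -> f v = 0 by rewrite lvE => /f0.
have fr v : v \notin r -> f v = 0 by move=> vr; rewrite f0 // /live_r /live (negbTE vr).
(* The gap is a rational statement and the norm bound a statement over [R]; [ratr] carries one to
   the other. *)
pose g v : R := ratr (f v).
have adjl v w : link_adj v w -> [&& v != w, live_r v & live_r w].
  by case/and4P => -> -> ->.
have cE v w : centred live_r link_adj q v w = cadj r (block_of r) q X v w.
  rewrite /centred /link_adj /cadj; case: (v == w); first by rewrite mulr0 subr0.
  rewrite -/(live_r v) -/(live_r w) /=; case: (live_r v); case: (live_r w) => /=; ring.
have Mn h : dot (app (centred live_r link_adj q) h) (app (centred live_r link_adj q) h) <=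
    kappa ^+ 2 * dot h h.
  pose M := cadj r (block_of r) q X.
  have -> : dot (app (centred live_r link_adj q) h) (app (centred live_r link_adj q) h) =
    dot (app M h) (app M h).
    have e v : app (centred live_r link_adj q) h v = app M h v.
      by apply: eq_bigr => w _; rewrite cE.
    by apply: eq_bigr => v _; rewrite e.
  rewrite -(ler_pXn2r (n := 2 ^ j)) ?nnegrE ?expn_gt0 ?mulr_ge0 ?sqr_ge0 ?dot_ge0 //.
  apply: le_trans (norm_trace j h (cadj_sym _ _ _ X)) _.
  rewrite exprMn mulrC ler_wpM2r ?exprn_ge0 ?dot_ge0 //.
  by rewrite -exprM.
have sc' : (1 < s <= \sum_v live_r v)%N.
  rewrite s1 (leq_trans sc) //= big_mkcond leq_sum // => v _.
  by rewrite /live_r /live /=; case: ifP.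
have degt' v : live_r v -> (t <= \sum_w link_adj v w)%N.
  by move=> lvv; rewrite -link_degreeE // degt //; case/andP: lvv.
have ort' : \sum_v (\sum_w link_adj v w)%:R * g v = 0.
  rewrite -[RHS](raddf0 (@ratr R)) -ort raddf_sum [RHS]big_mkcond; apply: eq_bigr => v _ /=.
  case: (boolP (v \in r)) => vr; first by rewrite rmorphM /= ratr_nat wt_link.
  by rewrite /g fr // raddf0 mulr0.
have := gap_of_norm adjl q0 k0 (ler0n R m) Mn sc' degt' num _ ort'.
move=> /(_ _)/wrap[v /f0 e|]; first by rewrite /g e raddf0.
rewrite -(ler_rat R) rmorphM /= ratr_nat !raddf_sum /=.
set a1 := \sum_v \sum_w _; set a2 := \sum_v _ * _.
set b1 := \sum_(v in r) _; set b2 := \sum_(v in r) _.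
have -> : b1 = a1.
  rewrite /b1 /a1 [LHS]big_mkcond; apply: eq_bigr => v _ /=.
  case: (boolP (v \in r)) => vr; last by rewrite big1 // => w _; rewrite /g fr // raddf0 mul0r mulr0.
  rewrite raddf_sum [LHS]big_mkcond; apply: eq_bigr => w _ /=.
  by rewrite outer_link //; case: (link_adj v w); rewrite ?mul0r // mul1r rmorphM.
suff -> : b2 = a2 by [].
rewrite /b2 /a2 [LHS]big_mkcond; apply: eq_bigr => v _ /=.
case: (boolP (v \in r)) => vr; last by rewrite /g fr // raddf0 expr0n mulr0.
by rewrite rmorphM /= ratr_nat rmorphXn wt_link.
Qed.

End Good.

(** Good links serve three purposes: their gaps feed [garland], the bound $t>0$ makes the weights
    positive, and for [r = setT] a live vertex is a non-face of codimension one, which settles the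
    top cardinal. *)
Lemma good_link_exact (R : realFieldType) (q kappa : {set V} -> R) (j I : nat)
    (s t : {set V} -> nat) X :
  outer X setT ->
  (forall r, (#|~: r| <= I)%N -> [&& 0 < q r, 0 <= kappa r, (1 < s r)%N, (0 < t r)%N,
     (2 * #|~: r|.+1)%:R * (kappa r + 4 * kappa r ^+ 2 / (q r * (s r)%:R)) <= (t r)%:R &
     good_link (q r) r X (kappa r ^+ (2 * 2 ^ j)) j (s r) (t r)]) ->
  forall K, (n.+1 <= K + I.+1)%N -> rel_exact (outer X) K.
Proof.
move=> UT H K KI.
have sizeC r : (#|~: r| = n.+1 - #|r|)%N by rewrite -[X in (X - _)%N](card_ord n.+1) -(cardsC r) addKn.
case: (ltngtP K n.+1) => [|Kn|->].
- rewrite ltnS => Kn; apply: rel_exact_of_gap => // [u v|u Uu uK|r rK].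
  + exact: outer_up.
  + have [v vu] : exists v, v \notin u.
      have /card_gt0P[v] : (0 < #|~: u|)%N by rewrite sizeC uK subn_gt0 ltnS.
      by rewrite inE; exists v.
    (* Seen from any [r] one point larger, [u] is a live vertex whose degree is the weight of
       [u]. *)
    pose r := v |: u; have rE : u = r :\ v by rewrite /r setU1K.
    have vr : v \in r by rewrite /r setU11.
    have Ur : outer X r by apply: outer_up Uu _; rewrite subsetUr.
    have /H/and5P[_ _ _ t0 /andP[_ /and3P[_ _ /forall_inP/(_ v vr)]]] : (#|~: r| <= I)%N.
      by rewrite sizeC /r cardsU1 vu uK; lia.
    move=> tle; rewrite rE wt_link // -link_degreeE ?(leq_trans t0) //.
    by move: Uu; rewrite rE outerD1 // Ur /live /= vr.
  + have rI : (#|~: r| <= I)%N by rewrite sizeC rK; lia.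
    have /and5P[q0 k0 s1 t0 /andP[num gd]] := H r rI.
    rewrite (_ : (n.+1 - K = #|~: r|.+1)%N); last by rewrite sizeC rK; lia.
    exact: good_link_gap gd.
- apply: rel_exact_empty => u _; apply: contraTneq Kn => <-.
  by rewrite -leqNgt -[X in (_ <= X)%N](card_ord n.+1) max_card.
- have /H/and5P[_ _ s1 _ /andP[_ /and3P[_ sc _]]] : (#|~: [set: V]| <= I)%N.
    by rewrite setCT cards0.
  case: (boolP [exists v, avoid (block setT [set v]) X]) => [/existsP[v av]|/existsPn h].
    by apply: (@rel_exact_top _ _ v); rewrite outerD1 // av andbT.
  by move: (leq_trans s1 sc); rewrite big1 // => v _; rewrite (negbTE (h v)).
Qed.

End Links.

(** * Avoidance probabilities of blocks *)

Section Blocks.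
Variables (R : realFieldType) (n : nat).
Local Notation V := 'I_n.+1.
Variable p : {set V} -> R.
Hypothesis p01 : forall s, 0 <= p s <= 1.
Implicit Types (v w : V) (r s e : {set V}) (X : {set {set V}}).

(** A member of the block is $r\setminus e$ together with an arbitrary part of the complement of
    [r]; the cardinals that occur depend only on those of [r] and [e]. *)
Lemma pavoid_blockE r e : e \subset r ->
  pavoid p (block r e) = \prod_(u in powerset (~: r)) (1 - p ((r :\: e) :|: u)).
Proof.
move=> er; rewrite /pavoid.
rewrite (reindex_onto (fun u => (r :\: e) :|: u) (fun t : {set V} => t :\: r)) /=.
  apply: eq_bigl => u; rewrite !inE.
  apply/andP/idP => [[_ /eqP h]|h].
    by rewrite -h; apply/subsetP => x; rewrite !inE => /andP[].
  have ur : u :\: r = u.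
    by apply/setDidPl; rewrite disjoints_subset.
  split; apply/eqP.
    apply/setP => x; rewrite !inE; have := subsetP h x; rewrite inE.
    have := subsetP er x.
    by case: (x \in e); case: (x \in u); case: (x \in r) => //= h1 h2; rewrite ?(h1 isT) ?(h2 isT) //; case: (h1 isT); case: (h2 isT).
  by rewrite setDUl ur; apply/setUidPr; apply/subsetP => x; rewrite !inE; case: (x \in r); rewrite ?andbF.
move=> t; rewrite inE => /eqP <-; apply/setP => x; rewrite !inE.
by case: (x \in r); case: (x \in t).
Qed.

Lemma card_block_arg r e (u : {set V}) : e \subset r -> u \subset ~: r ->
  #|(r :\: e) :|: u| = (#|r| - #|e| + #|u|)%N.
Proof.
move=> er ur; rewrite cardsU cardsD (setIidPr er) (_ : _ :&: u = set0) ?cards0 ?subn0 //.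
apply/setP => x; rewrite !inE; case: (boolP (x \in u)) => [/(subsetP ur)|]; last by rewrite andbF.
by rewrite inE => /negbTE ->; rewrite andbF.
Qed.

Hypothesis hom : forall s s' : {set V}, #|s| = #|s'| -> p s = p s'.

(** Homogeneity enters here: all vertices of a link share one probability, and all pairs another. *)
Lemma pavoid_block_hom r e e' : e \subset r -> e' \subset r -> #|e| = #|e'| ->
  pavoid p (block r e) = pavoid p (block r e').
Proof.
move=> er er' ee; rewrite !pavoid_blockE //; apply: eq_bigr => u; rewrite inE => ur.
by congr (1 - _); apply: hom; rewrite !card_block_arg // ee.
Qed.

End Blocks.

(** * Failure probability of one link *)

Section BadLink.
Variables (R : realFieldType) (n : nat).
Local Notation V := 'I_n.+1.
Variable p : {set V} -> R.
Hypothesis p01 : forall s, 0 <= p s <= 1.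
Implicit Types (v w : V) (r s e : {set V}) (X : {set {set V}}).

Lemma pavoid_block_ge (P : R) r e : 0 <= P -> P <= 1 -> (forall s, p s <= P) -> e \subset r ->
  (1 - P) ^+ (2 ^ #|~: r|) <= pavoid p (block r e).
Proof.
move=> P0 P1 pP er; rewrite pavoid_blockE // -card_powerset -prodr_const.
by apply: ler_prod => u _; rewrite subr_ge0 P1 lerD2l lerN2 pP.
Qed.

(** The three terms are Markov's inequality for the trace, [lower_tail] for the live vertices, and a
    union over [v] of [lower_tail] for the degrees, where [v] itself is excluded and the exponent
    drops by one. *)
Lemma bad_link (r : {set V}) (Q q c : R) (j s t : nat) :
  (forall v, v \in r -> pavoid p (block r [set v]) = Q) ->
  (forall e : {set V}, #|e| = 2 -> e \subset r -> pavoid p (block r e) = q) ->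
  0 <= Q -> 0 <= q <= 1 -> 1 <= n.+1%:R * Q * q -> 0 < c ->
  Pr p (fun X => ~~ good_link q r X c j s t) <=
  (2 ^ j).+1%:R ^+ (2 ^ j + 2 ^ j).+1 * (n.+1%:R * Q) * (n.+1%:R * Q * q) ^+ (2 ^ j) / c
  + 2 ^+ s * (1 - Q / 2) ^+ #|r| + #|r|%:R * (2 ^+ t * (1 - Q * q / 2) ^+ #|r|.-1).
Proof.
move=> HQ Hq Q0 q01 T1 c0.
pose trX X := tr (cadj r (block_of r) q X) (2 ^ j + 2 ^ j).
pose E1 X := c < trX X.
pose E2 X := (\sum_(v in r) avoid (block r [set v]) X < s)%N.
pose E3 X := [exists (v | v \in r), link_degree r X v < t]%N.
have tr0 X : 0 <= trX X.
  rewrite /trX -(frob_mpow _ (cadj_sym _ _ _ X)); apply: sumr_ge0 => v _.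
  by apply: sumr_ge0 => w _; rewrite sqr_ge0.
apply: (@le_trans _ _ (Pr p (fun X => (E1 X || E2 X) || E3 X))).
  apply: le_Pr => // X; rewrite /good_link !negb_and -ltNge -ltnNge orbA.
  by rewrite negb_forall_in; congr (_ || _); apply: eq_existsb => v; rewrite -ltnNge.
apply: le_trans (Pr_or p01 _ _) _; apply: lerD; last first.
  apply: le_trans (Pr_union p01 _ _) _.
  rewrite mulr_natl -sumr_const; apply: ler_sum => v vr.
  rewrite (cardsD1 v r) vr add1n /=.
  apply: (lower_tail p01) => [i k ik|w].
    rewrite -setI_eq0 setIUl !setIUr !setU_eq0 !setI_eq0 -!andbA.
    apply/and4P; split; apply: block_disjoint.
    - by apply: contra ik => /eqP/set1_inj ->.
    - apply: contra ik => /eqP/setP/(_ k); rewrite !inE eqxx orbT.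
      by rewrite eq_sym.
    - by apply: contra ik => /eqP/setP/(_ i); rewrite !inE eqxx orbT => <-.
    - apply: contra ik => /eqP/setP h.
      have := h i; have := h k; rewrite !inE !eqxx !orbT.
      by case: (i =P v) => [->|_ _ /= <-] //; rewrite orbb eq_sym => ->.
  rewrite !inE => /andP[wv wr]; rewrite pavoidU; last first.
    apply: block_disjoint; apply: contra wv => /eqP/setP/(_ v).
    by rewrite !inE eqxx eq_sym.
  by rewrite HQ // Hq // ?cards2 1?eq_sym ?wv // subUset !sub1set vr wr.
apply: le_trans (Pr_or p01 _ _) _; apply: lerD; last first.
  by apply: (lower_tail p01) => // i k ik; apply: block_disjoint; apply: contra ik => /eqP/set1_inj ->.
apply: le_trans (markov p01 c0 tr0) _; rewrite ler_pM2r ?invr_gt0 //.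
have := @Ex_trace R _ p _ r (block_of r) Q q (@block_of_disjoint n r) _ _ Q0 q01 (2 ^ j).
rewrite card_ord; apply => //; first by move=> e e2 er; rewrite /= e2 eqxx Hq.
by rewrite expn_gt0.
Qed.

End BadLink.

(** * Second moment *)

(** In probabilistic terms, a uniform [d]-subset of [N] points contains [i] given points with
    probability at most $(d/N)^i$. *)
Lemma bin_ratio (N d i : nat) : (i <= d)%N -> (d <= N)%N ->
  ('C(N - i, d - i) * N ^ i <= 'C(N, d) * d ^ i)%N.
Proof.
move=> id dN; elim: i id => [|i IH] id; first by rewrite !subn0.
have {}IH := IH (ltnW id).
have Ni : (0 < N - i)%N by lia.
have := mul_bin_diag (N - i) (d - i.+1).
have -> : ((N - i).-1 = N - i.+1)%N by lia.
have -> : ((d - i.+1).+1 = d - i)%N by lia.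
move: IH; set a := 'C(N - i.+1, d - i.+1); set b := 'C(N - i, d - i) => IH ab.
have cmp : ((d - i) * N <= d * (N - i))%N.
  by rewrite mulnBl mulnBr leq_sub2l // mulnC leq_mul2l dN orbT.
have h : (a * N <= b * d)%N.
  rewrite -(leq_pmul2l Ni) mulnA ab.
  rewrite (_ : (_ * b * N = (d - i) * N * b)%N); last by lia.
  rewrite (_ : ((N - i) * (b * d) = d * (N - i) * b)%N); last by lia.
  by rewrite leq_mul2r cmp orbT.
rewrite !expnSr [(N ^ i * N)%N]mulnC mulnA.
apply: leq_trans (leq_mul h (leqnn _)) _.
by rewrite mulnAC mulnA leq_mul2r IH orbT.
Qed.

Section Overlaps.
Variables (R : realFieldType) (T : finType).
Implicit Types (c u : {set T}).

Lemma sum_exp_subset (y : R) c : \sum_(u : {set T} | u \subset c) y ^+ #|u| = (1 + y) ^+ #|c|.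
Proof.
pose f i := if i \in c then y else 0.
rewrite -prodr_const big_mkcond /=.
transitivity (\prod_i (f i + 1)); last first.
  by rewrite [RHS]big_mkcond; apply: eq_bigr => i _; rewrite /f; case: ifP => _; rewrite ?add0r // addrC.
rewrite bigA_distr; apply: eq_bigr => u _ /=; rewrite -big_mkcond /=.
case: (boolP (u \subset c)) => [uc|/subsetPn[x xu xc]].
  by rewrite -prodr_const; apply: eq_bigr => i /(subsetP uc); rewrite /f => ->.
by rewrite (bigD1 x) //= /f (negbTE xc) mul0r.
Qed.

Lemma card_supersets u d : (#|u| <= d)%N ->
  #|[set c : {set T} | (u \subset c) && (#|c| == d)]| = 'C(#|T| - #|u|, d - #|u|).
Proof.
move=> ud; have -> : (#|T| - #|u| = #|~: u|)%N by rewrite -(cardsC u) addKn.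
rewrite -cards_draws.
rewrite -(@card_in_imset _ _ (fun c => c :\: u) [set c : {set T} | (u \subset c) && (#|c| == d)]); last first.
  move=> c c'; rewrite !inE => /andP[uc _] /andP[uc' _] h.
  by rewrite -(setID c u) -(setID c' u) h (setIidPr uc) (setIidPr uc').
apply: eq_card => w; rewrite inE; apply/imsetP/idP.
  move=> [c]; rewrite inE => /andP[uc /eqP cd] ->.
  rewrite cardsD (setIidPr uc) cd eqxx andbT.
  by apply/subsetP => x; rewrite !inE => /andP[].
case/andP => wu /eqP wc; exists (w :|: u).
  rewrite inE subsetUr cardsU (_ : w :&: u = set0) ?cards0 ?subn0 ?wc ?subnK //=.
  by apply/eqP; rewrite setI_eq0 disjoints_subset.
rewrite setDUl setDv setU0; apply/esym/setDidPl.
by rewrite disjoints_subset.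
Qed.

(** The power is expanded over the subsets [u] of the overlap; by [bin_ratio] a proportion at most
    $(d/N)^{|u|}$ of the sets contain [u], and the sum over [u] in [c] is binomial again. *)
Lemma sum_overlap (y : R) (d : nat) c : 0 <= y -> (d <= #|T|)%N -> (0 < #|T|)%N -> #|c| = d ->
  \sum_(c' : {set T} | #|c'| == d) (1 + y) ^+ #|c :&: c'| <=
  'C(#|T|, d)%:R * (1 + y * d%:R / #|T|%:R) ^+ d.
Proof.
move=> y0 dT T0 cd; have T0' : 0 < #|T|%:R :> R by rewrite ltr0n.
under eq_bigr do rewrite -sum_exp_subset.
rewrite (exchange_big_dep (fun u : {set T} => u \subset c)) /=; last first.
  by move=> c' u _; rewrite subsetI => /andP[].
rewrite -[in leRHS]cd -sum_exp_subset mulr_sumr; apply: ler_sum => u uc.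
have ud : (#|u| <= d)%N by rewrite -cd subset_leq_card.
rewrite (eq_bigl [in [set c' : {set T} | (u \subset c') && (#|c'| == d)]]); last first.
  by move=> c'; rewrite inE subsetI uc /= andbC.
rewrite sumr_const card_supersets // -[leLHS]mulr_natl -mulrA exprMn mulrCA [leLHS]mulrC.
apply: ler_wpM2l; first exact: exprn_ge0.
rewrite expr_div_n mulrA ler_pdivlMr ?exprn_gt0 //.
by rewrite -!natrX -!natrM ler_nat cd bin_ratio.
Qed.

End Overlaps.

Section SecondMoment.
Variables (R : realFieldType) (n : nat).
Local Notation V := 'I_n.+1.
Variable p : {set V} -> R.
Hypothesis p01 : forall s, 0 <= p s <= 1.
Hypothesis pT : p setT = 0.
Implicit Types (r s c : {set V}) (X : {set {set V}}).

Lemma card_star s : #|star s| = (2 ^ #|~: s|)%N.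
Proof.
rewrite -card_powerset -(card_imset (mem (star s)) (@setC_inj V)).
apply: eq_card => t; rewrite !inE; apply/imsetP/idP.
  by move=> [t']; rewrite inE => st ->; rewrite setCS.
by move=> st; exists (~: t); rewrite ?setCK // inE -setCS setCK.
Qed.

Lemma pavoid_starE s : pavoid p (star s) = \prod_(t in star s :\ setT) (1 - p t).
Proof.
rewrite /pavoid (bigD1 setT) ?inE ?subsetT //= pT subr0 mul1r.
by apply: eq_bigl => t; rewrite !inE andbC.
Qed.

Lemma card_star' s : #|star s :\ setT| = (2 ^ #|~: s|).-1.
Proof.
have := cardsD1 setT (star s); rewrite card_star inE subsetT add1n => ->.
by [].
Qed.

Lemma pavoid_star_ge (P : R) s : P <= 1 -> (forall t, p t <= P) ->
  (1 - P) ^+ (2 ^ #|~: s|).-1 <= pavoid p (star s).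
Proof.
move=> P1 pP; rewrite pavoid_starE -card_star' -prodr_const.
by apply: ler_prod => t _; rewrite subr_ge0 P1 lerD2l lerN2 pP.
Qed.

Lemma pavoid_star_le (P : R) s : P <= 1 -> (forall t : {set V}, s \subset t -> t != setT -> P <= p t) ->
  pavoid p (star s) <= (1 - P) ^+ (2 ^ #|~: s|).-1.
Proof.
move=> P1 pP; rewrite pavoid_starE -card_star' -prodr_const.
apply: ler_prod => t; rewrite !inE => /andP[tT st].
by case/andP: (p01 t) => _ ?; rewrite subr_ge0 lerD2l lerN2 pP // andbT.
Qed.

Lemma starI s s' : star s :&: star s' = star (s :|: s').
Proof. by apply/setP => t; rewrite !inE subUset. Qed.

(** This gives the correlation of two non-face events exactly: the inverse of the avoidance
    probability of their common supersets. *)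
Lemma pavoidUI (S S' : {set {set V}}) :
  pavoid p (S :|: S') * pavoid p (S :&: S') = pavoid p S * pavoid p S'.
Proof.
have e1 : pavoid p S' = pavoid p (S :&: S') * pavoid p (S' :\: S).
  rewrite -pavoidU ?[S :&: S']setIC ?setID //.
  by rewrite -setI_eq0; apply/eqP/setP => x; rewrite !inE; case: (x \in S); rewrite ?andbF.
have e2 : pavoid p (S :|: S') = pavoid p S * pavoid p (S' :\: S).
  rewrite -pavoidU; first by congr pavoid; apply/setP => x; rewrite !inE; case: (x \in S).
  by rewrite -setI_eq0; apply/eqP/setP => x; rewrite !inE; case: (x \in S); rewrite ?andbF.
by rewrite e1 e2; ring.
Qed.

(* Weighting each event by the inverse of its probability makes the second
   moment depend only on the overlaps, whatever the individual probabilities. *)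
Lemma no_outer (P E : R) (d : nat) :
  0 <= P -> P < 1 -> (forall t, p t <= P) -> (d <= n.+1)%N -> 1 <= E ->
  (forall i, (i <= d)%N -> 1 <= E ^+ i * (1 - P) ^+ (2 ^ i).-1) ->
  Pr p (fun X => ~~ [exists (c : {set V} | #|c| == d), outer X (~: c)]) <=
  (1 + (E - 1) * d%:R / n.+1%:R) ^+ d - 1.
Proof.
move=> P0 P1 pP dn E1 Ei.
pose pi c := pavoid p (star (~: c)).
have rho0 : 0 < 1 - P by lra.
have pi0 c : 0 < pi c.
  by apply: lt_le_trans (pavoid_star_ge _ (ltW P1) pP); rewrite exprn_gt0.
pose M : R := 'C(n.+1, d)%:R.
have M0 : 0 < M by rewrite ltr0n bin_gt0.
have cM (x : R) : \sum_(c : {set V} | #|c| == d) x = M * x.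
  rewrite sumr_const -[LHS]mulr_natl /M; congr (_%:R * _).
  by rewrite -[X in 'C(X, _)](card_ord n.+1) -card_draws; apply: eq_card => c; rewrite inE.
pose Z X : R := \sum_(c : {set V} | #|c| == d) (outer X (~: c))%:R / pi c.
have EZ : Ex p Z = M.
  rewrite Ex_sum -[RHS]mulr1 -cM; apply: eq_bigr => c _.
  transitivity (Ex p (fun X => (pi c)^-1 * (outer X (~: c))%:R)).
    by apply: eq_Ex => X; rewrite mulrC.
  by rewrite ExZ -/(Pr _ _) Ex_avoid mulVf // gt_eqF.
have EZ2 : Ex p (fun X => Z X ^+ 2) <= M * (M * (1 + (E - 1) * d%:R / n.+1%:R) ^+ d).
  have -> : Ex p (fun X => Z X ^+ 2) = \sum_(c : {set V} | #|c| == d)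
      \sum_(c' : {set V} | #|c'| == d) (pi c)^-1 * (pi c')^-1 * pavoid p (star (~: c) :|: star (~: c')).
    transitivity (Ex p (fun X => \sum_(c : {set V} | #|c| == d) \sum_(c' : {set V} | #|c'| == d)
       (pi c)^-1 * (pi c')^-1 * (avoid (star (~: c) :|: star (~: c')) X)%:R)); last first.
      rewrite Ex_sum; apply: eq_bigr => c _; rewrite Ex_sum; apply: eq_bigr => c' _.
      by rewrite ExZ -/(Pr _ _) Ex_avoid.
    apply: eq_Ex => X; rewrite expr2 mulr_suml; apply: eq_bigr => c _.
    rewrite mulr_sumr; apply: eq_bigr => c' _.
    by rewrite avoidU /outer -mulnb natrM; ring.
  rewrite -[leRHS]cM; apply: ler_sum => c /eqP cd.
  apply: le_trans (_ : \sum_(c' : {set V} | #|c'| == d) (1 + (E - 1)) ^+ #|c :&: c'| <= _); last first.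
    have := @sum_overlap R V (E - 1) d c; rewrite card_ord; apply => //.
    by rewrite subr_ge0.
  apply: ler_sum => c' /eqP c'd; rewrite addrC subrK.
  (* The joint probability over the product is $1/\pi(c\cap c')$, which [Ei] bounds by $E^{|c\cap
     c'|}$. *)
  have := pavoidUI (star (~: c)) (star (~: c')); rewrite starI -setCI -/(pi c) -/(pi c') -/(pi (c :&: c')).
  move=> h; rewrite -invfM mulrC ler_pdivrMr ?mulr_gt0 // -h mulrCA ler_peMr.
  - by [].
  - exact: pavoid_ge0.
  have := Ei #|c :&: c'| _; rewrite -{1}cd subset_leq_card ?subsetIl // => /(_ isT) h1.
  apply: le_trans h1 _; rewrite ler_wpM2l ?exprn_ge0 //; first by lra.
  by have := pavoid_star_ge (~: (c :&: c')) (ltW P1) pP; rewrite setCK.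
(* Chebyshev: [M] is the mean of [Z], and the indicator of $Z=0$ is at most $(Z/M-1)^2$. *)
apply: (@le_trans _ _ (Ex p (fun X => M^-1 ^+ 2 * (Z X ^+ 2) + ((- 2 * M^-1) * Z X + 1)))).
  apply: le_Ex => // X.
  have -> : M^-1 ^+ 2 * Z X ^+ 2 + (- 2 * M^-1 * Z X + 1) = (M^-1 * Z X - 1) ^+ 2 by ring.
  case: (boolP [exists (_ | _), _]) => [_|/existsPn h] /=; first exact: sqr_ge0.
  rewrite (_ : Z X = 0) ?mulr0 ?sub0r ?sqrrN ?expr1n // /Z big1 // => c cd.
  by have := h c; rewrite cd /= => /negbTE ->; rewrite mul0r.
rewrite ExD ExD !ExZ Excst EZ.
have -> : -2 * M^-1 * M + 1 = - 1 by field; rewrite gt_eqF.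
rewrite lerD2r; apply: le_trans (ler_wpM2l _ EZ2) _; first exact: sqr_ge0.
by rewrite mulrA mulrA -expr2 -exprMn mulVf ?gt_eqF // expr1n mul1r.
Qed.

End SecondMoment.

(** * The upper model *)

Section UpperModel.
Variables (R : realType) (n : nat) (ps : {set 'I_n.+1} -> R).
Local Notation V := 'I_n.+1.
Implicit Types (s t c : {set V}) (X Y : {set {set V}}).

(** Parameter 0 on inadmissible sets turns the model into a product over all subsets. Then [setT]
    never occurs in [X], which explains the exponents [(2 ^ i).-1]. *)
Definition ext_param s : R := if s \in admissible n then ps s else 0.

Lemma wtX_inadmissible X : ~~ (X \subset admissible n) -> wtX ext_param X = 0.
Proof.
case/subsetPn => s sX sa.
by rewrite /wtX (bigD1 s) //= sX /ext_param (negbTE sa) mul0r.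
Qed.

Lemma probE (E : pred {set {set V}}) :
  prob ps E = Pr ext_param (fun X => E (upper_cplx X)).
Proof.
rewrite /prob /Pr /Ex big_mkcond; apply: eq_bigr => X _.
case: (boolP (X \subset admissible n)) => XA /=; last by rewrite wtX_inadmissible // mul0r.
case: (E _); last by rewrite mulr0.
rewrite mulr1 /wtX [LHS]big_mkcond; apply: eq_bigr => s _; rewrite /ext_param.
case: (boolP (s \in admissible n)) => sa //.
by rewrite (contraNF (subsetP XA s) sa) subr0.
Qed.

Hypothesis ps01 : forall s, s \in admissible n -> 0 <= ps s <= 1.

Lemma ext_param01 s : 0 <= ext_param s <= 1.
Proof. by rewrite /ext_param; case: ifP => [/ps01 //|_]; rewrite lexx ler01. Qed.

Lemma ext_paramT : ext_param setT = 0.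
Proof. by rewrite /ext_param inE eqxx andbF. Qed.

Lemma le_Pr_admissible (E E' : pred {set {set V}}) :
  (forall X, X \subset admissible n -> E X -> E' X) -> Pr ext_param E <= Pr ext_param E'.
Proof.
move=> h; apply: ler_sum => X _.
case: (boolP (X \subset admissible n)) => XA; last by rewrite wtX_inadmissible // !mul0r.
rewrite ler_wpM2l ?wtX_ge0 //; first exact: ext_param01.
by rewrite ler_nat; case: (E X) (h X XA) => // ->.
Qed.

Lemma prob_le1 (E : pred {set {set V}}) : prob ps E <= 1.
Proof. by rewrite probE Pr_le1 //; apply: ext_param01. Qed.

Lemma prob_ge (E bad : pred {set {set V}}) (e : R) :
  (forall X, X \subset admissible n -> ~~ bad X -> E (upper_cplx X)) ->
  Pr ext_param bad <= e -> 1 - e <= prob ps E.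
Proof.
move=> h be; rewrite probE; apply: (@le_trans _ _ (Pr ext_param (predC bad))).
  rewrite (PrC _ (predC bad)) lerD2l lerN2; apply: le_trans be; apply: le_Pr => [|X].
    exact: ext_param01.
  by rewrite /= negbK.
exact: le_Pr_admissible.
Qed.

Lemma outer_notin X s : outer X s = ~~ [exists t in X, s \subset t].
Proof.
rewrite /outer /avoid -setI_eq0; apply/eqP/exists_inPn => [h t tX|h].
  by have /setP/(_ t) := h; rewrite !inE tX andbT => ->.
by apply/setP => t; rewrite !inE; apply/negbTE; rewrite andbC; apply/negP => /andP[/h/negbTE ->].
Qed.

Lemma admissible_neq0 X t : X \subset admissible n -> t \in X -> (t != set0) && (t != setT).
Proof. by move=> /subsetP XA /XA; rewrite inE. Qed.

Lemma outerT X : X \subset admissible n -> outer X setT.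
Proof.
move=> XA; rewrite outer_notin; apply/exists_inPn => t tX.
by rewrite subTset; case/andP: (admissible_neq0 XA tX).
Qed.

Lemma mem_upper X s : s != set0 -> (s \in upper_cplx X) = ~~ outer X s.
Proof. by move=> s0; rewrite inE s0 outer_notin negbK. Qed.

(** The delicate case is the void complex: [aug] then omits the empty face, in accordance with [X]
    having no member at all. *)
Lemma nonface_upper X s : X \subset admissible n ->
  nonface (upper_cplx X) s = outer X s.
Proof.
move=> XA; rewrite /nonface /aug; case: (altP (upper_cplx X =P set0)) => [Y0|Yn].
  rewrite Y0 inE; apply/esym; rewrite outer_notin; apply/exists_inPn => t tX.
  have /setP/(_ t) := Y0; rewrite !inE; case/andP: (admissible_neq0 XA tX) => -> _ /=.
  by move/negbT/exists_inPn/(_ t tX); rewrite subxx.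
rewrite !inE negb_or; case: (altP (s =P set0)) => [->|s0] /=; last by rewrite outer_notin.
case/set0Pn: Yn => t; rewrite inE => /andP[_ /exists_inP[u uX _]].
by apply/esym/negbTE; rewrite outer_notin negbK; apply/exists_inP; exists u; rewrite ?sub0set.
Qed.

Lemma nonface_up X s t : X \subset admissible n ->
  nonface (upper_cplx X) s -> s \subset t -> nonface (upper_cplx X) t.
Proof. by move=> XA; rewrite !nonface_upper //; apply: outer_up. Qed.

Lemma rbetti_upper X k : X \subset admissible n ->
  rel_exact (outer X) k.+1 -> rbetti (upper_cplx X) (k%:Z - 1) = 0%N.
Proof.
move=> XA ex; apply: rbetti_eq0 => [s t|]; first exact: nonface_up.
move=> z z0 z1; have [|t Ut|y y0 y1] := ex z.
- by move=> s; rewrite -nonface_upper //; apply: z0.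
- by apply: z1; rewrite nonface_upper.
by exists y => s; rewrite nonface_upper //; [apply: y0 | apply: y1].
Qed.

Lemma contains_skel_mono Y d e : (d <= e)%N -> contains_skel Y d -> contains_skel Y e.
Proof.
move=> de /forallP h; apply/forallP => s; apply/implyP => /andP[s0 se].
by apply: (implyP (h s)); rewrite s0 (leq_trans _ se) // leq_add2l.
Qed.

(** Non-faces are closed upwards, so a missing face grows to one whose complement has exactly [d]
    points; [d <= n] keeps that set non-empty. *)
Lemma contains_skelP X d : (d <= n)%N -> X \subset admissible n ->
  contains_skel (upper_cplx X) d = ~~ [exists (c : {set V} | #|c| == d), outer X (~: c)].
Proof.
move=> dn XA; have cC (c : {set V}) : (#|c| + #|~: c| = n.+1)%N by rewrite cardsC card_ord.
apply/forallP/exists_inPn => [h c /eqP cd|h s].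
  have c0 : ~: c != set0 by rewrite -card_gt0; have := cC c; lia.
  by rewrite -mem_upper //; apply: (implyP (h _)); rewrite c0 /= addnC -cd cC.
apply/implyP => /andP[s0 sd]; rewrite mem_upper //; apply/negP => Us.
have /set0Pn[c] : [set c : {set V} | (c \subset ~: s) && (#|c| == d)] != set0.
  rewrite -card_gt0 cards_draws bin_gt0; have := cC s; lia.
rewrite inE => /andP[cs cd]; have := h c cd; rewrite (outer_up Us) //.
by rewrite -[s]setCK setCS.
Qed.

Lemma skel_codim_le Y d : (d <= n.+1)%N -> contains_skel Y d -> (skel_codim Y <= d)%N.
Proof.
move=> dn h; rewrite leqNgt; apply/negP => /(before_find 0%N).
by rewrite nth_iota ?ltnS // add0n h.
Qed.

Lemma skel_codim_gt Y d : (d <= n)%N -> ~~ contains_skel Y d -> (d < skel_codim Y)%N.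
Proof.
move=> dn; apply: contraR; rewrite -leqNgt => h.
have hn : (skel_codim Y < n.+2)%N by lia.
apply: contains_skel_mono h _.
have : has (contains_skel Y) (iota 0 n.+2) by rewrite has_find size_iota.
by move/(nth_find 0%N); rewrite nth_iota.
Qed.

Lemma cdim_upper X t : X \subset admissible n -> t \in X -> #|t| = n ->
  cdim (upper_cplx X) = n%:Z - 1.
Proof.
move=> XA tX tn; rewrite /cdim; congr (_ %:Z - 1); apply/eqP; rewrite eqn_leq.
apply/andP; split.
  apply/bigmax_leqP => s; rewrite inE => /andP[_ /exists_inP[u uX su]].
  apply: leq_trans (subset_leq_card su) _.
  rewrite -ltnS -[X in (_ < X)%N](card_ord n.+1) -cardsT proper_card // properT.
  by case/andP: (admissible_neq0 XA uX).
rewrite -[X in (X <= _)%N]tn.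
apply: (@leq_bigmax_cond _ [in upper_cplx X] (fun s : {set V} => #|s|)).
rewrite inE; case/andP: (admissible_neq0 XA tX) => -> _.
by apply/exists_inP; exists t.
Qed.

Section Bounds.
Variables (p P : R).
Hypothesis p0 : 0 < p.
Hypothesis pP : p <= P.
Hypothesis P1 : P < 1.
Hypothesis psp : forall s, s \in admissible n -> p <= ps s <= P.

Lemma ext_param_le s : ext_param s <= P.
Proof.
rewrite /ext_param; case: ifP => [/psp/andP[] //|_].
exact: le_trans (ltW p0) pP.
Qed.

Lemma prob_dim : (0 < n)%N -> 1 - (1 - p) ^+ n.+1 <= prob ps (fun Y => cdim Y == n%:Z - 1).
Proof.
move=> n0; pose S : {set {set V}} := [set s : {set V} | #|s| == n].
have SA s : s \in S -> s \in admissible n.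
  rewrite !inE => /eqP sn; rewrite -card_gt0 sn n0 /=.
  by apply/eqP => sT; move: sn; rewrite sT cardsT card_ord; lia.
apply: (prob_ge (bad := avoid S)) => [X XA|].
  rewrite /avoid -setI_eq0 => /set0Pn[t]; rewrite !inE => /andP[/eqP tn tX].
  by rewrite (cdim_upper XA tX).
rewrite Ex_avoid /pavoid.
have cS : #|S| = n.+1 by rewrite card_draws card_ord binSn.
rewrite -[X in _ ^+ X]cS -prodr_const; apply: ler_prod => s sS.
rewrite /ext_param SA //; have /andP[h1 h2] := psp (SA s sS).
by have h3 := P1; apply/andP; split; lra.
Qed.

Lemma skel_union d : (d <= n)%N ->
  Pr ext_param (fun X => [exists (c : {set V} | #|c| == d), outer X (~: c)]) <=
  'C(n.+1, d)%:R * (1 - p) ^+ (2 ^ d).-1.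
Proof.
move=> dn; apply: le_trans (Pr_union ext_param01 _ _) _.
have -> : 'C(n.+1, d)%:R * (1 - p) ^+ (2 ^ d).-1 =
    \sum_(c : {set V} | #|c| == d) (1 - p) ^+ (2 ^ d).-1.
  rewrite sumr_const -[RHS]mulr_natl; congr (_%:R * _).
  by rewrite -[X in 'C(X, _)](card_ord n.+1) -card_draws; apply: eq_card => c; rewrite inE.
apply: ler_sum => c /eqP cd; have cE : #|~: ~: c| = d by rewrite setCK.
rewrite /outer Ex_avoid -[X in (2 ^ X)%N]cE.
apply: (pavoid_star_le ext_param01 ext_paramT).
  exact: ltW (le_lt_trans pP P1).
move=> t ct tT; rewrite /ext_param inE tT andbT -card_gt0.
have tc : (0 < #|t|)%N.
  have := subset_leq_card ct; have : (#|c| + #|~: c| = n.+1)%N by rewrite cardsC card_ord.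
  lia.
by rewrite tc; have /psp/andP[] : t \in admissible n by rewrite inE -card_gt0 tc.
Qed.

End Bounds.

End UpperModel.

From mathcomp Require Import all_classical all_reals all_analysis.
Import numFieldNormedType.Exports.
Local Open Scope classical_set_scope.
Local Open Scope ring_scope.

(** * Asymptotics *)

Section Asymptotics.
Variable R : realType.
Implicit Types (x y c C : R).

Lemma ln2_gt0 : 0 < ln (2 : R).
Proof. by rewrite ln_gt0 // ltr1n. Qed.

Definition pow2 y : R := expR (y * ln 2).

Lemma pow2_nat (d : nat) : pow2 d%:R = 2 ^+ d.
Proof. by rewrite /pow2 -powR_mulrn // /powR pnatr_eq0 /=. Qed.

Lemma pow2D y z : pow2 (y + z) = pow2 y * pow2 z.
Proof. by rewrite /pow2 mulrDl expRD. Qed.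

Lemma pow2_gt0 y : 0 < pow2 y.
Proof. exact: expR_gt0. Qed.

Lemma le_pow2 y z : (pow2 y <= pow2 z) = (y <= z).
Proof. by rewrite /pow2 ler_expR ler_pM2r ?ln2_gt0. Qed.

Lemma log2K x : 0 < x -> pow2 (log2 x) = x.
Proof. by move=> x0; rewrite /pow2 /log2 divfK ?gt_eqF ?ln2_gt0 // lnK. Qed.

Lemma pow2N y : pow2 (- y) = (pow2 y)^-1.
Proof. by rewrite /pow2 mulNr expRN. Qed.

Lemma near_log2 (Q : R -> Prop) :
  (\forall y \near +oo, Q y) -> \forall x \near +oo, Q (log2 x).
Proof.
move=> [M [Mr HM]]; near=> x; apply: HM.
have x1 : expR (M * ln 2) < x by near: x; apply: nbhs_pinfty_gt; rewrite num_real.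
rewrite /log2 ltr_pdivlMr ?ln2_gt0 // -[ltLHS]expRK ltr_ln // posrE ?expR_gt0 //.
Unshelve. all: by end_near. Qed.

Lemma near_ln_nat (Q : R -> Prop) :
  (\forall x \near +oo, Q x) -> \forall n \near \oo, Q (ln (n%:R : R)).
Proof.
move=> [M [Mr HM]]; near=> n; apply: HM.
have x1 : expR M < n%:R by near: n; apply: nbhs_infty_gtr.
rewrite -[ltLHS]expRK ltr_ln // posrE ?expR_gt0 //.
exact: lt_trans (expR_gt0 _) x1.
Unshelve. all: by end_near. Qed.

Lemma expR_ge_pow (m : nat) y : 0 <= y -> (y / m.+1%:R) ^+ m.+1 <= expR y.
Proof.
move=> y0; have -> : expR y = expR (y / m.+1%:R) ^+ m.+1.
  by rewrite -expRM_natl mulrC divfK // pnatr_eq0.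
rewrite lerXn2r ?nnegrE ?expR_ge0 ?divr_ge0 //.
apply: le_trans (expR_ge1Dx _); by rewrite lerDr.
Qed.

Lemma near_poly_expR (m : nat) c C : 0 < c -> \forall x \near +oo, C * x ^+ m <= expR (c * x).
Proof.
move=> c0; near=> x.
have x0 : 0 < x by near: x; apply: nbhs_pinfty_gt; rewrite num_real.
have xC : C * (m.+1%:R / c) ^+ m.+1 <= x by near: x; apply: nbhs_pinfty_ge; rewrite num_real.
apply: le_trans (expR_ge_pow m (mulr_ge0 (ltW c0) (ltW x0))).
have -> : c * x / m.+1%:R = (m.+1%:R / c)^-1 * x.
  by rewrite invf_div mulrAC.
rewrite exprMn exprVn [leRHS]mulrC [x ^+ m.+1]exprS.
rewrite ler_pdivlMr ?exprn_gt0 ?divr_gt0 ?ltr0n // mulrAC.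
by rewrite ler_wpM2r ?exprn_ge0 // ltW.
Unshelve. all: by end_near. Qed.

Lemma near_log2_le c C : 0 < c -> \forall x \near +oo, log2 x + C <= c * x.
Proof.
move=> c0; pose a := c * ln 2.
have a0 : 0 < a by rewrite mulr_gt0 ?ln2_gt0.
near=> x.
have x0 : 0 < x by near: x; apply: nbhs_pinfty_gt; rewrite num_real.
have : expR (C * ln 2) * x ^+ 1 <= expR (a * x) by near: x; apply: near_poly_expR.
have e0 : 0 < expR (C * ln 2) := expR_gt0 _.
rewrite expr1 -ler_ln ?posrE ?expR_gt0 ?mulr_gt0 // lnM ?posrE //.
rewrite !expRK /a addrC mulrAC => h.
by rewrite -(ler_pM2r ln2_gt0) mulrDl /log2 divfK // gt_eqF ?ln2_gt0.
Unshelve. all: by end_near. Qed.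

Lemma cvg_to_one (f : nat -> R) : (forall n, f n <= 1) ->
  (forall e, 0 < e -> \forall n \near \oo, 1 - e <= f n) -> f @ \oo --> (1 : R).
Proof.
move=> f1 fe; apply/cvgrPdist_le => e e0; near=> n.
rewrite ger0_norm ?subr_ge0 //.
have : 1 - e <= f n by near: n; apply: fe.
by rewrite lerBlDr lerBlDl addrC.
Unshelve. all: by end_near. Qed.

End Asymptotics.

(** * The largest skeleton *)

Section Exponents.
Variable R : realType.
Implicit Types (x y a C g : R) (d : nat).

(** Here $x=\ln n$, and the final quantity is the exponent of the union bound, $\binom{n+1}{d}\le
    e^{d(x+1)}$ against $e^{-a(2^d-1)}$. Both parts have order $x\log_2x$; the factor $1+g$
    decides. *)
Lemma upper_exponent a C g K : 0 < g ->
  \forall x \near +oo, [/\ 0 < x, K <= x, 0 < log2 x,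
    0 <= log2 x + log2 (log2 x) + C & log2 x + log2 (log2 x) + C <= x] /\
  forall d, d%:R <= log2 x + log2 (log2 x) + C ->
  (1 + g) * x * log2 x <= a * 2 ^+ d ->
  d%:R * (x + 1) - a * (2 ^+ d - 1) <= - x.
Proof.
move=> g0; near=> x.
have x0 : 0 < x by near: x; apply: nbhs_pinfty_gt; rewrite num_real.
have xK : K <= x by near: x; apply: nbhs_pinfty_ge; rewrite num_real.
have y0 : 0 < log2 x.
  by near: x; apply: (@near_log2 R (fun y => 0 < y)); apply: nbhs_pinfty_gt; rewrite num_real.
have z0 : - C <= log2 (log2 x).
  near: x; apply: (@near_log2 R (fun y => - C <= log2 y)).
  by apply: (@near_log2 R (fun y => - C <= y)); apply: nbhs_pinfty_ge; rewrite num_real.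
have yx : log2 x + C / 2 <= 2^-1 * x by near: x; apply: near_log2_le.
have h1 : log2 (log2 x) + (C + 3) <= g * log2 x.
  by near: x; apply: (@near_log2 R (fun y => log2 y + (C + 3) <= g * y)); apply: near_log2_le.
have h2 : log2 (log2 x) + 0 <= 1 * log2 x.
  by near: x; apply: (@near_log2 R (fun y => log2 y + 0 <= 1 * y)); apply: near_log2_le.
have h3 : log2 x + (C + a) / 2 <= 1 * x by near: x; apply: near_log2_le.
set y := log2 x in h1 h2 h3 y0 z0 yx *; set z := log2 y in h1 h2 z0 *.
split=> [|d dle ale]; first by split => //; lra.
have e1 : d%:R * (x + 1) <= (y + z + C) * (x + 1) by rewrite ler_wpM2r // addr_ge0 // ltW.
have e2 : x * (z + (C + 3)) <= x * (g * y) by rewrite ler_wpM2l // ltW.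
have e3 : x * (g * y) = g * x * y by ring.
lra.
Unshelve. all: by end_near. Qed.

(** With $x=\ln n$ and $E=e^{a2^d/d}$, the final quantity bounds the exponent of $d^2E/n$, the size
    of the variance term. It is negative because $d$ exceeds $\log_2x$ by at least 1. *)
Lemma lower_exponent a C K : 0 < a ->
  \forall x \near +oo, [/\ 0 < x, K <= log2 x, 0 < log2 x,
    0 <= log2 x + log2 (log2 x) + C & log2 x + log2 (log2 x) + C <= x] /\
  forall d, log2 x + log2 (log2 x) + C - 1 < d%:R ->
  d%:R <= log2 x + log2 (log2 x) + C ->
  a * 2 ^+ d <= x * log2 x ->
  (0 < d)%N /\ a * 2 ^+ d / d%:R + 2 * d%:R - x <= - log2 x.
Proof.
move=> a0; near=> x.
have x0 : 0 < x by near: x; apply: nbhs_pinfty_gt; rewrite num_real.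
have yK : K <= log2 x.
  by near: x; apply: (@near_log2 R (fun y => K <= y)); apply: nbhs_pinfty_ge; rewrite num_real.
have yx : log2 x + C / 2 <= 2^-1 * x by near: x; apply: near_log2_le.
have h1 : 2 - C <= log2 (log2 x).
  near: x; apply: (@near_log2 R (fun y => 2 - C <= log2 y)).
  by apply: (@near_log2 R (fun y => 2 - C <= y)); apply: nbhs_pinfty_ge; rewrite num_real.
have h2 : log2 (log2 x) + 0 <= 1 * log2 x.
  by near: x; apply: (@near_log2 R (fun y => log2 y + 0 <= 1 * y)); apply: near_log2_le.
have h3 : C <= log2 x.
  by near: x; apply: (@near_log2 R (fun y => C <= y)); apply: nbhs_pinfty_ge; rewrite num_real.
have h4 : 21 * log2 x ^+ 2 <= x.
  rewrite -[leRHS](log2K x0) /pow2 mulrC [log2 x * _]mulrC [leLHS]mulrC; near: x.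
  apply: (@near_log2 R (fun y => 21 * y ^+ 2 <= expR (ln 2 * y))).
  exact/near_poly_expR/ln2_gt0.
have h5 : 1 <= log2 x.
  by near: x; apply: (@near_log2 R (fun y => 1 <= y)); apply: nbhs_pinfty_ge; rewrite num_real.
set y := log2 x in h1 h2 h3 h4 h5 yK yx *; set z := log2 y in h1 h2 *.
split=> [|d dgt dle ale]; first by split => //; lra.
have dy : y + 1 <= d%:R by lra.
have d3 : d%:R <= 3 * y by lra.
have d0 : 0 < d%:R :> R by lra.
split; first by rewrite ltr0n in d0.
(* Of the $7y$, six absorb $2d\le6y$ and one is the conclusion; the 21 in [h4] is 7 times the 3 of
   [d3]. *)
suff : a * 2 ^+ d / d%:R <= x - 7 * y by lra.
rewrite ler_pdivrMr //; apply: le_trans ale _.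
have e1 : 7 * y * d%:R <= 7 * y * (3 * y) by rewrite ler_wpM2l //; lra.
have e2 : x * (y + 1) <= x * d%:R by rewrite ler_wpM2l // ltW.
have e3 : 7 * y * (3 * y) = 21 * y ^+ 2 by ring.
lra.
Unshelve. all: by end_near. Qed.

Lemma pred_exp_convex i d : (i <= d)%N -> ((2 ^ i).-1 * d <= i * 2 ^ d)%N.
Proof.
case: i => [|i] id; first by rewrite mul0n.
apply: (@leq_trans (2 ^ i.+1 * d)); first by rewrite leq_mul2r leq_pred orbT.
rewrite -(subnK id) expnD mulnCA [X in (_ <= X)%N]mulnC mulnAC [X in (X <= _)%N]mulnC leq_mul2r.
have := ltn_expl (d - i.+1) (isT : 1 < 2)%N.
by set k := (d - i.+1)%N; set m := (2 ^ k)%N => km; apply/orP; right; nia.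
Qed.

(** The last hypothesis of [no_outer] in exponents: by convexity of $2^i$, the slope $a2^d/d$ at the
    endpoint suffices for every smaller overlap, hence this choice of $\ln E$. *)
Lemma exponent_trade (a : R) i d : 0 < a -> (0 < d)%N -> (i <= d)%N ->
  0 <= i%:R * (a * 2 ^+ d / d%:R) + (2 ^ i).-1%:R * - a.
Proof.
move=> a0 d0 id; rewrite mulrN subr_ge0 -!mulrA [leRHS]mulrCA [leLHS]mulrC.
rewrite ler_wpM2l ?(ltW a0) // mulrA ler_pdivlMr ?ltr0n // -natrX -!natrM ler_nat.
exact: pred_exp_convex.
Qed.

Lemma expR_le_linear (u : R) : 0 <= u -> u <= 2^-1 -> expR u <= 1 + 2 * u.
Proof.
move=> u0 u2; have hu := expR_ge1Dx (- u); have u1 : 0 < 1 - u by lra.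
rewrite -[u in expR u]opprK expRN; apply: (@le_trans _ _ (1 - u)^-1).
  by rewrite lef_pV2 ?posrE ?expR_gt0.
by rewrite -[leLHS]mul1r ler_pdivrMr //; nra.
Qed.

Lemma natS_le_expR n : (0 < n)%N -> n.+1%:R <= expR (ln (n%:R : R) + 1).
Proof.
move=> n0; rewrite expRD lnK ?posrE ?ltr0n //.
apply: (@le_trans _ _ (n%:R * 2)); first by rewrite -natrM ler_nat; lia.
by rewrite ler_wpM2l //; have := expR_ge1Dx (1 : R); lra.
Qed.

Lemma beta_pow2 (n : nat) (a : R) : 0 < a -> 0 < log2 (ln (n%:R : R)) -> 0 < ln (n%:R : R) ->
  a * pow2 (beta n a) = ln n%:R * log2 (ln n%:R).
Proof.
move=> a0 y0 x0; rewrite /beta !pow2D pow2N !log2K //.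
by field; rewrite gt_eqF.
Qed.

Lemma near_nat_pos : \forall n \near \oo, (0 < n)%N.
Proof. exact: nbhs_infty_gt. Qed.

End Exponents.

(** * The two skeleton bounds for large n *)

Section Tails.
Variables (R : realType) (p P : R) (ps : forall n : nat, {set 'I_n.+1} -> R).
Hypothesis p0 : 0 < p.
Hypothesis pP : p <= P.
Hypothesis P1 : P < 1.
Hypothesis psp : forall (n : nat) (s : {set 'I_n.+1}), s \in admissible n -> p <= ps s <= P.

Lemma ps01 n (s : {set 'I_n.+1}) : s \in admissible n -> 0 <= ps s <= 1.
Proof. by have ? := p0; have ? := P1; move/psp/andP => [h1 h2]; apply/andP; split; lra. Qed.

Lemma dual_gt0 (q : R) : 0 < q -> q < 1 -> 0 < - ln (1 - q).
Proof. by move=> q0 q1; rewrite oppr_gt0 ln_lt0 //; apply/andP; split; lra. Qed.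

Lemma expR_dual (q : R) : q < 1 -> expR (- (- ln (1 - q))) = 1 - q.
Proof. by move=> q1; rewrite opprK lnK // posrE subr_gt0. Qed.

Lemma near_skeleton (eps0 e : R) : 0 < eps0 -> 0 < e ->
  \forall n \near \oo,
  let h := beta n (- ln (1 - p)) + 1 + eps0 in let d := Num.truncn h in
  [/\ 0 <= h, (d <= n)%N &
    Pr (ext_param (ps (n:=n)))
     (fun X => [exists (c : {set 'I_n.+1} | #|c| == d), outer X (~: c)%SET]) <= e].
Proof.
move=> eps00 e0; set a := - ln (1 - p).
have p1 : p < 1 := le_lt_trans pP P1.
have a0 : 0 < a by apply: dual_gt0.
(* Rounding [h] down costs less than the [+ 1] it contains, so $2^d$ keeps the factor
   $2^{\epsilon_0}=1+g$. *)
pose g : R := pow2 eps0 - 1.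
have g0 : 0 < g.
  rewrite subr_gt0 (_ : 1 = pow2 0); last by rewrite /pow2 mul0r expR0.
  by rewrite lt_neqAle le_pow2 (ltW eps00) andbT; apply/eqP => /eqP;
     rewrite eq_le !le_pow2 => /andP[_]; rewrite leNgt eps00.
pose C : R := - log2 a + 1 + eps0.
near=> n.
have n0 : (0 < n)%N by near: n; apply: near_nat_pos.
have [] := near (near_ln_nat (upper_exponent a C (- ln e) g0)) n.
  by [].
set x : R := ln n%:R => -[x0 xe y0 hh0 hhx] expo.
set h := beta n a + 1 + eps0; set d := Num.truncn h.
have hE : h = log2 x + log2 (log2 x) + C by rewrite /h /beta /C -/x; ring.
have h0 : 0 <= h by rewrite hE.
have /andP[dh hd] := truncn_itv h0; rewrite -/d in dh hd.
have xn : x <= n%:R.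
  have := expR_ge1Dx x; rewrite lnK ?posrE ?ltr0n //; lra.
have dn : (d <= n)%N.
  by rewrite -(ler_nat R); apply: le_trans dh _; apply: le_trans xn; rewrite hE.
split => //.
apply: le_trans (skel_union (@ps01 n) p0 pP P1 (@psp n) dn) _.
have {}expo := expo d; rewrite -hE in expo.
have pow_d : (1 + g) * x * log2 x <= a * 2 ^+ d.
  have -> : (1 + g) * x * log2 x = a * pow2 (h - 1).
    rewrite /g addrC subrK (_ : h - 1 = eps0 + beta n a); last by rewrite /h; ring.
    have bp := beta_pow2 a0 y0 x0.
    by rewrite pow2D [RHS]mulrCA bp; apply: esym; apply: mulrA.
  rewrite ler_wpM2l ?(ltW a0) // -pow2_nat le_pow2.
  by rewrite lerBlDr natr1 ltW.
have {}expo := expo dh pow_d.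
apply: (@le_trans _ _ (expR (d%:R * (x + 1) - a * (2 ^+ d - 1)))); last first.
  by rewrite -[leRHS]lnK ?posrE // ler_expR (le_trans expo) // lerNl.
rewrite expRD; apply: ler_pM; rewrite ?exprn_ge0 ?subr_ge0 ?(ltW p1) //.
  apply: (@le_trans _ _ (n.+1%:R ^+ d)); first by rewrite -natrX ler_nat bin_le_exp.
  by rewrite expRM_natl lerXn2r ?nnegrE ?expR_ge0 // natS_le_expR.
rewrite -(expR_dual p1) -/a -expRM_natl ler_expR mulrN mulrC.
by rewrite lerN2 ler_wpM2l ?(ltW a0) // -natrX -subn1 natrB // expn_gt0.
Unshelve. all: by end_near. Qed.

Lemma near_missing_face (e : R) : 0 < e ->
  \forall n \near \oo,
  let h := beta n (- ln (1 - P)) in let d := Num.truncn h in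
  [/\ 0 <= h, (d <= n)%N &
    Pr (ext_param (ps (n:=n)))
     (fun X => ~~ [exists (c : {set 'I_n.+1} | #|c| == d), outer X (~: c)%SET]) <= e].
Proof.
move=> e0; set a := - ln (1 - P).
have P0 : 0 < P := lt_le_trans p0 pP.
have a0 : 0 < a by apply: dual_gt0.
pose C : R := - log2 a.
near=> n.
have n0 : (0 < n)%N by near: n; apply: near_nat_pos.
(* The two thresholds yield $u\le e/2$ and $u\le1/2$ below. *)
have [] := near (near_ln_nat (lower_exponent C (Num.max (- ln (e / 2)) (- ln 2^-1)) a0)) n.
  by [].
set x : R := ln n%:R => -[x0 yK y0 hh0 hhx] expo.
set h := beta n a; set d := Num.truncn h.
have {yK}[ye y2] : - ln (e / 2) <= log2 x /\ - ln 2^-1 <= log2 x.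
  by move: yK; rewrite ge_max => /andP.
have hE : h = log2 x + log2 (log2 x) + C by rewrite /h /beta /C -/x; ring.
have h0 : 0 <= h by rewrite hE.
have /andP[dh hd] := truncn_itv h0; rewrite -/d in dh hd.
have xn : x <= n%:R.
  have := expR_ge1Dx x; rewrite lnK ?posrE ?ltr0n //; lra.
have dn : (d <= n)%N.
  by rewrite -(ler_nat R); apply: le_trans dh _; apply: le_trans xn; rewrite hE.
split => //.
have pow_d : a * 2 ^+ d <= x * log2 x.
  rewrite -(beta_pow2 a0 y0 x0) -/h ler_wpM2l ?(ltW a0) //.
  by rewrite -pow2_nat le_pow2.
have {expo}[||d0 expo] := expo d _ _ pow_d; rewrite -?hE //.
  by rewrite ltrBlDr natr1.
pose E := expR (a * 2 ^+ d / d%:R).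
have dR : 0 < d%:R :> R by rewrite ltr0n.
have E1 : 1 <= E by rewrite -[leLHS]expR0 ler_expR !mulr_ge0 ?exprn_ge0 ?(ltW a0) ?invr_ge0 ?ler0n.
have Ei i : (i <= d)%N -> 1 <= E ^+ i * (1 - P) ^+ (2 ^ i).-1.
  move=> id; rewrite -(expR_dual P1) -/a -!expRM_natl -expRD -[leLHS]expR0 ler_expR.
  exact: exponent_trade.
have := no_outer (ext_param01 (@ps01 n)) (ext_paramT (ps (n:=n))) (ltW P0) P1
  (ext_param_le p0 pP (@psp n)) (leqW dn) E1 Ei.
move/le_trans; apply.
(* The variance bound is $(1+w)^d-1\le e^{dw}-1\le2u$. *)
pose w := (E - 1) * d%:R / n.+1%:R.
pose u := expR (- log2 x).
have wu : d%:R * w <= u.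
  have d2 : d%:R <= expR d%:R :> R.
    by apply: le_trans (expR_ge1Dx _); rewrite lerDr.
  rewrite /u /w mulrCA !mulrA ler_pdivrMr ?ltr0n //.
  apply: (@le_trans _ _ (E * expR (2 * d%:R))).
    rewrite -mulrA; apply: ler_pM; rewrite ?subr_ge0 ?mulr_ge0 // ?gerBl //.
    have -> : 2 * d%:R = d%:R + d%:R :> R by ring.
    by rewrite expRD; apply: ler_pM.
  apply: (@le_trans _ _ (expR (- log2 x) * n%:R)); last first.
    by rewrite ler_wpM2l ?expR_ge0 // ler_nat.
  rewrite -[n%:R]lnK ?posrE ?ltr0n // -!expRD ler_expR -/x [leRHS]addrC.
  by rewrite -lerBlDl.
have w0 : 0 <= w by rewrite !mulr_ge0 ?subr_ge0 ?invr_ge0 ?ler0n.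
have u2 : u <= 2^-1 by rewrite -[leRHS]lnK ?posrE // ler_expR lerNl.
have ue : u <= e / 2 by rewrite -[leRHS]lnK ?posrE ?divr_gt0 // ler_expR lerNl.
rewrite -/w lerBlDr; apply: (@le_trans _ _ (expR u)).
  apply: (@le_trans _ _ (expR (d%:R * w))); last by rewrite ler_expR.
  by rewrite expRM_natl lerXn2r ?nnegrE ?expR_ge0 ?expR_ge1Dx // addr_ge0.
apply: (@le_trans _ _ (1 + 2 * u)); first by rewrite expR_le_linear // expR_ge0.
by rewrite addrC lerD2r mulrC -ler_pdivlMr.
Unshelve. all: by end_near. Qed.

End Tails.

(** * Probability of a bad link *)

Section LinkBound.
Variables (R : realType).

Lemma pred_half (a b m : nat) : (a + b = m)%N -> (2 * (b + 2) <= m)%N -> (m <= a.-1 * 2)%N.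
Proof. lia. Qed.

Lemma pow2_le_expR (t : nat) : (2 : R) ^+ t <= expR t%:R.
Proof.
rewrite -[t%:R]mulr1 expRM_natl lerXn2r ?nnegrE ?expR_ge0 //.
by have := expR_ge1Dx (1 : R); lra.
Qed.

(** The exponent is $t-lx/2\le T/8-T/4$; hence thresholds at an eighth of the mean. *)
Lemma tail_le (x T : R) (t l : nat) : 0 <= x <= 1 -> T / 2 <= l%:R * x -> t%:R <= T / 8 ->
  2 ^+ t * (1 - x / 2) ^+ l <= expR (- (T / 8)).
Proof.
move=> /andP[x0 x1] Tl tT.
have h : (1 - x / 2) ^+ l <= expR (l%:R * (- (x / 2))).
  rewrite expRM_natl lerXn2r ?nnegrE ?expR_ge0 //; first by lra.
  exact: expR_ge1Dx.
apply: (@le_trans _ _ (expR t%:R * expR (l%:R * (- (x / 2))))).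
  by apply: ler_pM; rewrite ?exprn_ge0 ?pow2_le_expR //; lra.
by rewrite -expRD ler_expR; lra.
Qed.

(** The 64 is $4\cdot16$: rounding leaves $t\ge T/16$, the second-order term is at most [kappa], and
    so the left side is at most $4(i+1)\kappa=T/16$. *)
Lemma link_params (N Q q : R) (i : nat) : 0 < N -> 0 < Q -> 0 < q <= 1 -> 32 <= N * Q * q ->
  let T := N * Q * q in let kappa := T / (64 * i.+1%:R) in
  let s := Num.truncn (N * Q / 8) in let t := Num.truncn (T / 8) in
  [/\ 0 < kappa, (1 < s)%N, (0 < t)%N, s%:R <= N * Q / 8 /\ t%:R <= T / 8 &
    (2 * i.+1)%:R * (kappa + 4 * kappa ^+ 2 / (q * s%:R)) <= t%:R].
Proof.
move=> N0 Q0 /andP[q0 q1] T32 T kappa s t; rewrite -/T in T32.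
have NQ : T <= N * Q by rewrite /T ler_piMr // mulr_ge0 // ltW.
have T8 : 0 <= T / 8 by lra.
have NQ8 : 0 <= N * Q / 8 by lra.
have st := truncn_itv NQ8; have tt := truncn_itv T8.
rewrite -/s -/t -[s.+1%:R]natr1 -[t.+1%:R]natr1 in st tt.
have i0 : 0 < i.+1%:R :> R by rewrite ltr0n.
have k0 : 0 < kappa.
  by apply: divr_gt0; [lra | apply: mulr_gt0].
case/andP: st => s1 s2; case/andP: tt => t1 t2.
have s3 : N * Q / 16 <= s%:R by move: s2 T32 NQ; clear; move: (s%:R : R) => u; lra.
have t3 : T / 16 <= t%:R by move: t2 T32; clear; move: (t%:R : R) => u; lra.
split=> //.
- by rewrite -(ltr_nat R); move: s3 s2 T32 NQ; clear; move: (s%:R : R) => u; lra.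
- by rewrite -(ltr_nat R); move: t3 T32; clear; move: (t%:R : R) => u; lra.
apply: le_trans t3.
have qs : T / 16 <= q * s%:R.
  have -> : T / 16 = q * (N * Q / 16) by rewrite /T; ring.
  by rewrite ler_wpM2l // ltW.
have T0 : 0 < T by lra.
have h : 4 * kappa ^+ 2 / (q * s%:R) <= 64 * kappa ^+ 2 / T.
  rewrite ler_pdivrMr; last by apply: lt_le_trans qs; lra.
  rewrite mulrAC ler_pdivlMr //.
  have -> : 64 * kappa ^+ 2 * (q * s%:R) = 64 * kappa ^+ 2 * (q * s%:R - T / 16) + 4 * kappa ^+ 2 * T by field.
  by rewrite lerDr mulr_ge0 ?subr_ge0 // mulr_ge0 // sqr_ge0.
have h2 : 64 * kappa ^+ 2 / T <= kappa.
  rewrite ler_pdivrMr // expr2 mulrCA ler_wpM2l ?(ltW k0) //.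
  rewrite /kappa mulrCA ler_piMr ?(ltW T0) // ler_pdivrMr ?mulr_gt0 // mul1r.
  by rewrite ler_peMr // ler1n.
apply: (@le_trans _ _ ((2 * i.+1)%:R * (2 * kappa))).
  by rewrite ler_wpM2l //; lra.
rewrite /kappa natrM le_eqVlt; apply/orP; left; apply/eqP; field.
by rewrite gt_eqF.
Qed.

(** Since $\kappa=T/c$, the trace bound divided by $\kappa^{2k}$ decays like a [k]-th power once [T]
    exceeds $(k+1)^2c^2$. *)
Lemma trace_term (N Q T kappa c : R) (k : nat) :
  0 < N -> 0 < Q -> Q <= 1 -> 0 < T -> 0 < c -> kappa = T / c ->
  k.+1%:R ^+ (k + k).+1 * (N * Q) * T ^+ k / kappa ^+ (2 * k) <=
  k.+1%:R * N * (k.+1%:R ^+ 2 * c ^+ 2 / T) ^+ k.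
Proof.
move=> N0 Q0 Q1 T0 c0 ->.
have -> : k.+1%:R ^+ (k + k).+1 * (N * Q) * T ^+ k / (T / c) ^+ (2 * k) =
  Q * (k.+1%:R * N * (k.+1%:R ^+ 2 * c ^+ 2 / T) ^+ k).
  rewrite addnn -mul2n exprS !exprM !expr_div_n [(_ ^+ 2 * c ^+ 2) ^+ k]exprMn.
  have -> : (T ^+ 2) ^+ k = T ^+ k * T ^+ k by rewrite -exprMn -expr2.
  set K := (k.+1%:R ^+ 2) ^+ k; set C := (c ^+ 2) ^+ k.
  have Tk : T ^+ k != 0 by rewrite expf_neq0 // gt_eqF.
  have Ck : C != 0 by rewrite !expf_neq0 // gt_eqF.
  by field; rewrite Tk Ck.
by rewrite ler_piMl // !mulr_ge0 ?exprn_ge0 ?divr_ge0 ?mulr_ge0 ?sqr_ge0 // ltW.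
Qed.

Section Finite.
Variables (n : nat) (p : {set 'I_n.+1} -> R).
Local Notation V := 'I_n.+1.
Hypothesis p01 : forall s, 0 <= p s <= 1.

Lemma bad_link_bound (r : {set V}) (Q q : R) (j : nat) :
  (forall v, v \in r -> pavoid p (block r [set v]) = Q) ->
  (forall e : {set V}, #|e| = 2 -> e \subset r -> pavoid p (block r e) = q) ->
  0 < Q -> Q <= 1 -> 0 < q -> q <= 1 ->
  (2 * (#|~: r| + 2) <= n.+1)%N ->
  let T := n.+1%:R * Q * q in let c := 64 * #|~: r|.+1%:R in 32 <= T ->
  Pr p (fun X => ~~ good_link q r X ((T / c) ^+ (2 * 2 ^ j)) j
    (Num.truncn (n.+1%:R * Q / 8)) (Num.truncn (T / 8))) <=
  (2 ^ j).+1%:R * n.+1%:R * ((2 ^ j).+1%:R ^+ 2 * c ^+ 2 / T) ^+ (2 ^ j)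
   + 2 * n.+1%:R * expR (- (T / 8)).
Proof.
move=> HQ Hq Q0 Q1 q0 q1 iN T c T32.
have N0 : 0 < n.+1%:R :> R by rewrite ltr0n.
have q01 : 0 < q <= 1 by rewrite q0.
have [k0 _ _ [sle tle] _] := link_params #|~: r| N0 Q0 q01 T32.
have T1 : 1 <= T by lra.
have c0 : 0 < c by rewrite mulr_gt0 // ltr0n.
have ck : 0 < (T / c) ^+ (2 * 2 ^ j) by rewrite exprn_gt0.
have q01' : 0 <= q <= 1 by rewrite ltW.
apply: le_trans (@bad_link R n p p01 r Q q _ j _ _ HQ Hq (ltW Q0) q01' T1 ck) _.
rewrite -addrA; apply: lerD.
  exact: (trace_term (kappa := T / c) (2 ^ j) N0 Q0 Q1 (lt_le_trans ltr01 T1) c0 erefl).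
have rN : (#|r| <= n.+1)%N by rewrite -[X in (_ <= X)%N](card_ord n.+1) max_card.
have cr : (#|r| + #|~: r| = n.+1)%N by rewrite cardsC card_ord.
have half : n.+1%:R / 2 <= #|r|.-1%:R :> R.
  by rewrite ler_pdivrMr // -natrM ler_nat (pred_half cr).
have half' : n.+1%:R / 2 <= #|r|%:R :> R.
  by apply: le_trans half _; rewrite ler_nat leq_pred.
have e1 : 2 ^+ Num.truncn (n.+1%:R * Q / 8) * (1 - Q / 2) ^+ #|r| <= expR (- (T / 8)).
  apply: (@le_trans _ _ (expR (- (n.+1%:R * Q / 8)))).
    apply: tail_le => //; first by rewrite ltW.
    by rewrite mulrAC ler_wpM2r // ltW.
  by rewrite ler_expR lerN2 ler_wpM2r // /T ler_piMr // mulr_ge0 // ltW.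
have e2 : 2 ^+ Num.truncn (T / 8) * (1 - Q * q / 2) ^+ #|r|.-1 <= expR (- (T / 8)).
  apply: tail_le => //; first by rewrite mulr_ge0 ?mulr_ile1 // ltW.
  by rewrite /T -[_ * Q * q]mulrA mulrAC ler_wpM2r // mulr_ge0 // ltW.
have -> : 2 * n.+1%:R * expR (- (T / 8)) = n.+1%:R * expR (- (T / 8)) + n.+1%:R * expR (- (T / 8)) by ring.
apply: lerD.
  apply: le_trans e1 _; by rewrite ler_peMl ?expR_ge0 // ler1n.
by apply: ler_pM => //; rewrite ?ler_nat // mulr_ge0 // exprn_ge0 //; nra.
Qed.

Lemma count_small_compl (I : nat) (b : R) : 0 <= b ->
  \sum_(r : {set V} | (#|~: r| <= I)%N) b <= I.+1%:R * n.+1%:R ^+ I * b.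
Proof.
move=> b0; rewrite (reindex_inj (@finset.setC_inj V)) /=.
under eq_bigl do rewrite finset.setCK.
rewrite big_mkcond -mulrA.
rewrite [leLHS](sum_by_card V (fun d => if (d <= I)%N then b else 0)) card_ord.
apply: (@le_trans _ _ (\sum_(d < n.+2) (d < I.+1)%N%:R * (n.+1%:R ^+ I * b))).
  apply: ler_sum => -[d _] _ /=; rewrite ltnS; case: leqP => dI; last by rewrite mulr0 mul0r.
  rewrite mul1r ler_wpM2r // -natrX ler_nat (leq_trans (bin_le_exp _ _)) //.
  by rewrite leq_pexp2l.
rewrite -mulr_suml ler_wpM2r ?mulr_ge0 ?exprn_ge0 // -natr_sum ler_nat.
suff h m : (\sum_(d < m) (d < I.+1) <= minn m I.+1)%N by apply: leq_trans (h _) (geq_minr _ _).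
elim: m => [|m IH]; first by rewrite big_ord0.
by rewrite big_ord_recr /=; move: IH; set S := (\sum_(_ < _) _)%N; lia.
Qed.

Hypothesis hom : forall s s' : {set V}, #|s| = #|s'| -> p s = p s'.

(** Under homogeneity the choice of the [k]-subset is immaterial; the default covers sets [r] with
    fewer than [k] points. *)
Definition link_prob (k : nat) (r : {set V}) : R :=
  pavoid p (block r (odflt finset.set0 [pick e : {set V} | (e \subset r) && (#|e| == k)])).

Lemma link_probE k (r e : {set V}) : e \subset r -> #|e| = k -> pavoid p (block r e) = link_prob k r.
Proof.
move=> er ek; rewrite /link_prob; case: pickP => [e' /andP[er' /eqP ek']|/(_ e)] /=.
  by apply: pavoid_block_hom; rewrite ?ek.
by rewrite er ek eqxx.
Qed.

Lemma link_prob_itv (P : R) k (r : {set V}) : 0 <= P -> P <= 1 -> (forall s, p s <= P) ->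
  (1 - P) ^+ (2 ^ #|~: r|) <= link_prob k r <= 1.
Proof.
move=> P0 P1 pP; rewrite pavoid_le1 // andbT; apply: pavoid_block_ge => //.
by case: pickP => [e /andP[]|_] //=; rewrite finset.sub0set.
Qed.

End Finite.
End LinkBound.

(** * The union bound over links in the limit *)

Section Regime.
Variable R : realType.

Definition link_error (N T : R) (m k : nat) : R :=
  k.+1%:R * N * (k.+1%:R ^+ 2 * (64 * m%:R) ^+ 2 / T) ^+ k + 2 * N * expR (- (T / 8)).

Lemma link_error_le (N T T' : R) (m m' k : nat) : 0 <= N -> 0 < T -> T <= T' -> (m' <= m)%N ->
  link_error N T' m' k <= link_error N T m k.
Proof.
move=> N0 T0 TT mm; have T0' : 0 < T' := lt_le_trans T0 TT.
apply: lerD; apply: ler_wpM2l; rewrite ?mulr_ge0 //; last by rewrite ler_expR lerN2 ler_wpM2r.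
rewrite lerXn2r ?nnegrE ?divr_ge0 ?mulr_ge0 ?sqr_ge0 ?(ltW T0) ?(ltW T0') //.
apply: ler_pM; rewrite ?invr_ge0 ?mulr_ge0 ?sqr_ge0 ?(ltW T0') //; last by rewrite lef_pV2 ?posrE.
by rewrite ler_wpM2l ?sqr_ge0 // lerXn2r ?nnegrE ?mulr_ge0 // ler_wpM2l // ler_nat.
Qed.

(** With $x=\ln n$, the base of the [k]-th power is at most $e^{-\eta x}$ and $k\ge x/4$, so one
    link fails with probability about $e^{-\eta x^2/4}$. The condition $m\le\eta x/16$ lets the
    factor $N^m\le e^{2mx}$ use up only half of this exponent. *)
Lemma near_link_error (eta e : R) : 0 < eta -> eta <= 1 -> 0 < e ->
  \forall x \near +oo, forall (m k : nat) (N : R), 0 < N -> N <= expR (2 * x) ->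
  (0 < m)%N -> m%:R <= eta * x / 16 -> x / 4 <= k%:R -> k.+1%:R <= x ->
  m%:R * N ^+ m.-1 * link_error N (expR (2 * eta * x)) m k <= e.
Proof.
move=> eta0 eta1 e0; have eta8 : 0 < eta / 8 by rewrite divr_gt0.
have eta2 : 0 < 2 * eta by rewrite mulr_gt0.
near=> x => m k N N0 Nx m0 mx kx k1x.
have x1 : 1 <= x by near: x; apply: nbhs_pinfty_ge; rewrite num_real.
have X1 : 4096 * x ^+ 4 <= expR (eta * x) by near: x; apply: near_poly_expR.
have X2 : 2 * eta * x ^+ 2 <= expR (2 * eta * x) by near: x; apply: near_poly_expR.
have X3 : 3 / e * x ^+ 2 <= expR (eta / 8 * x) by near: x; apply: near_poly_expR.
have x0 : 0 <= x := le_trans ler01 x1.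
have ex : eta * x <= x by rewrite ler_piMl.
have mx' : m%:R <= x by move: mx ex x0; clear; move: (m%:R : R) (eta * x) => u v; lra.
pose G := expR (- (eta * x ^+ 2 / 4)).
set T := expR (2 * eta * x).
have T0 : 0 < T by apply: expR_gt0.
pose b := k.+1%:R ^+ 2 * (64 * m%:R) ^+ 2 / T.
have b0 : 0 <= b by rewrite /b divr_ge0 ?mulr_ge0 ?sqr_ge0 // ltW.
have bx : b <= expR (- (eta * x)).
  rewrite /b ler_pdivrMr // /T -expRD (_ : - (eta * x) + 2 * eta * x = eta * x); last by ring.
  apply: le_trans X1; have -> : 4096 * x ^+ 4 = x ^+ 2 * (64 * x) ^+ 2 by ring.
  apply: ler_pM; rewrite ?sqr_ge0 //; rewrite lerXn2r ?nnegrE ?mulr_ge0 //.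
  by rewrite ler_wpM2l.
have bk : b ^+ k <= G.
  apply: (@le_trans _ _ (expR (- (eta * x)) ^+ k)).
    by rewrite lerXn2r ?nnegrE ?expR_ge0.
  rewrite -expRM_natl ler_expR mulrN lerN2.
  have -> : eta * x ^+ 2 / 4 = x / 4 * (eta * x) by ring.
  by rewrite ler_wpM2r // mulr_ge0 // ltW.
have Tg : expR (- (T / 8)) <= G.
  rewrite ler_expR lerN2 ler_pdivlMr //; apply: le_trans X2.
  by rewrite (_ : eta * x ^+ 2 / 4 * 8 = 2 * eta * x ^+ 2) //; field.
have G0 : 0 <= G by apply: expR_ge0.
have LE : link_error N T m k <= 3 * x * N * G.
  apply: (@le_trans _ _ (x * N * G + 2 * N * G)).
    apply: lerD; last by rewrite ler_wpM2l // mulr_ge0 // ltW.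
    by apply: ler_pM => //; rewrite ?mulr_ge0 ?exprn_ge0 ?ler_wpM2r // ltW.
  rewrite -mulrDl -mulrDl ler_wpM2r // ler_wpM2r ?(ltW N0) //.
  by move: x1; clear; lra.
apply: (@le_trans _ _ (m%:R * N ^+ m.-1 * (3 * x * N * G))).
  by rewrite ler_wpM2l // mulr_ge0 // exprn_ge0 // ltW.
have -> : m%:R * N ^+ m.-1 * (3 * x * N * G) = 3 * x * m%:R * (N ^+ m * G).
  have -> : N ^+ m = N * N ^+ m.-1 by rewrite -exprS prednK.
  ring.
apply: (@le_trans _ _ (3 * x * x * expR (- (eta * x ^+ 2 / 8)))).
  apply: ler_pM; rewrite ?mulr_ge0 ?exprn_ge0 ?(ltW N0) //.
    by rewrite ler_wpM2l // mulr_ge0.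
  apply: (@le_trans _ _ (expR (2 * x) ^+ m * G)).
    by rewrite ler_wpM2r // lerXn2r ?nnegrE ?expR_ge0 // ltW.
  rewrite -expRM_natl -expRD ler_expR.
  have h : m%:R * (2 * x) <= eta * x / 16 * (2 * x) by rewrite ler_wpM2r // mulr_ge0.
  apply: le_trans (lerD h (lexx _)) _.
  rewrite (_ : eta * x / 16 * (2 * x) - eta * x ^+ 2 / 4 = - (eta * x ^+ 2 / 8)) //.
  by field.
rewrite expRN ler_pdivrMr ?expR_gt0 //.
have X4 : expR (eta / 8 * x) <= expR (eta * x ^+ 2 / 8).
  rewrite ler_expR (_ : eta * x ^+ 2 / 8 = eta / 8 * x * x); last by ring.
  by rewrite ler_peMr // mulr_ge0 // ltW.
have -> : 3 * x * x = e * (3 / e * x ^+ 2) by field; rewrite gt_eqF.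
by rewrite ler_wpM2l ?(ltW e0) // (le_trans X3).
Unshelve. all: by end_near. Qed.

(** [norm_trace] gives only moments whose order is a power of two, so one is chosen within a factor
    4 of $\ln n$. *)
Lemma dyadic_between (x : R) : 4 <= x -> exists j, x / 4 <= (2 ^ j)%:R /\ (2 ^ j).+1%:R <= x.
Proof.
move=> x4; have x0 : 0 <= x by lra.
have /andP[K1 K2] := truncn_itv x0; set K := Num.truncn x in K1 K2.
have K4 : (4 <= K)%N by rewrite truncn_ge_nat.
have K0 : (0 < K.-1)%N by lia.
have /andP[h1 h2] := trunc_log_bounds (isT : 1 < 2)%N K0.
exists (trunc_log 2 K.-1); set w := (2 ^ trunc_log 2 K.-1)%N in h1 *.
rewrite expnS -/w in h2; split; last by apply: le_trans K1; rewrite ler_nat; lia.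
have h3 : K.+1%:R <= 4 * w%:R :> R by rewrite -natrM ler_nat; lia.
by rewrite ler_pdivrMr // mulrC; apply: le_trans h3; apply: ltW.
Qed.

End Regime.

(** * All links are good with high probability *)

Section Links.
Variables (R : realType) (p P : R) (ps : forall n : nat, {set 'I_n.+1} -> R).
Hypothesis p0 : 0 < p.
Hypothesis pP : p <= P.
Hypothesis P1 : P < 1.
Hypothesis psp : forall (n : nat) (s : {set 'I_n.+1}), s \in admissible n -> p <= ps s <= P.
Hypothesis hom : homogeneous ps.

Lemma ext_param_hom n (s t : {set 'I_n.+1}) : #|s| = #|t| ->
  ext_param (ps (n:=n)) s = ext_param (ps (n:=n)) t.
Proof.
move=> st; have adm : (s \in admissible n) = (t \in admissible n).
  rewrite !inE -!card_gt0 st; congr (_ && ~~ _).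
  by rewrite !eqEcard !finset.subsetT /= st.
by rewrite /ext_param -adm; case: ifP => // sa; apply: hom; rewrite -?adm.
Qed.

(** Each block probability is at least $(1-P)^{2^i}$, where $i\le m-1$ is the size of the complement
    of [r]; the product of the two is at least $(1-P)^{2^m}$, which is the origin of the bound on
    [T0]. The prefactor counts the links. *)
Lemma inexact_prob n (m j : nat) (T0 : R) : (0 < m)%N -> (2 * m.+1 <= n.+1)%N -> 32 <= T0 ->
  T0 <= n.+1%:R * expR (- (- ln (1 - P) * 2 ^+ m)) ->
  Pr (ext_param (ps (n:=n)))
    (fun X => ~~ `[< forall K, (n.+1 <= K + m)%N -> rel_exact (outer X) K >]) <=
  m%:R * n.+1%:R ^+ m.-1 * link_error n.+1%:R T0 m (2 ^ j).
Proof.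
move=> m0 mn T32 T0n; set a := - ln (1 - P) in T0n.
have P0 : 0 < P := lt_le_trans p0 pP.
have a0 : 0 < a by apply: dual_gt0.
pose pp := ext_param (ps (n:=n)).
have pp01 := ext_param01 (@ps01 R p P ps p0 P1 psp n).
have ppP := ext_param_le p0 pP (@psp n).
pose Q := link_prob pp 1; pose q := link_prob pp 2.
pose T r := n.+1%:R * Q r * q r.
pose c (r : {set 'I_n.+1}) : R := 64 * #|~: r|.+1%:R.
have lpi k (r : {set 'I_n.+1}) : expR (- (a * 2 ^+ #|~: r|)) <= link_prob pp k r <= 1.
  have := link_prob_itv pp01 k r (ltW P0) (ltW P1) ppP.
  by rewrite -(expR_dual P1) -/a -expRM_natl mulrN mulrC natrX.
have lp0 k r : 0 < link_prob pp k r.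
  by case/andP: (lpi k r) => h _; apply: lt_le_trans h; apply: expR_gt0.
have lp1 k r : link_prob pp k r <= 1 by case/andP: (lpi k r).
have T0T r : (#|~: r| <= m.-1)%N -> T0 <= T r.
  move=> rm; apply: le_trans T0n _; rewrite /T -mulrA ler_wpM2l //.
  apply: (@le_trans _ _ (expR (- (a * 2 ^+ #|~: r|)) * expR (- (a * 2 ^+ #|~: r|)))).
    rewrite -expRD ler_expR -opprD lerN2 -mulrDr ler_wpM2l ?(ltW a0) //.
    apply: (@le_trans _ _ (2 ^+ #|~: r|.+1)); first by rewrite exprS mulr_natl mulr2n.
    by rewrite ler_weXn2l ?ler1n //; lia.
  by apply: ler_pM; rewrite ?expR_ge0 //; [case/andP: (lpi 1%N r) | case/andP: (lpi 2%N r)].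
have N0 : 0 < n.+1%:R :> R by rewrite ltr0n.
pose good r X := good_link (q r) r X ((T r / c r) ^+ (2 * 2 ^ j)) j
    (Num.truncn (n.+1%:R * Q r / 8)) (Num.truncn (T r / 8)).
apply: (@le_trans _ _ (Pr pp (fun X => [exists (r : {set 'I_n.+1} | (#|~: r| <= m.-1)%N), ~~ good r X]))).
  apply: (le_Pr_admissible (@ps01 R p P ps p0 P1 psp n)) => X XA; apply: contraR.
  rewrite negb_exists_in => /forall_inP H; apply/asboolP => K Km.
  apply: (@good_link_exact n R q (fun r => T r / c r) j m.-1
    (fun r => Num.truncn (n.+1%:R * Q r / 8)) (fun r => Num.truncn (T r / 8)) X).
  - exact: outerT.
  - move=> r rm; have := H r rm; rewrite negbK => gd.
    have q01 : 0 < q r <= 1 by rewrite lp0 lp1.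
    have Tr32 : 32 <= n.+1%:R * Q r * q r := le_trans T32 (T0T r rm).
    have [k0 s1 t0 _ num] := link_params #|~: r| N0 (lp0 1%N r) q01 Tr32.
    by apply/and5P; split; rewrite ?lp0 ?(ltW k0) ?s1 ?t0 //; apply/andP; split.
  - by rewrite prednK.
apply: le_trans (Pr_union pp01 _ _) _.
have E0 : 0 <= link_error n.+1%:R T0 m (2 ^ j).
  have T00 : 0 < T0 by apply: lt_le_trans T32.
  rewrite addr_ge0 ?mulr_ge0 ?exprn_ge0 ?expR_ge0 //.
  by rewrite divr_ge0 ?mulr_ge0 ?sqr_ge0 // ltW.
apply: (@le_trans _ _ (\sum_(r : {set 'I_n.+1} | (#|~: r| <= m.-1)%N) link_error n.+1%:R T0 m (2 ^ j))).
  apply: ler_sum => r rm.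
  have rm' : (2 * (#|~: r| + 2) <= n.+1)%N.
    by apply: leq_trans mn; rewrite leq_mul2l /= addn2 ltnS -(prednK m0) ltnS.
  have Tr32 : 32 <= n.+1%:R * Q r * q r := le_trans T32 (T0T r rm).
  have HQ v : v \in r -> pavoid pp (block r [set v]%SET) = Q r.
    by move=> vr; apply: (link_probE (@ext_param_hom n)); rewrite ?cards1 // finset.sub1set.
  have Hq (e : {set 'I_n.+1}) : #|e| = 2%N -> e \subset r -> pavoid pp (block r e) = q r.
    by move=> e2 er; apply: (link_probE (@ext_param_hom n)).
  apply: le_trans (bad_link_bound pp01 j HQ Hq (lp0 1%N r) (lp1 1%N r) (lp0 2%N r) (lp1 2%N r) rm' Tr32) _.
  apply: le_trans (link_error_le (m' := #|~: r|.+1) (m := m) (2 ^ j) (ltW N0) _ (T0T r rm) _).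
  - by [].
  - by apply: lt_le_trans T32.
  - by rewrite -(prednK m0) ltnS.
by have := @count_small_compl R n m.-1 (link_error n.+1%:R T0 m (2 ^ j)) E0; rewrite prednK.
Qed.

Lemma near_links (delta0 e : R) : 0 < delta0 -> 0 < e ->
  \forall n \near \oo,
  let h := log2 (ln (n%:R : R)) - log2 (- ln (1 - P)) - delta0 in
  0 <= h /\ Pr (ext_param (ps (n:=n)))
    (fun X => ~~ `[< forall K, (n.+1 <= K + Num.truncn h)%N -> rel_exact (outer X) K >]) <= e.
Proof.
move=> d0 e0; set a := - ln (1 - P).
have a0 : 0 < a by apply: dual_gt0 => //; apply: lt_le_trans p0 pP.
(* Since $a2^m\le2^{-\delta_0}\ln n$, this makes $n(1-P)^{2^m}$ at least $n^{2\eta}$. *)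
pose eta : R := (1 - pow2 (- delta0)) / 2.
have g1 : pow2 (- delta0) < 1.
  by rewrite -expR0 /pow2 ltr_expR pmulr_llt0 ?ln2_gt0 // oppr_lt0.
have g0 := pow2_gt0 (- delta0).
have eta0 : 0 < eta by rewrite /eta; lra.
have eta1 : eta <= 1 by rewrite /eta; lra.
pose C := - log2 a - delta0.
have c16 : 0 < eta / 16 by rewrite divr_gt0.
have two_eta : 0 < 2 * eta by rewrite mulr_gt0.
have reg : \forall x \near +oo, [/\ 4 <= x, 1 <= log2 x + C, log2 x + C <= eta / 16 * x,
    log2 x + (C + 1) <= 2^-1 * x & 32 <= expR (2 * eta * x)].
  near=> x; split.
  - by near: x; apply: nbhs_pinfty_ge; rewrite num_real.
  - rewrite -lerBlDr; near: x; apply: (@near_log2 R (fun y => 1 - C <= y)).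
    by apply: nbhs_pinfty_ge; rewrite num_real.
  - by near: x; apply: near_log2_le.
  - by near: x; apply: near_log2_le.
  - have : 32 * x ^+ 0 <= expR (2 * eta * x) by near: x; apply: near_poly_expR.
    by rewrite expr0 mulr1.
near=> n.
have n0 : (0 < n)%N by near: n; apply: near_nat_pos.
have [] := near (near_ln_nat reg) n; first by [].
have := near (near_ln_nat (near_link_error eta0 eta1 e0)) n.
set x : R := ln n%:R => err x4 h1 h2 h3 T32.
set h := log2 x - log2 a - delta0.
have hE : h = log2 x + C by rewrite /h /C addrA.
have h0 : 0 <= h by rewrite hE (le_trans _ h1).
split => //; set m := Num.truncn h.
have /andP[mh _] := truncn_itv h0; rewrite -/m in mh.
have m0 : (0 < m)%N by rewrite truncn_ge_nat // hE.
have [j [j1 j2]] := dyadic_between x4.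
have xn : x <= n%:R.
  apply: le_trans (_ : 1 + x <= _); first by rewrite lerDr.
  by apply: le_trans (expR_ge1Dx _) _; rewrite lnK ?posrE ?ltr0n.
have x0 : 0 < x by apply: lt_le_trans x4.
have mn : (2 * m.+1 <= n.+1)%N.
  rewrite -(ler_nat R); apply: (@le_trans _ _ n%:R); last by rewrite ler_nat.
  apply: le_trans xn; rewrite natrM mulrC -ler_pdivlMr // [x / 2]mulrC.
  by apply: le_trans h3; rewrite -natr1 addrA lerD2r -hE.
have nx : n%:R = expR x by rewrite lnK ?posrE ?ltr0n.
have T0n : expR (2 * eta * x) <= n.+1%:R * expR (- (a * 2 ^+ m)).
  apply: (@le_trans _ _ (n%:R * expR (- (a * 2 ^+ m)))); last by rewrite ler_wpM2r ?expR_ge0 // ler_nat.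
  rewrite nx -expRD ler_expR lerBrDl -lerBrDr.
  apply: (@le_trans _ _ (a * pow2 h)); first by rewrite ler_wpM2l ?(ltW a0) // -pow2_nat le_pow2.
  rewrite /h !pow2D pow2N !log2K // /eta.
  rewrite (_ : a * (x / a * pow2 (- delta0)) = x * pow2 (- delta0)); last by field; rewrite gt_eqF.
  rewrite (_ : x - 2 * ((1 - pow2 (- delta0)) / 2) * x = x * pow2 (- delta0)) //.
  by field.
apply: le_trans (inexact_prob j m0 mn T32 T0n) _.
apply: err => //.
- rewrite mulr_natl mulr2n expRD -nx; apply: (@le_trans _ _ (n%:R * 2)).
    by rewrite -natrM ler_nat muln2 -addnn -addn1 leq_add2l.
  rewrite ler_wpM2l // nx; apply: le_trans (expR_ge1Dx _).
  by rewrite -[2]/(1 + 1) lerD2l (le_trans _ x4) // ler1n.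
- by apply: le_trans mh _; rewrite hE mulrAC.
Unshelve. all: by end_near. Qed.

End Links.

(** * Conclusion *)

Section Vanishing.
Variables (R : realType) (n : nat) (X : {set {set 'I_n.+1}}).
Hypothesis XA : X \subset admissible n.

Lemma floor_truncn (x : R) : 0 <= x -> Num.floor x = (Num.truncn x)%:Z.
Proof. by move=> x0; rewrite truncn_floor x0 gez0_abs // floor_ge0. Qed.

Lemma skel_codim_bounds (h h' : R) : 0 <= h -> 0 <= h' ->
  (Num.truncn h <= n)%N -> (Num.truncn h' <= n)%N ->
  [exists (c : {set 'I_n.+1} | #|c| == Num.truncn h), outer X (~: c)%SET] ->
  ~~ [exists (c : {set 'I_n.+1} | #|c| == Num.truncn h'), outer X (~: c)%SET] ->
  (Num.floor h + 1 <= (skel_codim (upper_cplx X))%:Z) && ((skel_codim (upper_cplx X))%:R <= h').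
Proof.
move=> h0 h0' dn dn' miss full; apply/andP; split.
  rewrite floor_truncn // lezD1 ltz_nat skel_codim_gt //.
  by rewrite contains_skelP // negbK.
apply: le_trans (_ : (Num.truncn h')%:R <= _); last by rewrite truncn_le.
by rewrite ler_nat skel_codim_le ?leqW // contains_skelP.
Qed.

Lemma rbetti_vanish (h h' : R) : 0 <= h -> 0 <= h' -> (Num.truncn h' <= n)%N ->
  (forall K, (n.+1 <= K + Num.truncn h)%N -> rel_exact (outer X) K) ->
  ~~ [exists (c : {set 'I_n.+1} | #|c| == Num.truncn h'), outer X (~: c)%SET] ->
  forall j : int, ~ (h + 1 < n%:R - j%:~R <= h') -> rbetti (upper_cplx X) j = 0%N.
Proof.
move=> h0 h0' dn' ex full j hj.
case: (ltP j (-1)) => jlt; first by rewrite /rbetti jlt.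
have [k kE] : exists k : nat, j = k%:Z - 1.
  exists (absz (j + 1)); rewrite gez0_abs ?addrK //.
  by rewrite -(lerD2r (- 1)) add0r addrK.
rewrite kE; apply: rbetti_upper => //.
have jR : n%:R - j%:~R = n%:R - k%:R + 1 :> R by rewrite kE rmorphB /= opprB addrA addrAC.
rewrite jR in hj.
have {hj} [hj|hj] : n%:R - k%:R <= h \/ h' < n%:R - k%:R + 1.
  case: (lerP (n%:R - k%:R) h) => c1; [by left|right].
  by rewrite ltNge; apply/negP => c2; apply: hj; rewrite ltrD2r c1 c2.
- apply: ex; rewrite addSn ltnS; case: (leqP k n) => kn; last by rewrite (leq_trans (ltnW kn)) // leq_addr.
  by rewrite -leq_subLR truncn_ge_nat // natrB.
apply: rel_exact_empty => s Us; apply/eqP => sk.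
have := contains_skelP dn' XA; rewrite full => /forallP/(_ s)/implyP.
have s0 : s != finset.set0 by rewrite -card_gt0 sk.
have kd : (#|s| + Num.truncn h' <= n.+1)%N.
  have h1 : (Num.truncn h')%:R < n%:R - k%:R + 1 :> R by apply: le_lt_trans hj; rewrite truncn_le.
  by rewrite sk addSn addnC -(ltr_nat R) natrD -natr1 -ltrBrDr addrAC.
by rewrite s0 kd => /(_ isT); rewrite mem_upper // Us.
Qed.

End Vanishing.

Theorem theorem3p2 (R : realType) (p P : R)
    (ps : forall n : nat, {set 'I_n.+1} -> R) :
  0 < p -> p <= P -> P < 1 ->
  (forall (n : nat) (s : {set 'I_n.+1}), s \in admissible n ->
     p <= ps n s <= P) ->
  let a' := - ln (1 - p) in
  let A' := - ln (1 - P) in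
  [/\ (fun n : nat => prob (ps n) (fun Y => cdim Y == n%:Z - 1)) @ \oo --> (1 : R),
      (forall eps0 : R, 0 < eps0 ->
         (fun n : nat => prob (ps n) (fun Y =>
            (Num.floor (beta n A') + 1 <= (skel_codim Y)%:Z) &&
            ((skel_codim Y)%:R <= beta n a' + 1 + eps0))) @ \oo --> (1 : R)) &
      (homogeneous ps -> forall eps0 delta0 : R, 0 < eps0 -> 0 < delta0 ->
         (fun n : nat => prob (ps n) (fun Y =>
            `[< forall j : int,
                  ~ (log2 (ln (n%:R : R)) - log2 A' + 1 - delta0 < n%:R - j%:~R
                     <= beta n a' + 1 + eps0) ->
                  rbetti Y j = 0%N >])) @ \oo --> (1 : R))].
Proof.
move=> p0 pP P1 psp a' A'.
have ps01n n : forall s, s \in admissible n -> 0 <= ps n s <= 1 := @ps01 R p P ps p0 P1 psp n.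
split.
- apply: cvg_to_one => [n|e e0]; first exact: prob_le1 (ps01n n) _.
  near=> n; apply: le_trans (prob_dim (ps01n n) p0 pP P1 (psp n) _); last first.
    by near: n; apply: near_nat_pos.
  rewrite lerD2l lerN2; apply: (@le_trans _ _ (expR (n.+1%:R * - p))).
    rewrite expRM_natl lerXn2r ?nnegrE ?expR_ge0 ?subr_ge0 ?expR_ge1Dx //.
    exact: ltW (le_lt_trans pP P1).
  rewrite -[leRHS]lnK ?posrE // ler_expR mulrN lerNl -ler_pdivrMr //.
  apply: (@le_trans _ _ n%:R); last by rewrite ler_nat.
  by near: n; apply: nbhs_infty_ger.
- move=> eps0 eps00; apply: cvg_to_one => [n|e e0]; first exact: prob_le1 (ps01n n) _.
  have e2 : 0 < e / 2 by rewrite divr_gt0.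
  near=> n.
  have [//|h0' dn' full] := near (near_skeleton p0 pP P1 psp eps00 e2) n.
  have [//|h0 dn miss] := near (near_missing_face p0 pP P1 psp e2) n.
  apply: (prob_ge (ps01n n) _ (le_trans (Pr_or (ext_param01 (ps01n n)) _ _)
    (le_trans (lerD full miss) _))); last by rewrite -splitr.
  move=> X XA; rewrite negb_or => /andP[full' /negPn miss'].
exact: skel_codim_bounds.
- move=> hom eps0 delta0 eps00 delta00; apply: cvg_to_one => [n|e e0].
    exact: prob_le1 (ps01n n) _.
  have e2 : 0 < e / 2 by rewrite divr_gt0.
  near=> n.
  have [//|h0' dn' full] := near (near_skeleton p0 pP P1 psp eps00 e2) n.
  have [//|h0 ex] := near (near_links p0 pP P1 psp hom delta00 e2) n.
  apply: (prob_ge (ps01n n) _ (le_trans (Pr_or (ext_param01 (ps01n n)) _ _)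
    (le_trans (lerD full ex) _))); last by rewrite -splitr.
  move=> X XA; rewrite negb_or => /andP[full' /negPn/asboolP ex'].
  apply/asboolP => j; rewrite addrAC.
  exact: (rbetti_vanish XA h0 h0' dn' ex' full').
Unshelve. all: by end_near. Qed.
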